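(* Let $d\ge 1$ and let $W:\mathbb{R}^d\to\mathbb{R}\cup\{+\infty\}$ be lower semicontinuous, bounded from below by a finite constant, locally integrable and symmetric ($W(-x)=W(x)$ for all $x$). Suppose that the limit $W_\infty:=\lim_{|x|\to\infty}W(x)$ exists in $\mathbb{R}\cup\{+\infty\}$, that there is $R_W>0$ such that $W$ is radially strictly increasing on $\mathbb{R}^d\setminus B_{R_W}$, and that one of the following two properties holds: (A) $W$ is bounded from above and upper semicontinuous; (B) $W$ is $\beta$-repulsive for some $2<\beta<d$, $W\in C^1(\mathbb{R}^d\setminus\{0\})$, and there is $C_W>0$ such that $\Delta^0W(x)\le C_W$ for all $x\in\mathbb{R}^d$, $W(x)\le C_W|x|^{2-\beta}$ for all $|x|\le 1$, and $|\nabla W(x)|\le C_W|x|^{1-\beta}$ for all $0<|x|\le 1$. Then for any $N\ge 2$ the discrete energy $E_N$ has a minimiser on $\mathbb{R}^{Nd}$, and for any sequence $(\boldsymbol{X}_N)_{N\ge 2}$ such that $\boldsymbol{X}_N\in\mathbb{R}^{Nd}$ is a minimiser of $E_N$ for each $N\ge2$, the following hold: (1) If $W$ is unstable, then the diameter of $\boldsymbol{X}_N$ is bounded uniformly in $N$, and $(\boldsymbol{X}_N)_{N\ge 2}$ has a subsequence which, up to translations, converges narrowly as $N\to\infty$ to a minimiser of the continuum energy $E$ on $\mathcal{P}(\mathbb{R}^d)$. (2) If $W$ is strictly stable, then the diameter of $\boldsymbol{X}_N$ tends to $\infty$ as $N\to\infty$.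
   Context: $B_R(z)$ is the open ball of radius $R$ and centre $z$ in $\mathbb{R}^d$, $B_R:=B_R(0)$. $\mathcal{P}(\mathbb{R}^d)$ is the set of Borel probability measures on $\mathbb{R}^d$, with the narrow topology (duality with bounded continuous functions). ''Radially strictly increasing on $\mathbb{R}^d\setminus B_{R_W}$'' means $W(x)<W(y)$ whenever $R_W\le |x|<|y|$. Energies. For $N\ge2$ and $\boldsymbol{X}=(x_1,\dots,x_N)\in\mathbb{R}^{Nd}$ (each $x_i\in\mathbb{R}^d$), $E_N(\boldsymbol{X})=\frac{1}{2N^2}\sum_{i=1}^N\sum_{j\neq i}W(x_i-x_j)$. For $\rho\in\mathcal{P}(\mathbb{R}^d)$, $E(\rho)=\frac12\int\int W(x-y)\,d\rho(x)\,d\rho(y)\in\mathbb{R}\cup\{+\infty\}$. ''Minimiser'' means global minimiser. Configurations. The diameter of $\boldsymbol{X}$ is the diameter of the set $\{x_1,\dots,x_N\}$; the empirical measure is $\mu_{\boldsymbol{X}}=\frac1N\sum_{i=1}^N\delta_{x_i}$. $(\boldsymbol{X}_N)$ converges narrowly to $\rho$ if $\mu_{\boldsymbol{X}_N}\to\rho$ narrowly; ''up to translations'' means after replacing each $\boldsymbol{X}_N=(x_1,\dots,x_N)$ by $(x_1-a_N,\dots,x_N-a_N)$ for a suitable $a_N\in\mathbb{R}^d$. Stability. $W$ is unstable if there is $\rho\in\mathcal{P}(\mathbb{R}^d)$ with $E(\rho)<\frac12W_\infty$; $W$ is strictly stable if $E(\rho)>\frac12W_\infty$ for all $\rho\in\mathcal{P}(\mathbb{R}^d)$.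 Generalised Laplacian. For $W$ locally integrable and $\varepsilon>0$, $\Delta^\varepsilon W(x)=\frac{2(d+2)}{\varepsilon^2}\left(\frac{1}{|B_\varepsilon|}\int_{B_\varepsilon}W(x+y)\,dy-W(x)\right)$ (equal to $-\infty$ if $W(x)=+\infty$), and $\Delta^0W(x)=\liminf_{\varepsilon\to0}\Delta^\varepsilon W(x)\in[-\infty,+\infty]$. For $\beta>0$, $W$ is $\beta$-repulsive (at the origin) if it is locally integrable and there exist $\delta>0$, $C>0$ with $-\Delta^0W(x)\ge C|x|^{-\beta}$ for all $0<|x|<\delta$ and $-\Delta^0W(0)=+\infty$. In (B), $|0|^{2-\beta}=+\infty$. *)

(* Defs.v *)
From HB Require Import structures.
From mathcomp Require Import all_boot all_order all_algebra.
From mathcomp Require Import all_classical all_reals all_analysis.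
From mathcomp Require Import measurable_realfun.

Set Implicit Arguments.
Unset Strict Implicit.
Unset Printing Implicit Defensive.

Import Order.TTheory GRing.Theory Num.Theory.
Import numFieldNormedType.Exports.

Local Open Scope classical_set_scope.
Local Open Scope ring_scope.

(* R^d is 'rV[R]_d, for an arbitrary R : realType, with its Borel sigma-algebra. *)
HB.instance Definition _ (R : realType) (d : nat) :=
  @isMeasurable.Build (sigma_display (@open 'rV[R]_d)) 'rV[R]_d
    <<s @open 'rV[R]_d >> (@sigma_algebra0 _ setT _) (@sigma_algebraC _ _)
    (@sigma_algebra_bigcup _ setT _).

Section borel_rV.
Context {R : realType}.

Lemma open_measurable_rV d (U : set 'rV[R]_d) : open U -> measurable U.
Proof. exact: sub_sigma_algebra. Qed.

Lemma measurable_coord d (i : 'I_d) :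
  measurable_fun setT (fun x : 'rV[R]_d => x ord0 i).
Proof.
apply: (measurability _ (RGenOpens.measurableE R)).
move=> _ [_ [a [b ->] <-]]; rewrite setTI.
apply: open_measurable_rV; apply: open_comp; last exact: interval_open.
by move=> x _; exact: coord_continuous.
Qed.

Lemma rat_ball_basis d (U : set 'rV[R]_d) : open U ->
  U = \bigcup_(q in [set q : 'rV[rat]_d * rat |
        ball (map_mx ratr q.1 : 'rV[R]_d) (ratr q.2) `<=` U])
      ball (map_mx ratr q.1 : 'rV[R]_d) (ratr q.2).
Proof.
move=> oU; apply/seteqP; split => [x Ux|x [q qU] /qU//].
have /nbhs_ballP[e /= e0 eU] : nbhs x U by exact: open_nbhs_nbhs.
have [r] : exists r : rat, (ratr r : R) \in `]0, (e / 2)[.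
  by apply: rat_in_itvoo; rewrite divr_gt0.
rewrite in_itv/= => /andP[r0 re].
have /choice[q qx] : forall i, exists p : rat, `|ratr p - x ord0 i| < ratr r.
  move=> i; have [p] : exists p : rat,
      (ratr p : R) \in `](x ord0 i - ratr r), (x ord0 i + ratr r)[.
    by apply: rat_in_itvoo; rewrite ltrD2l gtrN.
  by rewrite in_itv/= -ltr_distl => pr; exists p.
have bx : ball (map_mx ratr (\row_i q i) : 'rV[R]_d) (ratr r) x.
  by split => // i j; rewrite !mxE ord1; exact: qx.
exists (\row_i q i, r) => //= y yb; apply: eU.
have := ball_triangle (ball_sym bx) yb.
by apply: le_ball; rewrite (splitr e) lerD ?ltW.
Qed.

Lemma measurable_rV d0 (T : measurableType d0) d (f : T -> 'rV[R]_d) :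
  (forall i, measurable_fun setT (fun t => f t ord0 i)) -> measurable_fun setT f.
Proof.
move=> mf; apply: (@measurability _ _ _ _ _ _ (@open 'rV[R]_d)) => //.
move=> _ [U oU <-]; rewrite setTI (rat_ball_basis oU) preimage_bigcup.
rewrite bigcup_mkcond; apply: countable_bigcupT_measurable => // -[q r].
case: ifPn => // _.
have [r0|r0] := ltP 0 (ratr r : R); last first.
  rewrite (_ : _ @^-1` _ = set0)//; apply/seteqP; split => // t [/=].
  by rewrite ltNge r0.
rewrite (_ : _ @^-1` _ = \bigcap_(i in [set: 'I_d])
    ((fun t => f t ord0 i) @^-1` ball (ratr (q ord0 i) : R) (ratr r))); last first.
  apply/seteqP; split => [t [_ /= b] i _ /=|t tb].
    by have := b ord0 i; rewrite mxE.
  by split => // i j; rewrite ord1 mxE; exact: tb.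
apply: fin_bigcap_measurable => // i _.
rewrite -[X in measurable X]setTI; apply: mf => //.
by apply: open_measurable; exact: ball_open.
Qed.

End borel_rV.

Section lebesgue_step.
Context {R : realType} (d : nat).
Variable mu : {sigma_finite_measure set 'rV[R]_d -> \bar R}.
Local Open Scope ereal_scope.

Definition consrV (p : R * 'rV[R]_d) : 'rV[R]_d.+1 :=
  row_mx (p.1%:M : 'rV_1) p.2.

Definition unconsrV (x : 'rV[R]_d.+1) : R * 'rV[R]_d :=
  (x ord0 ord0, \row_j x ord0 (lift ord0 j)).

Lemma consrVE0 p : consrV p ord0 ord0 = p.1.
Proof.
by rewrite /consrV mxE; case: splitP => // j _; rewrite (ord1 j) mxE eqxx.
Qed.

Lemma consrVES p j : consrV p ord0 (lift ord0 j) = p.2 ord0 j.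
Proof.
rewrite /consrV mxE; case: splitP => [[[]]//|i [/val_inj->]//].
Qed.

Lemma consrVK : cancel consrV unconsrV.
Proof.
move=> [x y]; rewrite /unconsrV consrVE0; congr pair.
by apply/rowP => j; rewrite mxE consrVES.
Qed.

Lemma measurable_consrV : measurable_fun setT consrV.
Proof.
apply: measurable_rV => i; have [j ->|->] := unliftP ord0 i.
  rewrite (_ : (fun _ => _) = (fun y : 'rV_d => y ord0 j) \o snd).
    by apply: measurableT_comp => //; exact: measurable_coord.
  by apply/funext => p; rewrite consrVES.
rewrite (_ : (fun _ => _) = fst)//.
by apply/funext => p; rewrite consrVE0.
Qed.

Lemma measurable_unconsrV : measurable_fun setT unconsrV.
Proof.
apply: measurable_fun_pair; first exact: measurable_coord.
apply: measurable_rV => i; under eq_fun do rewrite mxE.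
exact: measurable_coord.
Qed.

Definition lebesgue_step (A : set 'rV[R]_d.+1) : \bar R :=
  (@lebesgue_measure R \x mu) (consrV @^-1` A).

Let step0 : lebesgue_step set0 = 0.
Proof. by rewrite /lebesgue_step preimage_set0 measure0. Qed.

Let step_ge0 A : 0 <= lebesgue_step A.
Proof. exact: measure_ge0. Qed.

Let step_sigma_additive : semi_sigma_additive lebesgue_step.
Proof.
move=> F mF tF mUF; rewrite /lebesgue_step preimage_bigcup.
apply: measure_semi_sigma_additive.
- by move=> n; rewrite -[X in measurable X]setTI; exact: measurable_consrV.
- apply/trivIsetP => /= i j _ _ ij; rewrite -preimage_setI.
  by move/trivIsetP : tF => /(_ _ _ _ _ ij) ->//; rewrite preimage_set0.
- by rewrite -preimage_bigcup -[X in measurable X]setTI;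
    exact: measurable_consrV.
Qed.

HB.instance Definition _ := isMeasure.Build _ _ _
  lebesgue_step step0 step_ge0 step_sigma_additive.

Let step_sigma_finite : sigma_finite setT lebesgue_step.
Proof.
have /sigma_finiteP[F [UF ndF mF]] := sigma_finiteT (@lebesgue_measure R).
have /sigma_finiteP[G [UG ndG mG]] := sigma_finiteT mu.
exists (fun n => unconsrV @^-1` (F n `*` G n)).
  apply/seteqP; split => // x _.
  have [n _ Fn] : (\bigcup_i F i) (unconsrV x).1 by rewrite -UF.
  have [k _ Gk] : (\bigcup_i G i) (unconsrV x).2 by rewrite -UG.
  exists (maxn n k) => //; split => /=.
    by move: Fn; exact/subsetPset/ndF/leq_maxl.
  by move: Gk; exact/subsetPset/ndG/leq_maxr.
move=> n; have [mFn Fn] := mF n; have [mGn Gn] := mG n; split.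
  rewrite -[X in measurable X]setTI.
  by apply: measurable_unconsrV => //; exact: measurableX.
rewrite /lebesgue_step -comp_preimage.
rewrite (_ : unconsrV \o consrV = id); last first.
  by apply/funext => p; exact: consrVK.
by rewrite preimage_id product_measure1E// lte_mul_pinfty// ge0_fin_numE.
Qed.

HB.instance Definition _ := Measure_isSigmaFinite.Build _ _ _
  lebesgue_step step_sigma_finite.

End lebesgue_step.

(* d-dimensional Lebesgue measure: the d-fold product of the Lebesgue measure on
   R, transported to row vectors (lebesgue_rV_box gives its value on boxes). *)
Fixpoint lebesgue_rV {R : realType} (d : nat) :
    {sigma_finite_measure set 'rV[R]_d -> \bar R} :=
  match d with
  | 0 => [the {sigma_finite_measure set 'rV[R]_0 -> \bar R} of \d_(0 : 'rV[R]_0)]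
  | d'.+1 => [the {sigma_finite_measure set 'rV[R]_d'.+1 -> \bar R} of
               lebesgue_step (lebesgue_rV d')]
  end.

Section lebesgue_box.
Context {R : realType}.
Local Open Scope ereal_scope.

Lemma measurable_box d (A : 'I_d -> set R) : (forall i, measurable (A i)) ->
  measurable [set x : 'rV[R]_d | forall i, A i (x ord0 i)].
Proof.
move=> mA; rewrite (_ : [set _ | _] =
    \bigcap_(i in [set: 'I_d]) ((fun x : 'rV[R]_d => x ord0 i) @^-1` A i)).
  apply: fin_bigcap_measurable => // i _; rewrite -[X in measurable X]setTI.
  exact: (@measurable_coord R d i measurableT _ (mA i)).
by apply/seteqP; split => [x /= Ax i _|x /= Ax i]; exact: Ax.
Qed.

Lemma lebesgue_rV_box d (A : 'I_d -> set R) : (forall i, measurable (A i)) ->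
  lebesgue_rV d [set x : 'rV[R]_d | forall i, A i (x ord0 i)] =
  \prod_(i < d) @lebesgue_measure R (A i).
Proof.
elim: d A => [|d IH] A mA.
  by rewrite big_ord0 /= diracE mem_set//; case.
rewrite big_ord_recl -IH; last by move=> i; exact: mA.
have mB := @measurable_box d (fun i => A (lift ord0 i)) (fun i => mA _).
have := product_measure1E lebesgue_measure (lebesgue_rV d) (mA ord0) mB.
move=> /= <-; rewrite /lebesgue_step; congr product_measure1.
apply/seteqP; split => -[x y] /=.
  move=> Axy; split => [|i]; first by have := Axy ord0; rewrite consrVE0.
  by have := Axy (lift ord0 i); rewrite consrVES.
move=> [Ax Ay] i; have [j ->|->] := unliftP ord0 i; last by rewrite consrVE0.
by rewrite consrVES; exact: Ay.
Qed.

End lebesgue_box.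

Section euclidean.
Context {R : realType} {d : nat}.
Implicit Types (x y z : 'rV[R]_d).

(* The library norm `|x| on 'rV[R]_d is the maximum norm; it induces the usual
   topology, which is the one used below for open, compact, continuous, etc. *)
Definition enorm x : R := Num.sqrt (\sum_(i < d) x ord0 i ^+ 2).

Definition eball z (r : R) : set 'rV[R]_d := [set x | enorm (x - z) < r].

Definition enorm_infty : set_system 'rV[R]_d :=
  filter_from [set: R] (fun M => [set x | M < enorm x]).

Definition diameter (A : set 'rV[R]_d) : R :=
  sup [set enorm (p.1 - p.2) | p in A `*` A].

(* r `^ a, with the value +oo (instead of 0) at r = 0; meant for a < 0. *)
Definition sing_pow (r a : R) : \bar R :=
  if r == 0 then +oo%E else (r `^ a)%:E.

End euclidean.

Section potential.
Context {R : realType} {d : nat}.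
Local Notation mu := (@lebesgue_rV R d).
Implicit Types (W : 'rV[R]_d -> \bar R) (x : 'rV[R]_d).
Local Open Scope ereal_scope.

Definition upper_semicontinuous W := forall x a, W x < a%:E ->
  exists2 V, nbhs x V & forall y, V y -> W y < a%:E.

Definition locally_integrable_rV W := measurable_fun setT W /\
  forall K, compact K -> \int[mu]_(x in K) `|W x| < +oo.

(* If W x = +oo this is -oo, since the average of a locally integrable W is
   finite. *)
Definition laplacian_eps (e : R) W x : \bar R :=
  (2 * (d%:R + 2) / e ^+ 2)%:E *
  ((mu (eball 0 e))^-1 * (\int[mu]_(y in eball 0 e) W (x + y)%R) - W x).

Definition laplacian0 W x : \bar R :=
  limf_einf (fun e : R => laplacian_eps e W x) (0%R^'+).

Definition repulsive (b : R) W :=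
  locally_integrable_rV W /\
  exists delta C : R, [/\ (0 < delta)%R, (0 < C)%R,
    forall x, (0 < enorm x < delta)%R ->
      (C * enorm x `^ (- b))%:E <= - laplacian0 W x &
    - laplacian0 W 0%R = +oo].

Definition gradient W x : 'rV[R]_d :=
  \row_(i < d) 'D_('e_i) (fine \o W : 'rV[R]_d -> R^o) x.

(* C^1 on R^d \ {0}; in particular W is real-valued there. *)
Definition C1_off0 W := forall x, x != 0%R ->
  [/\ W x \is a fin_num,
      differentiable (fine \o W : 'rV[R]_d -> R^o) x &
      {for x, continuous (gradient W)}].

Definition radially_strictly_increasing (r : R) W :=
  forall x y, (r <= enorm x)%R -> (enorm x < enorm y)%R -> W x < W y.

End potential.

Section energies.
Context {R : realType} {d : nat}.
Implicit Types (W : 'rV[R]_d -> \bar R) (rho : probability 'rV[R]_d R).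
Local Open Scope ereal_scope.

Definition discrete_energy W (N : nat) (X : 'I_N -> 'rV[R]_d) : \bar R :=
  ((2 * N%:R ^+ 2)^-1)%:E *
  \sum_(i < N) \sum_(j < N | j != i) W (X i - X j)%R.

Definition energy W rho : \bar R :=
  (2^-1)%:E * \int[rho]_x \int[rho]_y W (x - y)%R.

Definition discrete_minimiser W (N : nat) (X : 'I_N -> 'rV[R]_d) :=
  forall Y : 'I_N -> 'rV[R]_d, discrete_energy W X <= discrete_energy W Y.

Definition minimiser W rho :=
  forall nu : probability 'rV[R]_d R, energy W rho <= energy W nu.

Definition unstable W (Winf : \bar R) :=
  exists rho, energy W rho < (2^-1)%:E * Winf.

Definition strictly_stable W (Winf : \bar R) :=
  forall rho, (2^-1)%:E * Winf < energy W rho.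

End energies.

Section empirical.
Context {R : realType} {d : nat} (N : nat) (X : 'I_N -> 'rV[R]_d).
Local Open Scope ereal_scope.

(* A probability measure when N > 0, see empirical_setT. *)
Definition empirical (A : set 'rV[R]_d) : \bar R :=
  (N%:R^-1)%:E * \sum_(i < N) \d_(X i) A.

Let empirical0 : empirical set0 = 0.
Proof. by rewrite /empirical big1 ?mule0// => i _; rewrite measure0. Qed.

Let empirical_ge0 A : 0 <= empirical A.
Proof. by rewrite mule_ge0// sume_ge0. Qed.

Let empirical_sigma_additive : semi_sigma_additive empirical.
Proof.
move=> F mF tF mUF; rewrite [X in _ --> X](_ : _ =
    limn (fun n => \sum_(0 <= i < n) empirical (F i))).
  by apply: is_cvg_ereal_nneg_natsum => k _; exact: empirical_ge0.
rewrite nneseriesZl//; last by move=> i _; exact: sume_ge0.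
rewrite nneseries_sum//; congr (_ * _); apply: eq_bigr => /= i _.
exact: measure_semi_bigcup.
Qed.

HB.instance Definition _ := isMeasure.Build _ _ _
  empirical empirical0 empirical_ge0 empirical_sigma_additive.

Lemma empirical_setT : (0 < N)%N -> empirical setT = 1.
Proof.
move=> N0; rewrite /empirical (eq_bigr (fun=> 1%:E)); last first.
  by move=> i _; rewrite diracT.
by rewrite sumEFin sumr_const card_ord -EFinM mulVf// pnatr_eq0 -lt0n.
Qed.

End empirical.

Definition narrow_cvg {R : realType} {d : nat}
    (m : nat -> {measure set 'rV[R]_d -> \bar R})
    (rho : probability 'rV[R]_d R) :=
  forall f : 'rV[R]_d -> R, continuous f ->
    (exists M : R, forall x, `|f x| <= M) ->
    (\int[m n]_x (f x)%:E)%E @[n --> \oo] --> (\int[rho]_x (f x)%:E)%E.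

(* Main.v *)
(* After subtracting a lower bound, W >= 0. If a coordinate of the points of a
   minimiser has a gap of length RW, pushing the two groups together decreases the
   energy; hence minimisers of E_N in a large box have no gap and are global.

   Drawing N points independently from rho shows N^2 E_N <= N (N - 1) E(rho). So if
   W is unstable, some particle i of a minimiser has mean potential at most e < Winf.
   Moving any other particle next to i (exactly on it in case (A)) bounds the
   potential of every particle by a constant less than Winf, so a fixed fraction of
   the particles is at bounded distance from each particle. Since there are no gaps,
   the diameter is bounded.

   In case (B) the particle cannot be put on i, but only at i + y, with y drawn from
   a law nu such that the mean of W(z + y) is at most a W(z) + g, with a e + g < Winf.
   Barriers for the generalised Laplacian compare W near 0 with the Riesz potential
   |x|^(2 - b), whose averages over cubes are bounded, and compare the values of W
   at neighbouring points at infinity. If Winf = +oo the uniform law of one cube is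
   enough; otherwise nu is an average over cubes of n very different sizes: for each
   z, all but one of these cubes are either so small that W(z + y) <= W(z) + k, or so
   large compared with |z| that W(z) exceeds the mean of W(z + y).

   Configurations in a bounded box are compact: coding points by binary digits, a
   subsequence of the empirical measures has converging frequencies for all finite
   words, and the limit law is realised on [0, 1[ by nested intervals. Fatou's lemma
   gives E(rho) <= liminf E_N, so limits of minimisers are minimisers. If diameters
   stay bounded along a subsequence, the limit has E(rho) <= Winf / 2, because points
   far apart already achieve that bound, which contradicts strict stability. *)
Require Import Defs.
From HB Require Import structures.
From mathcomp Require Import all_boot all_order all_algebra.
From mathcomp Require Import all_classical all_reals all_analysis.
From mathcomp Require Import measurable_realfun.
From mathcomp Require Import lra ring.

Set Implicit Arguments.
Unset Strict Implicit.
Unset Printing Implicit Defensive.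

Import Order.TTheory GRing.Theory Num.Theory.
Import numFieldNormedType.Exports.

Local Open Scope classical_set_scope.
Local Open Scope ring_scope.

(** * Lower semicontinuous pair energies *)

(** All estimates concern V = W - c >= 0, with limit Vinf = Winf - c, so that integrals make sense
    in [0, +oo] and inequalities may be multiplicative in V. The comparison used for a minimiser is
    isolated in [doubling]: the mean of V(z + y) is at most a V(z) + g for every z. Summed over the
    particles, it turns the bound e on the mean potential of one particle into the bound a e + g for
    all of them, up to a constant independent of N that pays for the pair formed by the moved
    particle and its target. The obstacle is case (B) with Vinf finite: e may be as close to Vinf as
    one likes, so a must be close to 1 and g close to 0, whereas the bound for one cube costs a
    fixed factor when |z| is in some window of radii. The n cubes are chosen with disjoint windows;
    each z then pays the factor for at most one cube, of weight 1 / n. This needs V to be comparable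
    with the Riesz potential from both sides near 0: the upper bound controls averages over cubes,
    the lower one turns them back into multiples of V(z). *)

Lemma ereal_dense {R : realType} (a b : \bar R) : (a < b)%E ->
  exists r : R, (a < r%:E < b)%E.
Proof.
case: a => [a||]; case: b => [b||] //=; rewrite ?lte_fin => ab.
- by exists ((a + b) / 2); rewrite !lte_fin; apply/andP; split; lra.
- by exists (a + 1); rewrite lte_fin ltry andbT; lra.
- by exists (b - 1); rewrite lte_fin ltNyr /=; lra.
- by exists 0; rewrite ltNyr ltry.
Qed.

Lemma lsc_compact_min {T : topologicalType} {R : realType} (f : T -> \bar R)
    (K : set T) : lower_semicontinuous f -> compact K -> K !=set0 ->
  exists2 x, K x & forall y, K y -> (f x <= f y)%E.
Proof.
move=> lscf cK [x0 Kx0].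
pose m := ereal_inf (f @` K).
have mle y : K y -> (m <= f y)%E by move=> Ky; apply: ereal_inf_lbound; exists y.
have [mfx0|mfx0] := leP (f x0) m.
  by exists x0 => // y /mle; exact: le_trans.
(* The sublevel sets at levels a > m form a proper filter on K. It has a cluster point x, and m < f
   x would give a neighbourhood of x missed by one of these sets. *)
pose F := filter_from [set a : \bar R | (m < a)%E]
  (fun a => K `&` [set x | (f x <= a)%E]).
have FF : ProperFilter F.
  apply: filter_from_proper; last first.
    move=> a /= ma; have [_ [y Ky <-] ya] := ereal_inf_lt ma.
    by exists y; split => //=; exact: ltW.
  apply: filter_from_filter; first by exists (f x0).
  move=> a b /= ma mb; exists (Order.min a b); first by rewrite /= lt_min ma mb.
  by move=> y [Ky] /=; rewrite le_min => /andP[ya yb]; do 2 split.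
have FK : F K by exists (f x0) => // y [].
have [x [Kx clx]] := cK F FF FK; exists x => // y /mle; apply: le_trans.
rewrite leNgt; apply/negP => mfx.
have [b /andP[mb bfx]] : exists b : R, (m < b%:E < f x)%E.
  exact: ereal_dense.
have [V nV VP] := lscf _ _ bfx.
have Fb : F (K `&` [set y | (f y <= b%:E)%E]) by exists b%:E.
have [z [[_ /= zb] Vz]] := clx _ _ Fb nV.
by have := VP _ Vz; rewrite ltNge zb.
Qed.

Lemma lscD {T : topologicalType} {R : realType} (f g : T -> \bar R) :
  (forall x, 0 <= f x)%E -> (forall x, 0 <= g x)%E ->
  lower_semicontinuous f -> lower_semicontinuous g ->
  lower_semicontinuous (fun x => f x + g x)%E.
Proof.
move=> f0 g0 lf lg x a afg.
suff [[b c]/= [abc bf cg]] : exists p : R * R,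
    [/\ a <= p.1 + p.2, (p.1%:E < f x)%E & (p.2%:E < g x)%E].
  have [V nV fV] := lf _ _ bf; have [U nU gU] := lg _ _ cg.
  exists (V `&` U); first exact: filterI.
  move=> y [/fV yb /gU yc]; apply: (@le_lt_trans _ _ (b + c)%:E).
    by rewrite lee_fin.
  by rewrite EFinD; exact: lteD.
move: (f0 x) (g0 x) afg; case: (f x) => [u||]; case: (g x) => [v||] //=.
- rewrite -EFinD lte_fin => _ _ auv.
  exists (u - (u + v - a) / 2, v - (u + v - a) / 2); rewrite /= !lte_fin.
  by split; lra.
- move=> _ _ _; exists (u - 1, a - u + 1); rewrite /= ltry lte_fin.
  by split => //; lra.
- move=> _ _ _; exists (a - v + 1, v - 1); rewrite /= ltry lte_fin.
  by split => //; lra.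
- move=> _ _ _; exists (a, 0); rewrite /= !ltry; split => //; lra.
Qed.

Lemma lsc_cst {T : topologicalType} {R : realType} (c : \bar R) :
  lower_semicontinuous (fun _ : T => c).
Proof. by move=> x a ac; exists setT => //; exact: filterT. Qed.

Lemma lsc_sum {T : topologicalType} {R : realType} (I : Type) (s : seq I)
    (P : pred I) (f : I -> T -> \bar R) :
  (forall i x, 0 <= f i x)%E -> (forall i, lower_semicontinuous (f i)) ->
  lower_semicontinuous (fun x => \sum_(i <- s | P i) f i x)%E.
Proof.
move=> f0 lf; elim: s => [|i s IH].
  rewrite (_ : (fun x => _) = fun=> 0%E); first exact: lsc_cst.
  by apply/funext => x; rewrite big_nil.
rewrite (_ : (fun x => _) = fun x =>
    ((if P i then f i x else 0) + \sum_(j <- s | P j) f j x)%E); last first.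
  by apply/funext => x; rewrite big_cons; case: ifP => // _; rewrite add0e.
apply: lscD => // [x|x|]; [by case: ifP|exact: sume_ge0|].
by case: (P i); [exact: lf|exact: lsc_cst].
Qed.

Lemma lsc_comp {T U : topologicalType} {R : realType} (f : U -> \bar R)
    (g : T -> U) : lower_semicontinuous f -> continuous g ->
  lower_semicontinuous (f \o g).
Proof.
move=> lf cg x a /lf[V nV fV]; exists (g @^-1` V); first exact: cg.
by move=> y /fV.
Qed.

Section pair_sum.
Context {R : realType} {d : nat}.
Implicit Types W : 'rV[R]_d -> \bar R.
Local Open Scope ereal_scope.

Definition pair_sum W (N : nat) (X : 'I_N -> 'rV[R]_d) : \bar R :=
  \sum_(i < N) \sum_(j < N | j != i) W (X i - X j)%R.

Lemma discrete_energyE W N (X : 'I_N -> 'rV[R]_d) :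
  discrete_energy W X = ((2 * N%:R ^+ 2)^-1)%:E * pair_sum W X.
Proof. by []. Qed.

Lemma discrete_minimiserP W N (X : 'I_N -> 'rV[R]_d) : (0 < N)%N ->
  discrete_minimiser W X <->
  forall Y : 'I_N -> 'rV[R]_d, pair_sum W X <= pair_sum W Y.
Proof.
move=> N0; have N2 : (0 < (2 * N%:R ^+ 2)^-1 :> R)%R.
  by rewrite invr_gt0 mulr_gt0// exprn_gt0// ltr0n.
split=> XY Y; have := XY Y; rewrite !discrete_energyE.
  by rewrite lee_pmul2l.
by rewrite lee_pmul2l.
Qed.

Lemma box_pair_sum_min W N (A : set 'rV[R]_d) :
  (forall x, 0 <= W x) -> lower_semicontinuous W -> compact A -> A !=set0 ->
  exists2 X : 'I_N -> 'rV[R]_d, (forall i, A (X i)) &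
    forall Y : 'I_N -> 'rV[R]_d, (forall i, A (Y i)) -> pair_sum W X <= pair_sum W Y.
Proof.
move=> W0 lW cA [a Aa].
pose T : topologicalType := prod_topology (fun _ : 'I_N => 'rV[R]_d).
have lsE : lower_semicontinuous (fun X : T => pair_sum W X).
  apply: lsc_sum => [i X|i]; first exact: sume_ge0.
  apply: lsc_sum => // j.
  apply: (@lsc_comp _ _ _ W (fun X : T => (X i - X j)%R)) => // X.
  have pc k : continuous (fun X : T => X k : 'rV[R]_d).
    by move=> Y; have := @proj_continuous 'I_N (fun=> 'rV[R]_d) k Y.
  exact: (cvgB (pc i X) (pc j X)).
have cT := @tychonoff _ (fun _ : 'I_N => 'rV[R]_d) (fun=> A) (fun=> cA).
have [|X XA XY] := @lsc_compact_min T R _ _ lsE cT.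
  by exists (fun=> a).
by exists X.
Qed.

End pair_sum.

(** * Euclidean norm and gaps in configurations *)

Section enorm_theory.
Context {R : realType} {d : nat}.
Implicit Types x y z : 'rV[R]_d.

Lemma enorm_ge0 x : 0 <= enorm x.
Proof. exact: sqrtr_ge0. Qed.

Lemma sqr_enorm x : enorm x ^+ 2 = \sum_(i < d) x ord0 i ^+ 2.
Proof. by rewrite sqr_sqrtr// sumr_ge0// => i _; exact: sqr_ge0. Qed.

Lemma enormN x : enorm (- x) = enorm x.
Proof.
by rewrite /enorm; congr Num.sqrt; apply: eq_bigr => i _; rewrite mxE sqrrN.
Qed.

Lemma enorm0 : enorm (0 : 'rV[R]_d) = 0.
Proof. by rewrite /enorm big1 ?sqrtr0// => i _; rewrite mxE expr0n. Qed.

Lemma coord_le_enorm x i : `|x ord0 i| <= enorm x.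
Proof.
rewrite -ler_sqr ?nnegrE ?enorm_ge0//.
rewrite sqr_enorm real_normK ?num_real// (bigD1 i)//= lerDl.
by apply: sumr_ge0 => j _; exact: sqr_ge0.
Qed.

Lemma coord_le_norm x i : `|x ord0 i| <= `|x|.
Proof.
rewrite [X in _ <= X]/Num.norm/= mx_normrE.
by rewrite (le_trans _ (le_bigmax _ _ (ord0, i))).
Qed.

Lemma norm_le_coord x r : 0 <= r -> (forall i, `|x ord0 i| <= r) -> `|x| <= r.
Proof.
move=> r0 xr; rewrite /Num.norm/= mx_normrE.
by apply: bigmax_le => // -[i j] _ /=; rewrite (ord1 i).
Qed.

Lemma norm_lt_coord x r : 0 < r -> (forall i, `|x ord0 i| < r) -> `|x| < r.
Proof.
move=> r0 xr; rewrite /Num.norm/= mx_normrE.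
by apply: bigmax_lt => // -[i j] _ /=; rewrite (ord1 i).
Qed.

Lemma norm_le_enorm x : `|x| <= enorm x.
Proof. by apply: norm_le_coord; [exact: enorm_ge0|exact: coord_le_enorm]. Qed.

Lemma enorm_le_norm x : enorm x <= d%:R * `|x|.
Proof.
rewrite -ler_sqr ?nnegrE ?enorm_ge0 ?mulr_ge0//.
rewrite sqr_enorm exprMn (@le_trans _ _ (\sum_(i < d) `|x| ^+ 2))//.
  apply: ler_sum => i _; rewrite -[leLHS]real_normK ?num_real//.
  by rewrite ler_sqr ?nnegrE//; exact: coord_le_norm.
rewrite sumr_const card_ord -[leLHS]mulr_natl; apply: ler_wpM2r; first exact: sqr_ge0.
rewrite -natrX ler_nat -mulnn; have [->//|d0] := posnP d; exact: leq_pmulr.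
Qed.

Lemma enorm_lt_coord x y k : (forall l, l != k -> x ord0 l = y ord0 l) ->
  `|x ord0 k| < `|y ord0 k| -> enorm x < enorm y.
Proof.
move=> xy xyk; rewrite -ltr_sqr ?nnegrE ?enorm_ge0// !sqr_enorm.
rewrite (bigD1 k)//= [ltRHS](bigD1 k)//=.
rewrite (eq_bigr (fun i => y ord0 i ^+ 2)); last by move=> i /xy ->.
rewrite ltrD2r -[ltLHS]real_normK ?num_real// -[ltRHS]real_normK ?num_real//.
by rewrite ltr_sqr ?nnegrE.
Qed.

End enorm_theory.

Section gap.
Context {R : realType} {d : nat}.
Variables (W : 'rV[R]_d -> \bar R) (RW : R) (N : nat).
Hypotheses (W0 : forall x, (0 <= W x)%E) (RW0 : 0 < RW)
  (Wi : radially_strictly_increasing RW W).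
Implicit Types X : 'I_N -> 'rV[R]_d.

(* The part of the configuration beyond the gap is pushed back until the gap has
   width RW: distances across the gap decrease and remain at least RW. *)
Lemma gap_shift X k s : (pair_sum W X < +oo)%E ->
  (exists i, X i ord0 k < s) -> (exists i, s + RW <= X i ord0 k) ->
  (forall i, ~ s <= X i ord0 k < s + RW) ->
  exists X', [/\ (pair_sum W X' < pair_sum W X)%E,
    forall i l, X' i ord0 l <= X i ord0 l &
    forall i l, exists j, X j ord0 l <= X' i ord0 l].
Proof.
have RWp := RW0; move=> Xfin [i0 i0s] [j0 j0s] gap.
have gapP i : X i ord0 k < s \/ (s <= X i ord0 k /\ s + RW <= X i ord0 k).
  have [|si] := ltP (X i ord0 k) s; [by left|right; split => //].
  by rewrite leNgt; apply/negP => iR; apply: (gap i); rewrite si.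
pose i1 := [arg max_(i > i0 | X i ord0 k < s) X i ord0 k]%O.
have [i1s i1max] : X i1 ord0 k < s /\
    forall i, X i ord0 k < s -> X i ord0 k <= X i1 ord0 k.
  by rewrite /i1; case: arg_maxP.
(* [i1] is the last particle before the gap. The particles beyond s + RW are shifted by the distance
   from [i1] to s, hence stay at least RW beyond [i1]. *)
clearbody i1; pose tau := s - X i1 ord0 k; have tau0 : 0 < tau by rewrite subr_gt0.
pose X' i : 'rV[R]_d :=
  \row_l (X i ord0 l - (if (l == k) && (s <= X i ord0 k) then tau else 0)).
have WX i j : (W (X' i - X' j)%R <= W (X i - X j)%R)%E /\
    (X i ord0 k < s -> s <= X j ord0 k -> (W (X' i - X' j)%R < W (X i - X j)%R)%E).
  have key : (X i ord0 k < s /\ s <= X j ord0 k) \/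
      (s <= X i ord0 k /\ X j ord0 k < s) ->
      (W (X' i - X' j)%R < W (X i - X j)%R)%E.
    move=> ij.
    have ijk : RW <= `|(X' i - X' j) ord0 k| < `|(X i - X j) ord0 k|.
      rewrite !mxE eqxx /=; case: ij => -[iS jS].
        rewrite [s <= X i _ _]leNgt iS jS /=; have := i1max _ iS.
        have [|[_ js]] := gapP j; first by rewrite ltNge jS.
        move=> h; rewrite ltr0_norm; last by rewrite /tau; lra.
        by rewrite ltr0_norm /tau; [apply/andP; split; lra|lra].
      rewrite [s <= X j _ _]leNgt jS iS /=; have := i1max _ jS.
      have [|[_ js]] := gapP i; first by rewrite ltNge iS.
      move=> h; rewrite gtr0_norm; last by rewrite /tau; lra.
      by rewrite gtr0_norm /tau; [apply/andP; split; lra|lra].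
    case/andP: ijk => RWk lk; apply: Wi.
      by apply: le_trans RWk _; exact: coord_le_enorm.
    by apply: enorm_lt_coord lk => l lk; rewrite !mxE (negPf lk) /= !subr0.
  split; last by move=> iS jS; apply: key; left.
  have [iS|iS] := ltP (X i ord0 k) s; have [jS|jS] := ltP (X j ord0 k) s.
  - rewrite (_ : X' i - X' j = X i - X j)//; apply/rowP => l; rewrite !mxE.
    by rewrite !(leNgt s) iS jS !andbF !subr0.
  - by apply/ltW/key; left.
  - by apply/ltW/key; right.
  - rewrite (_ : X' i - X' j = X i - X j)//; apply/rowP => l; rewrite !mxE.
    by rewrite iS jS !andbT; ring.
exists X'; split.
- have j0s' : s <= X j0 ord0 k by apply: le_trans j0s; rewrite lerDl ltW.
  have ji : j0 != i0.
    by apply/eqP => ji; move: j0s'; rewrite ji leNgt i0s.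
  (* The pair (i0, j0) lies across the gap and gives the strict decrease; it is singled out because
     strictness survives in the sum only if the other terms have a finite sum. *)
  have D (f : 'I_N -> 'I_N -> \bar R) :
      (\sum_(i < N) \sum_(j < N | j != i) f i j = f i0 j0 +
        \sum_(p : 'I_N * 'I_N | (p.2 != p.1) && (p != (i0, j0))) f p.1 p.2)%E.
    by rewrite pair_big_dep /= (bigD1 (i0, j0)).
  move: Xfin; rewrite /pair_sum !D => Xfin.
  have le1 : (\sum_(p | (p.2 != p.1) && (p != (i0, j0))) W (X' p.1 - X' p.2)%R
     <= \sum_(p | (p.2 != p.1) && (p != (i0, j0))) W (X p.1 - X p.2)%R)%E.
    by apply: lee_sum => p _; exact: (WX _ _).1.
  apply: lte_leD => //; last exact: (WX _ _).2.
  rewrite ge0_fin_numE ?sume_ge0//; apply: le_lt_trans le1 _.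
  by apply: le_lt_trans Xfin; rewrite leeDr.
- move=> i l; rewrite mxE lerBlDr lerDl; case: ifP => // _; exact: ltW.
- move=> i l; rewrite mxE; case: ifPn => [/andP[/eqP -> si]|_]; last first.
    by exists i; rewrite subr0.
  exists i1; have [|[_ is_]] := gapP i; first by rewrite ltNge si.
  by rewrite /tau; lra.
Qed.

End gap.

(** If the spread were larger, K windows of length D, separated by 2 r, would fit between t i and t
    j. Each contains some t (f l) since there is no gap, and the r-neighbourhoods of these points
    are disjoint with at least m N indices each, which makes more than N indices. *)
Lemma spread_bound {R : realType} (N : nat) (t : 'I_N -> R) (D r m : R) (K : nat) :
  0 < D -> 0 < r -> 1 < K%:R * m ->
  (forall s, (exists i, t i < s) -> (exists i, s + D <= t i) ->
    exists i, s <= t i < s + D) ->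
  (forall i, m * N%:R <= #|[pred j | `|t j - t i| < r]|%:R) ->
  forall i j, t j - t i <= K.+1%:R * (2 * r + 2 * D).
Proof.
move=> D0 r0 Km nogap dense i j; rewrite leNgt; apply/negP => far.
pose G := 2 * r + D; have G0 : 0 < G by rewrite /G; lra.
have /choice[f fP] : forall l : 'I_K, exists a,
    t i + l%:R * G + D <= t a < t i + l%:R * G + D + D.
  move=> l; apply: nogap.
    exists i; rewrite -addrA ltrDl.
    by rewrite ltr_wpDl// mulr_ge0// ltW.
  exists j; have lK : l%:R * G <= K%:R * G by rewrite ler_pM2r// ler_nat ltnW.
  have : K.+1%:R * (2 * r + 2 * D) = K%:R * G + K%:R * D + 2 * r + 2 * D.
    by rewrite /G -natr1; ring.
  have : 0 <= K%:R * D by rewrite mulr_ge0// ltW.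
  by move: far; lra.
pose B l := [pred a | `|t a - t (f l)| < r].
have Bdisj l l' a : a \in B l -> a \in B l' -> l = l'.
  wlog ll : l l' / (l <= l')%N.
    by move=> h; have [/h//|/ltnW/h h' x y] := leqP l l'; rewrite (h' y x).
  rewrite !inE !ltr_distl => /andP[a1 a2] /andP[a3 a4].
  apply/val_inj/eqP; rewrite /= eqn_leq ll /= leqNgt; apply/negP => lt.
  have /andP[b1 b2] := fP l; have /andP[b3 b4] := fP l'.
  have : l%:R * G + G <= l'%:R * G.
    by rewrite -[X in _ + X]mul1r -mulrDl natr1 ler_pM2r// ler_nat.
  rewrite {2}/G; lra.
have card_le : (\sum_(l < K) #|B l| <= N)%N.
  rewrite -[X in (_ <= X)%N](card_ord N) -[X in (_ <= X)%N]sum1_card.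
  rewrite (eq_bigr (fun l => \sum_(a < N) if a \in B l then 1 else 0)%N); last first.
    by move=> l _; rewrite -big_mkcond sum1_card.
  rewrite exchange_big /=; apply: leq_sum => a _.
  have [l0 al0|no] := pickP (fun l => a \in B l).
    rewrite (bigD1 l0)//= al0 big1 ?addn0// => l /negP ll0.
    by case: ifP => // al; case: ll0; rewrite (Bdisj _ _ _ al al0).
  by rewrite big1// => l _; rewrite no.
have N0 : 0 < N%:R :> R by rewrite ltr0n (leq_ltn_trans _ (ltn_ord i)).
have : K%:R * (m * N%:R) <= N%:R.
  apply: (@le_trans _ _ (\sum_(l < K) #|B l|%:R)).
    rewrite mulr_natl -[X in _ *+ X](card_ord K) -sumr_const.
    by apply: ler_sum => l _; exact: dense.
  by rewrite -natr_sum ler_nat.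
by rewrite mulrA -[leRHS]mul1r ler_pM2r// leNgt Km.
Qed.

Section box.
Context {R : realType} {d : nat}.

Definition box (L : R) : set 'rV[R]_d := [set x | forall k, 0 <= x ord0 k <= L].

Lemma box_compact L : compact (box L).
Proof.
have := @rV_compact _ d (fun=> `[0, L]%classic) (fun=> @segment_compact R 0 L).
by congr compact; apply/seteqP; split => x /= h k; have := h k; rewrite /= in_itv.
Qed.

Lemma enormZ (a : R) (x : 'rV[R]_d) : enorm (a *: x) = `|a| * enorm x.
Proof.
rewrite /enorm (eq_bigr (fun i => a ^+ 2 * x ord0 i ^+ 2)); last first.
  by move=> i _; rewrite mxE exprMn.
by rewrite -mulr_sumr sqrtrM ?sqr_ge0// sqrtr_sqr.
Qed.

End box.

(** * Existence of minimisers for a fixed number of particles *)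

Section existence.
Context {R : realType} {d : nat}.
Variables (W : 'rV[R]_d -> \bar R) (RW : R) (N : nat).
Hypotheses (W0 : forall x, (0 <= W x)%E) (RW0 : 0 < RW)
  (Wi : radially_strictly_increasing RW W).
Implicit Types X : 'I_N -> 'rV[R]_d.

Lemma pair_sum_translate X a : pair_sum W (fun i => X i - a) = pair_sum W X.
Proof.
apply: eq_bigr => i _; apply: eq_bigr => j _.
by rewrite opprB addrA subrK.
Qed.

Lemma increasing_fin x : RW <= enorm x -> (W x < +oo)%E.
Proof.
move=> xR; have x0 : 0 < enorm x by exact: lt_le_trans xR.
apply: (@lt_le_trans _ _ (W (2 *: x))); last exact: leey.
by apply: Wi => //; rewrite enormZ ger0_norm// ltr_pMl// ltr1n.
Qed.

(** Minimality is asked only against configurations within the coordinate range of X, so that the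
    lemma applies to minimisers in a box as well as to global ones. *)
Lemma no_gap X : (pair_sum W X < +oo)%E ->
  (forall X', (forall i l, X' i ord0 l <= X i ord0 l) ->
    (forall i l, exists j, X j ord0 l <= X' i ord0 l) ->
    (pair_sum W X <= pair_sum W X')%E) ->
  forall k s, (exists i, X i ord0 k < s) -> (exists i, s + RW <= X i ord0 k) ->
    exists i, s <= X i ord0 k < s + RW.
Proof.
move=> Xfin Xmin k s il ir; apply: contrapT => /forallNP gap.
have [X' [X'X X'u X'l]] := gap_shift W0 RW0 Wi Xfin il ir gap.
by have := Xmin _ X'u X'l; rewrite leNgt X'X.
Qed.

(** Each particle counts itself, which is a fraction 1 / N of all. The resulting bound grows with N,
    but suffices for existence at fixed N. *)
Lemma no_gap_spread X : (forall k s, (exists i, X i ord0 k < s) ->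
    (exists i, s + RW <= X i ord0 k) -> exists i, s <= X i ord0 k < s + RW) ->
  forall i j k, X j ord0 k - X i ord0 k <= N.+2%:R * (2 * RW + 2 * RW).
Proof.
move=> gap i j k.
have N0 : 0 < N%:R :> R by rewrite ltr0n (leq_ltn_trans _ (ltn_ord i)).
apply: (@spread_bound _ _ (fun i => X i ord0 k) RW RW N%:R^-1 N.+1) => //.
- by rewrite ltr_pdivlMr// mul1r ltr_nat.
- exact: gap.
- move=> l; rewrite mulVf ?gt_eqF// ler1n lt0n; apply/eqP => /card0_eq /(_ l).
  by rewrite !inE subrr normr0 RW0.
Qed.

Lemma minimiser_exists : (1 <= d)%N -> (0 < N)%N -> lower_semicontinuous W ->
  exists X, forall Y : 'I_N -> 'rV[R]_d, (pair_sum W X <= pair_sum W Y)%E.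
Proof.
move=> d1 N0 lW; pose C0 := N.+2%:R * (2 * RW + 2 * RW).
have C00 : 0 <= C0 by rewrite mulr_ge0// addr_ge0// mulr_ge0// ltW.
have box0 L : 0 <= L -> @box R d L !=set0.
  by move=> L0; exists (0 : 'rV[R]_d) => k; rewrite mxE lexx.
have [X0 X0A X0min] := @box_pair_sum_min _ _ W N _ W0 lW (@box_compact R d C0)
  (box0 _ C00).
exists X0 => Y; pose M := \sum_(i < N) `|Y i|.
have YM i k : `|Y i ord0 k| <= M.
  apply: le_trans (coord_le_norm _ _) _; rewrite /M (bigD1 i)//= lerDl.
  exact: sumr_ge0.
have M0 : 0 <= M by apply: sumr_ge0.
pose L := 2 * M; have L0 : 0 <= L by rewrite mulr_ge0.
(* This second box depends on Y. Its minimiser X has no gap, so a translate of X lies in the first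
   box, whose side C0 does not depend on Y and where X0 is minimal. *)
have [X XA Xmin] := @box_pair_sum_min _ _ W N _ W0 lW (@box_compact R d L)
  (box0 _ L0).
apply: (@le_trans _ _ (pair_sum W X)); last first.
  rewrite -(pair_sum_translate Y (const_mx (- M))); apply: Xmin => i k.
  have := YM i k; rewrite ler_norml !mxE /L => /andP[? ?]; apply/andP; split; lra.
have [Xoo|Xfin] := leP +oo%E (pair_sum W X); first exact: le_trans (leey _) Xoo.
have gap := @no_gap X Xfin.
have sp : forall i j k, X j ord0 k - X i ord0 k <= C0.
  apply: no_gap_spread; apply: gap => X' X'u X'l; apply: Xmin => i k.
  have /andP[_ u] := XA i k; rewrite (le_trans (X'u _ _) u) andbT.
  have [j jX] := X'l i k; have /andP[l _] := XA j k; exact: le_trans jX.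
have i0 : 'I_N := Ordinal N0.
pose m k := X [arg min_(i < i0) X i ord0 k]%O ord0 k.
have mP i k : m k <= X i ord0 k.
  by rewrite /m; case: arg_minP => // j _; apply.
rewrite -(pair_sum_translate X (\row_k m k)); apply: X0min => i k.
by rewrite !mxE subr_ge0 mP /= sp.
Qed.

End existence.

(** * Averaging over independent points *)

Section random_choice.
Local Open Scope ereal_scope.

Lemma natEDl {R : realType} (m n : nat) (x : \bar R) :
  (m + n)%N%:R%:E * x = m%:R%:E * x + n%:R%:E * x.
Proof. by rewrite natrD EFinD ge0_muleDl// lee_fin. Qed.

(** If f exceeded its mean c everywhere, c would be finite and f - c positive with integral 0, hence
    zero almost everywhere: impossible for a measure of mass 1. *)
Lemma exists_le_integral d (T : measurableType d) (R : realType)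
    (P : probability T R) (f : T -> \bar R) :
  measurable_fun setT f -> (forall x, 0 <= f x) ->
  exists x, f x <= \int[P]_x f x.
Proof.
move=> mf f0; apply: contrapT => /forallNP lt.
have {}lt x : \int[P]_x f x < f x by rewrite ltNge; apply/negP.
have I0 : 0 <= \int[P]_x f x by exact: integral_ge0.
have Ifin : \int[P]_x f x \is a fin_num.
  rewrite ge0_fin_numE// (lt_le_trans (lt point)) ?leey//.
set c := \int[P]_x f x in lt I0 Ifin.
have mc : measurable_fun setT (fun x => f x - c) by exact: emeasurable_funB.
have h0 x : 0 <= f x - c by rewrite sube_ge0 ?ltW// Ifin.
have : c = \int[P]_x (f x - c) + c.
  rewrite -[X in _ + X]mule1 -(probability_setT P) -integral_cst//.
  rewrite -ge0_integralD//; apply: eq_integral => x _.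
  by rewrite /cst subeK.
move=> cE; have Ic : \int[P]_x (f x - c) = 0.
  by rewrite -[LHS](addeK _ Ifin) -cE subee.
have : ae_eq P setT (fun x => f x - c) (cst 0).
  apply/ae_eq_integral_abs => //; rewrite -[RHS]Ic.
  by apply: eq_integral => x _; rewrite gee0_abs.
move=> [A [mA PA sA]]; have AT : A = setT.
  apply/seteqP; split => // x _; apply: sA => /= /(_ I) fx.
  by have := lt x; rewrite -sube_gt0 fx ltxx.
by have := probability_setT P; rewrite -AT PA => /esym/eqP; rewrite onee_eq0.
Qed.

Section averaging.
Context {R : realType} {d : nat}.
Variables (W : 'rV[R]_d -> \bar R) (rho : probability 'rV[R]_d R).
Hypotheses (W0 : forall x, 0 <= W x) (mW : measurable_fun setT W)
  (Ws : forall x, W (- x)%R = W x).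

Lemma measurable_rVB :
  measurable_fun setT (fun p : 'rV[R]_d * 'rV[R]_d => (p.1 - p.2)%R).
Proof.
apply: measurable_rV => i.
rewrite (_ : (fun _ => _) = (fun p : 'rV[R]_d * 'rV[R]_d =>
   (p.1 ord0 i - p.2 ord0 i)%R)); last by apply/funext => p; rewrite !mxE.
apply: measurable_funB.
  by apply: (measurableT_comp (measurable_coord i)).
by apply: (measurableT_comp (measurable_coord i)).
Qed.

Lemma measurable_kernel :
  measurable_fun setT (fun p : 'rV[R]_d * 'rV[R]_d => W (p.1 - p.2)%R).
Proof. by apply: (measurableT_comp mW); exact: measurable_rVB. Qed.

Lemma measurable_kernel_l (x : 'rV[R]_d) : measurable_fun setT (fun y : 'rV[R]_d => W (x - y)%R).
Proof. exact: (measurableT_comp measurable_kernel (pair1_measurable x)). Qed.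

Lemma measurable_potential :
  measurable_fun setT (fun x : 'rV[R]_d => \int[rho]_y W (x - y)%R).
Proof.
exact: (measurable_fun_fubini_tonelli_F _ measurable_kernel (fun p => W0 _)).
Qed.

Let U (x : 'rV[R]_d) := \int[rho]_y W (x - y)%R.
Let I := \int[rho]_x U x.
Let S k (X : nat -> 'rV[R]_d) : \bar R :=
  \sum_(i < k) \sum_(j < k | (j : nat) != i) W (X i - X j)%R.

(* Method of conditional expectations: this is the mean pair sum when [k] points
   have been chosen and [r] points remain to be drawn from [rho]. *)
Let Psi k r X := S k X + (2 * r)%:R%:E * (\sum_(i < k) U (X i))
  + (r * r.-1)%:R%:E * I.

Let U0 x : 0 <= U x. Proof. exact: integral_ge0. Qed.
Let I0 : 0 <= I. Proof. exact: integral_ge0. Qed.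
Let S0 k X : 0 <= S k X.
Proof. by apply: sume_ge0 => i _; exact: sume_ge0. Qed.

Let SS k X : S k.+1 X = S k X + 2%:R%:E * \sum_(i < k) W (X i - X k)%R.
Proof.
have lastE (i : nat) : (i < k)%N ->
    \sum_(j < k.+1 | (j : nat) != i) W (X i - X j)%R =
    \sum_(j < k | (j : nat) != i) W (X i - X j)%R + W (X i - X k)%R.
  move=> ik; rewrite big_mkcond big_ord_recr /= -big_mkcond/=.
  by rewrite gtn_eqF.
have diagE : \sum_(j < k.+1 | (j : nat) != k) W (X k - X j)%R =
    \sum_(j < k) W (X j - X k)%R.
  rewrite big_mkcond big_ord_recr /= eqxx/= adde0; apply: eq_bigr => i _.
  by rewrite ltn_eqF// -Ws opprB.
rewrite /S big_ord_recr /=; rewrite (eq_bigr _ (fun (i : 'I_k) _ => lastE i (ltn_ord i))).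
by rewrite diagE big_split /= -addeA (natEDl 1 1) mul1e.
Qed.

Let step k r X : exists x,
  Psi k.+1 r (fun i => if i == k then x else X i) <= Psi k r.+1 X.
Proof.
pose f (x : 'rV[R]_d) := S k X + 2%:R%:E * (\sum_(i < k) W (X i - x)%R)
  + (2 * r)%:R%:E * (\sum_(i < k) U (X i) + U x) + (r * r.-1)%:R%:E * I.
have mf1 : measurable_fun setT (fun x : 'rV[R]_d => \sum_(i < k) W (X i - x)%R).
  by apply: emeasurable_sum => i; exact: measurable_kernel_l.
have f10 x : 0 <= \sum_(i < k) W (X i - x)%R by exact: sume_ge0.
have mU : measurable_fun setT U by exact: measurable_potential.
have SU0 : 0 <= \sum_(i < k) U (X i) by exact: sume_ge0.
have m2 : measurable_fun setT (fun x : 'rV[R]_d => 2%:R%:E * (\sum_(i < k) W (X i - x)%R)).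
  exact: measurable_funeM.
have m3 : measurable_fun setT (fun x : 'rV[R]_d => \sum_(i < k) U (X i) + U x).
  exact: emeasurable_funD.
have m4 : measurable_fun setT (fun x : 'rV[R]_d => (2 * r)%:R%:E * (\sum_(i < k) U (X i) + U x)).
  exact: measurable_funeM.
have p2 x : 0 <= 2%:R%:E * \sum_(i < k) W (X i - x)%R by rewrite mule_ge0.
have p3 x : 0 <= \sum_(i < k) U (X i) + U x by rewrite adde_ge0.
have p4 x : 0 <= (2 * r)%:R%:E * (\sum_(i < k) U (X i) + U x).
  by rewrite mule_ge0// lee_fin.
have p5 : 0 <= (r * r.-1)%:R%:E * I by rewrite mule_ge0// lee_fin.
have m1 : measurable_fun setT
    (fun x : 'rV[R]_d => S k X + 2%:R%:E * (\sum_(i < k) W (X i - x)%R)).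
  exact: emeasurable_funD.
have m5 : measurable_fun setT
    (fun x : 'rV[R]_d => S k X + 2%:R%:E * (\sum_(i < k) W (X i - x)%R)
       + (2 * r)%:R%:E * (\sum_(i < k) U (X i) + U x)).
  exact: emeasurable_funD.
have cst_int (c : \bar R) : \int[rho]_x c = c.
  rewrite -[RHS]mule1 -(probability_setT rho); exact: integral_cst.
(* Integrating over the new point turns W (X i - x) into U (X i) and U x into I. The coefficients
   agree because 2 + 2 r = 2 (r + 1) and 2 r + r (r - 1) = (r + 1) r. *)
have If : \int[rho]_x f x = Psi k r.+1 X.
  rewrite /f ge0_integralD//; last by move=> x _; rewrite !adde_ge0.
  rewrite ge0_integralD//; last by move=> x _; rewrite adde_ge0.
  rewrite ge0_integralD//.
  rewrite !ge0_integralZl_EFin//.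
  rewrite (@ge0_integral_sum _ _ _ rho setT measurableT 'I_k
    (fun i x => W (X i - x)%R) (fun i => measurable_kernel_l (X i)))//.
  rewrite ge0_integralD//.
  rewrite cst_int (cst_int (\sum_(i < k) U (X i))) (cst_int I) -/I.
  rewrite (_ : \sum_(i < k) \int[rho]_x W (X i - x)%R = \sum_(i < k) U (X i))//.
  rewrite /Psi /= -!addeA; congr (_ + _).
  rewrite ge0_muleDr// !addeA -natEDl -mulnS -addeA; congr (_ + _).
  rewrite -natEDl; congr (_%:R%:E * _).
  by case: (r) => //= n; rewrite (mulnC n.+1 n) -mulnDl add2n.
have [x fx] := @exists_le_integral _ _ _ rho f (emeasurable_funD m5
  (measurable_cst _)) (fun x => adde_ge0 (adde_ge0 (adde_ge0 (S0 _ _) (p2 x)) (p4 x)) p5).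
exists x; rewrite -If; apply: le_trans fx.
have Xk (i : 'I_k) : (if (i : nat) == k then x else X i) = X i.
  by rewrite ltn_eqF.
rewrite /Psi SS big_ord_recr /= eqxx.
have XE (g : 'rV[R]_d -> \bar R) :
    \sum_(i < k) g (if (i : nat) == k then x else X i) = \sum_(i < k) g (X i).
  by apply: eq_bigr => i _; rewrite Xk.
rewrite (XE (fun y => W (y - x)%R)) (XE U).
rewrite (_ : S k _ = S k X)//; apply: eq_bigr => i _; apply: eq_bigr => j _.
by rewrite !Xk.
Qed.

Lemma averaging N : exists X : 'I_N -> 'rV[R]_d,
  pair_sum W X <= (N * N.-1)%:R%:E * \int[rho]_x \int[rho]_y W (x - y)%R.
Proof.
suff [X XN] : exists X, Psi N 0 X <= (N * N.-1)%:R%:E * I.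
  exists (fun i => X i); apply: le_trans XN.
  by rewrite /Psi !mul0n muln0 !mul0e !adde0.
have : forall k r, (k + r = N)%N -> exists X, Psi k r X <= (N * N.-1)%:R%:E * I.
  elim=> [|k IH] r krN.
    exists (fun=> 0%R); rewrite -krN add0n /Psi /S !big_ord0 mule0 !add0e.
    exact: lexx.
  have [|X XN] := IH r.+1; first by rewrite addnS -addSn.
  by have [x xX] := step k r X; eexists; exact: le_trans xX XN.
by move=> /(_ N 0%N); apply; rewrite addn0.
Qed.

End averaging.

End random_choice.

(** * Compactness of empirical measures *)

Lemma limn_einfE {R : realType} (u : (\bar R)^nat) :
  limn_einf u = ereal_sup (range (einfs u)).
Proof. by rewrite limn_einf_lim; apply/cvg_lim => //; exact: cvg_einfs_sup. Qed.

Lemma limn_einf_le {R : realType} (u : (\bar R)^nat) (c : \bar R) :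
  (forall n, u n <= c)%E -> (limn_einf u <= c)%E.
Proof.
move=> uc; rewrite limn_einfE; apply: ge_ereal_sup => _ [n _ <-].
by apply: le_trans (uc n); apply: ereal_inf_lbound; exists n => /=.
Qed.

Lemma limn_einf_ge {R : realType} (u : (\bar R)^nat) (x : \bar R) :
  (forall a : R, (a%:E < x)%E -> exists n, forall k, (n <= k)%N -> (a%:E <= u k)%E) ->
  (x <= limn_einf u)%E.
Proof.
move=> ux; rewrite limn_einfE leNgt; apply/negP => /ereal_dense[a /andP[sa ax]].
have [n nk] := ux _ ax; move: sa; rewrite ltNge => /negP; apply.
apply: (@le_trans _ _ (einfs u n)); last by apply: ereal_sup_ubound; exists n.
by apply: le_ereal_inf_tmp => _ [k /= nk' <-]; exact: nk.
Qed.

(* A diagonal extraction, through a cluster point of the product topology. *)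
Lemma bounded_subsequence {R : realType} (I : countType) (f : nat -> I -> R) :
  (forall n i, 0 <= f n i <= 1) ->
  exists (phi : nat -> nat) (l : I -> R), {homo phi : m n / (m < n)%N} /\
    forall i, f (phi n) i @[n --> \oo] --> l i.
Proof.
move=> f01; pose T : topologicalType := prod_topology (fun _ : I => R : topologicalType).
have cT := @tychonoff I (fun _ => R : topologicalType) (fun=> `[0, 1]%classic)
  (fun=> @segment_compact R 0 1).
have FF : ProperFilter ((f : nat -> T) @ \oo) by exact: fmap_proper_filter.
have [|l [_ cl]] := cT _ FF.
  by exists 0%N => // n _ i /=; rewrite in_itv /= f01.
(* Each S n constrains only finitely many coordinates, hence is a neighbourhood of l in the product
   topology; the n-th term of the subsequence is taken in S n. *)
pose S n := [set g : T | forall i, (pickle i < n)%N -> `|g i - l i| < n.+1%:R^-1].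
have nS n : nbhs (l : T) (S n).
  have SP (e : R) m : 0 < e ->
      nbhs (l : T) [set g : T | forall i, (pickle i < m)%N -> `|g i - l i| < e].
    move=> e0; elim: m => [|m IH]; first by apply: filterS filterT => g _ i.
    have [[i im]|noi] := pselect (exists i : I, pickle i = m); last first.
      apply: filterS IH => g gm i; rewrite ltnS leq_eqVlt => /orP[/eqP im|/gm//].
      by case: noi; exists i.

    have : nbhs (l : T) [set g : T | `|g i - l i| < e].
      have nb : nbhs (l : T) ((fun g : T => g i : R) @^-1` ball (l i) e).
        exact: (@proj_continuous I (fun=> R : topologicalType) i l _
          (nbhsx_ballx _ _ e0)).
      apply: (@filterS _ (nbhs (l : T)) _ _ _ _ nb) => g /= gi.
      by rewrite distrC; exact: gi.
    apply: filterS2 IH => g gm gi j; rewrite ltnS leq_eqVlt => /orP[/eqP jm|/gm//].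
    by have /(pcan_inj pickleK) -> : pickle j = pickle i by rewrite im jm.
  by apply: SP; rewrite invr_gt0.
have /choice[h hP] : forall p : nat * nat, exists k, (p.2 < k)%N /\ S p.1 (f k).
  move=> [n N]; have [|g [[k Nk <-] Sk]] := cl (f @` [set k | (N < k)%N]) _ _ (nS n).
    by exists N.+1 => // k /= Nk; exists k.
  by exists k.
pose phi := fix phi n := if n is n'.+1 then h (n, phi n') else h (0%N, 0%N).
have phiS n : (phi n < phi n.+1)%N by exact: (hP (n.+1, phi n)).1.
have phi_lt : {homo phi : m n / (m < n)%N}.
  exact: (homo_ltn ltn_trans phiS).
have Sphi n : S n (f (phi n)) by case: n => [|n]; [exact: (hP (0%N, 0%N)).2|exact: (hP (n.+1, phi n)).2].
exists phi, l; split => // i; apply/cvgrPdist_lt => e e0.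
near=> n; rewrite distrC; apply: lt_trans (Sphi n i _) _.
  by near: n; exact: nbhs_infty_gt.
by near: n; exact: near_infty_natSinv_lt (PosNum e0).
Unshelve. all: by end_near. Qed.

(** * Binary words, and their masses realised on the unit interval *)

Section words.
Context {R : realType}.
Implicit Types (b : nat -> bool) (w : seq bool).

(* Words list the most recent letter first. *)
Definition prefix b k : seq bool := rev (mkseq b k).

Definition extend w : nat -> bool := nth false (rev w).

Lemma prefixS b k : prefix b k.+1 = b k :: prefix b k.
Proof. by rewrite /prefix mkseqS rev_rcons. Qed.

Lemma size_prefix b k : size (prefix b k) = k.
Proof. by rewrite size_rev size_mkseq. Qed.

Lemma extend_prefix b k j : (j < k)%N -> extend (prefix b k) j = b j.
Proof. by move=> jk; rewrite /extend /prefix revK nth_mkseq. Qed.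

Lemma big_word k (x : seq bool) (g : seq bool -> \bar R) : size x = k ->
  (forall w, 0 <= g w)%E ->
  (\sum_(w : k.-tuple bool) g w * (x == w)%:R%:E = g x)%E.
Proof.
move=> xk g0; rewrite (bigD1 (Tuple (introT eqP xk)))//= eqxx mule1.
rewrite big1 ?adde0// => w; rewrite -val_eqE /= eq_sym => /negPf ->.
by rewrite mule0.
Qed.

End words.

(* A consistent family of masses of words is realised on [0, 1[ by the nested
   intervals [lo w, lo w + m w[. *)
Section tree.
Context {R : realType} (m : seq bool -> R).
Hypotheses (m0 : forall w, 0 <= m w) (m1 : m [::] = 1)
  (mD : forall w, m w = m (false :: w) + m (true :: w)).
Local Notation leb := (@lebesgue_measure R).

Fixpoint lo (w : seq bool) : R :=
  if w is c :: w' then lo w' + (if c then m (false :: w') else 0) else 0.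

Fixpoint word (t : R) (k : nat) : seq bool :=
  if k is k'.+1 then
    (lo (word t k') + m (false :: word t k') <= t) :: word t k'
  else [::].

Definition letter t k := lo (word t k) + m (false :: word t k) <= t.

Lemma wordE t k : word t k = prefix (letter t) k.
Proof. by elim: k => [//|k IH]; rewrite prefixS -IH. Qed.

Lemma size_word t k : size (word t k) = k.
Proof. by rewrite wordE size_prefix. Qed.

Lemma lo_ge0 w : 0 <= lo w.
Proof. by elim: w => //= c w IH; rewrite addr_ge0//; case: ifP. Qed.

Lemma hi_le1 w : lo w + m w <= 1.
Proof.
elim: w => [|c w IH] /=; first by rewrite m1 add0r.
apply: le_trans IH; rewrite [in leRHS]mD; case: c; first by rewrite addrA.
by rewrite addr0 lerD2l lerDl.
Qed.

Lemma word_mem t k : 0 <= t < 1 -> lo (word t k) <= t < lo (word t k) + m (word t k).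
Proof.
move=> t01; elim: k => [|k /andP[IH1 IH2]] /=; first by rewrite m1 add0r.
have [h|h] := boolP (lo (word t k) + m (false :: word t k) <= t) => /=; last first.
  by rewrite addr0 IH1 ltNge h.
by rewrite h -addrA -mD.
Qed.

Lemma word_eq t w : lo w <= t < lo w + m w -> word t (size w) = w.
Proof.
elim: w => // c w IH /=; case: c => /andP[h1 h2].
  have -> : word t (size w) = w.
    by apply: IH; rewrite (le_trans _ h1) ?lerDl//= mD addrA.
  by rewrite h1.
rewrite addr0 in h1 h2; have -> : word t (size w) = w.
  by apply: IH; rewrite h1 (lt_le_trans h2)// lerD2l [leRHS]mD lerDl.
by rewrite leNgt h2.
Qed.

Lemma word_eqE t w : 0 <= t < 1 ->
  (word t (size w) == w) = (t \in `[lo w, lo w + m w[).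
Proof.
move=> t01; rewrite in_itv /=; apply/eqP/idP => [<-|]; first exact: word_mem.
exact: word_eq.
Qed.

(** A version of t |-> g (word t k) written as a combination of indicators of intervals, hence easy
    to integrate; the two agree on [0, 1[. *)
Definition word_sum k (g : seq bool -> \bar R) (t : R) : \bar R :=
  (\sum_(w : k.-tuple bool) g w * (\1_`[lo w, lo w + m w[ t)%:E)%E.

Lemma word_sumE k g t : (forall w, 0 <= g w)%E -> 0 <= t < 1 ->
  word_sum k g t = g (word t k).
Proof.
move=> g0 t01; rewrite -(@big_word _ k (word t k) g (size_word _ _) g0).
apply: eq_bigr => w _; rewrite indicE; congr (_ * (_%:R)%:E)%E.
rewrite -[X in word t X](size_tuple w) word_eqE//.
by congr nat_of_bool; apply/idP/idP; rewrite inE.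
Qed.

Lemma measurable_word_sum k g : (forall w, 0 <= g w)%E ->
  measurable_fun setT (word_sum k g).
Proof.
move=> g0; apply: emeasurable_sum => w; apply: measurable_funeM.
exact/measurable_EFinP/measurable_indic.
Qed.

Lemma integral_word k g : (forall w, 0 <= g w)%E ->
  (\int[uniform_prob (@ltr01 R)]_t word_sum k g t =
   \sum_(w : k.-tuple bool) g w * (m w)%:E)%E.
Proof.
move=> g0.
have ms := measurable_word_sum k g0.
have s0 t : (0 <= word_sum k g t)%E.
  by apply: sume_ge0 => w _; rewrite mule_ge0// lee_fin.
rewrite integral_uniform// subr0 invr1 mul1e.
rewrite -integral_itv_bndo_bndc; last exact: measurable_funS ms.
rewrite ge0_integral_sum//; last 2 first.
- move=> w; apply: measurable_funeM; exact/measurable_EFinP/measurable_indic.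
- by move=> w t _; rewrite mule_ge0// lee_fin.
apply: eq_bigr => w _.
rewrite ge0_integralZl//;
  do ?[exact/measurable_EFinP/measurable_indic|by move=> t _; rewrite lee_fin].
congr (_ * _)%E; rewrite integral_indic//.
rewrite (_ : _ `&` _ = `[lo w, lo w + m w[%classic); last first.
  apply/setIidPl => t /=; rewrite !in_itv /= => /andP[h1 h2].
  by rewrite (le_trans (lo_ge0 w) h1) (lt_le_trans h2 (hi_le1 w)).
transitivity (@lebesgue_measure R `[lo w, lo w + m w[%classic) => //.
rewrite lebesgue_measure_itv /= lte_fin ltrDl.
case: ltP => [_|mw]; first by rewrite -EFinB addrAC subrr add0r.
by congr EFin; apply/eqP; rewrite eq_le mw m0.
Qed.

End tree.

(** No measurability is involved: the integral of a nonnegative function is a supremum over the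
    simple functions below it. *)
Lemma ge0_le_integralT d (T : measurableType d) (R : realType)
    (mu : {measure set T -> \bar R}) (f g : T -> \bar R) :
  (forall x, 0 <= f x)%E -> (forall x, f x <= g x)%E ->
  (\int[mu]_x f x <= \int[mu]_x g x)%E.
Proof.
move=> f0 fg; have g0 x : (0 <= g x)%E by exact: le_trans (fg x).
rewrite !ge0_integralTE//; apply: ereal_sup_le => _ [h hf <-].
by exists h => // x; apply: le_trans (fg x); exact: hf.
Qed.

(** Only x ranges over K, whereas y is any point near x, possibly outside K. Radii s with
    oscillation below e / 2 around each point of K are halved and one radius is extracted by
    compactness. *)
Lemma compact_unif_continuous {R : realType} (V : normedModType R) (f : V -> R)
    (K : set V) : compact K -> (forall x, K x -> {for x, continuous f}) ->
  forall e, 0 < e -> exists2 r, 0 < r &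
    forall x y, K x -> `|y - x| < r -> `|f y - f x| < e.
Proof.
move=> /compact_near_coveringP cK cf e e0.
have [|r /= r0 rP] := cK R^o (0 : R)^'+
    (fun r x => forall y, `|y - x| < r -> `|f y - f x| < e) _; last first.
  exists (r / 2); first by rewrite divr_gt0.
  move=> x y Kx; apply: rP => //=; last by rewrite divr_gt0.
  by rewrite sub0r normrN gtr0_norm ?divr_gt0// ltr_pdivrMr// ltr_pMr// ltr1n.
move=> x Kx.
have [s /= s0 sf] : exists2 s, 0 < s & forall y, `|y - x| < s -> `|f y - f x| < e / 2.
  have /cvgrPdist_lt/(_ _ (divr_gt0 e0 (ltr0n R 2))) := cf _ Kx.
  move=> /nbhs_normP[s /= s0 sf]; exists s => // y ys.
  by rewrite distrC; apply: sf => /=; rewrite distrC.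
exists (ball x (s / 2), [set r | r < s / 2]) => /=.
  split; first by apply: nbhsx_ballx; rewrite divr_gt0.
  by apply: nbhs_right_lt; rewrite divr_gt0.
move=> [x' r] /= [xx' rs] y yx'.
have xs : `|x' - x| < s / 2 by rewrite distrC -ball_normE in xx' *.
have h1 : `|f x' - f x| < e / 2.
  by apply: sf; apply: lt_trans xs _; rewrite ltr_pdivrMr// ltr_pMr// ltr1n.
have h2 : `|f y - f x| < e / 2.
  apply: sf; rewrite (_ : y - x = (y - x') + (x' - x)); last by rewrite addrA subrK.
  by rewrite (le_lt_trans (ler_normD _ _))// (splitr s) ltrD// (lt_trans yx').
rewrite (_ : f y - f x' = (f y - f x) + - (f x' - f x)); last by ring.
by rewrite (le_lt_trans (ler_normD _ _))// normrN (splitr e) ltrD.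
Qed.

(** * Binary expansions of the points of a box *)

Section digits.
Context {R : realType} (L : R).
Hypothesis L0 : 0 < L.

Fixpoint remainder (u : R) (l : nat) : R :=
  if l is l'.+1 then
    let r := remainder u l' in if L / 2 ^+ l'.+1 <= r then r - L / 2 ^+ l'.+1 else r
  else u.

Definition digit u l := L / 2 ^+ l.+1 <= remainder u l.

Definition partial (b : nat -> bool) k : R :=
  \sum_(l < k) (b l)%:R * (L / 2 ^+ l.+1).

Lemma partialS b k : partial b k.+1 = partial b k + (b k)%:R * (L / 2 ^+ k.+1).
Proof. by rewrite /partial big_ord_recr. Qed.

Lemma partial_digit u k : partial (digit u) k + remainder u k = u.
Proof.
elim: k => [|k IH]; first by rewrite /partial big_ord0 add0r.
rewrite -[RHS]IH partialS /= -/(digit u k).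
by case: (digit u k) => /=; rewrite ?mul1r ?mul0r; ring.
Qed.

Lemma half_pow k : L / 2 ^+ k = L / 2 ^+ k.+1 + L / 2 ^+ k.+1.
Proof. by rewrite exprS invfM; field; rewrite expf_neq0. Qed.

Lemma remainder_bound u k : 0 <= u < L -> 0 <= remainder u k < L / 2 ^+ k.
Proof.
move=> uL; elim: k => [|k /andP[IH1 IH2]] /=; first by rewrite expr0 divr1.
have := half_pow k.
have [h|h] := boolP (L / 2 ^+ k.+1 <= remainder u k) => h2.
  by apply/andP; split; lra.
by rewrite -ltNge in h; rewrite IH1 h.
Qed.

Lemma pow_gt0 k : 0 < L / 2 ^+ k.
Proof. by rewrite divr_gt0// exprn_gt0. Qed.

(** The digits from k to k + j add at most a finite geometric sum; its exact value, with the
    remainder L / 2^(k + j) subtracted, is what makes the induction work. *)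
Lemma partial_mono b k j :
  partial b k <= partial b (k + j) <= partial b k + L / 2 ^+ k - L / 2 ^+ (k + j).
Proof.
elim: j => [|j /andP[IH1 IH2]]; first by rewrite addn0 lexx /= addrK.
rewrite addnS partialS; have := pow_gt0 (k + j).+1; have := half_pow (k + j).
case: (b (k + j)%N); rewrite ?mul1r ?mul0r => h1 h2; apply/andP; split; lra.
Qed.

Definition real_of b : R := limn (partial b).

Lemma partial_nd b : {homo partial b : n m / (n <= m)%N >-> n <= m}.
Proof. by move=> n m nm; rewrite -(subnKC nm); have /andP[] := partial_mono b n (m - n). Qed.

Lemma partial_ub b k j : partial b j <= partial b k + L / 2 ^+ k.
Proof.
have [jk|/ltnW kj] := leqP j k.
  by rewrite (le_trans (partial_nd b jk))// lerDl ltW// pow_gt0.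
rewrite -(subnKC kj); have /andP[_] := partial_mono b k (j - k).
by have := pow_gt0 (k + (j - k)); lra.
Qed.

Lemma partial_cvg b : partial b @ \oo --> real_of b.
Proof.
apply: nondecreasing_is_cvgn; first exact: partial_nd.
by exists (partial b 0 + L / 2 ^+ 0) => _ [j _ <-]; exact: partial_ub.
Qed.

Lemma real_of_bound b k : partial b k <= real_of b <= partial b k + L / 2 ^+ k.
Proof.
apply/andP; split.
  by apply: nondecreasing_cvgn_le; [exact: partial_nd|exact: partial_cvg].
apply: limr_le; first exact: partial_cvg.
by apply: nearW => j; exact: partial_ub.
Qed.

Lemma real_of01 b : 0 <= real_of b <= L.
Proof.
by have := real_of_bound b 0; rewrite /partial big_ord0 add0r expr0 divr1.
Qed.

Section vector.
Context {d : nat}.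
Implicit Types (x : 'rV[R]_d) (b : nat -> bool).

(* The binary digits of the coordinates are interleaved into one sequence. *)
Definition code x (j : nat) : bool :=
  [exists i : 'I_d, (j %% d == i)%N && digit (x ord0 i) (j %/ d)].

Definition decode k b : 'rV[R]_d := \row_i partial (fun l => b (l * d + i)%N) k.

Definition point b : 'rV[R]_d := \row_i real_of (fun l => b (l * d + i)%N).

Lemma code_coord x (i : 'I_d) l : code x (l * d + i) = digit (x ord0 i) l.
Proof.
have d0 : (0 < d)%N by exact: leq_ltn_trans (ltn_ord i).
rewrite /code modnMDl modn_small// divnMDl// divn_small// addn0.
apply/existsP/idP => [[j /andP[/eqP/val_inj <-]]//|h].
by exists i; rewrite eqxx.
Qed.

Lemma decode_code k x : (forall i, 0 <= x ord0 i < L) ->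
  `|x - decode k (code x)| <= L / 2 ^+ k.
Proof.
move=> xL; apply: norm_le_coord => [|i]; first exact/ltW/pow_gt0.
have E : (fun l => code x (l * d + i)) = digit (x ord0 i).
  by apply/funext => l; exact: code_coord.
rewrite !mxE E -{1}(partial_digit (x ord0 i) k).
rewrite addrC addKr; have /andP[h1 h2] := remainder_bound k (xL i).
by rewrite ger0_norm// ltW.
Qed.

Lemma decode_point k b : `|point b - decode k b| <= L / 2 ^+ k.
Proof.
apply: norm_le_coord => [|i]; first exact/ltW/pow_gt0.
rewrite !mxE; set c := fun l => _.
have /andP[h1 h2] := real_of_bound c k.
by rewrite ger0_norm ?subr_ge0// lerBlDl.
Qed.

Lemma point_box b : box L (point b).
Proof. by move=> i; rewrite mxE; exact: real_of01. Qed.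

(** The first k digits of all d coordinates sit among the first k d letters, since l d + i < k d for
    l < k and i < d. *)
Lemma decode_extend k b : decode k (extend (prefix b (k * d))) = decode k b.
Proof.
apply/rowP => i; rewrite !mxE; apply: eq_bigr => l _.
rewrite extend_prefix// (@leq_trans (l.+1 * d))//; last by rewrite leq_mul2r ltn_ord orbT.
by rewrite mulSn addnC ltn_add2r.
Qed.

End vector.
End digits.

Lemma big_mem_tuple {R : realType} (k : nat) (x : seq bool) (g : seq bool -> R) :
  size x = k -> \sum_(w : k.-tuple bool) g w * (x == w)%:R = g x.
Proof.
move=> xk; rewrite (bigD1 (Tuple (introT eqP xk)))//= eqxx mulr1.
rewrite big1 ?addr0// => w; rewrite -val_eqE /= eq_sym => /negPf ->.
by rewrite mulr0.
Qed.

Lemma cvg_fin_sum {R : realType} (I : finType) (f : nat -> I -> R) (l : I -> R) :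
  (forall i, f n i @[n --> \oo] --> l i) ->
  \sum_i f n i @[n --> \oo] --> \sum_i l i.
Proof. by move=> fl; apply: cvg_big => //; exact: add_continuous. Qed.

Lemma integral_empirical {R : realType} {d : nat} (N : nat)
    (X : 'I_N -> 'rV[R]_d) (f : 'rV[R]_d -> \bar R) :
  measurable_fun setT f -> (forall x, 0 <= f x)%E ->
  (\int[empirical X]_x f x = (N%:R^-1)%:E * \sum_(i < N) f (X i))%E.
Proof.
move=> mf f0.
have N0 : 0 <= N%:R^-1 :> R by [].
(* [msum] is indexed by all natural numbers, so the configuration is extended by 0. *)
pose X' n : 'rV[R]_d := if insub n is Some i then X i else 0.
have X'E (i : 'I_N) : X' i = X i by rewrite /X' valK.
pose m n : {measure set 'rV[R]_d -> \bar R} := \d_(X' n).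
rewrite (@eq_measure_integral _ _ _ _ (mscale (NngNum N0) (msum m N))); last first.
  move=> A mA _; rewrite /empirical /mscale /= /msum /=; congr (_ * _)%E.
  by apply: eq_bigr => i _; rewrite /m X'E.
rewrite ge0_integral_mscale// ge0_integral_measure_sum//; congr (_ * _)%E.
by apply: eq_bigr => i _; rewrite /m integral_dirac// diracT mul1e X'E.
Qed.

Section limit_law.
Context {R : realType} (m : seq bool -> R).
Hypotheses (m0 : forall w, 0 <= m w) (m1 : m [::] = 1)
  (mD : forall w, m w = m (false :: w) + m (true :: w)).
Local Notation U01 := (uniform_prob (@ltr01 R)).

(** The target of g is left general in the induction: the test that chooses the next letter compares
    t with a real function of the shorter word, to which the hypothesis applies again. *)
Lemma measurable_word d (T : measurableType d) k (g : seq bool -> T) :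
  measurable_fun (setT : set (measurableTypeR R)) (fun t => g (word m t k)).
Proof.
elim: k d T g => [|k IH] d T g /=; first exact: measurable_cst.
rewrite (_ : (fun t => _) = fun t =>
    if lo m (word m t k) + m (false :: word m t k) <= t
    then g (true :: word m t k) else g (false :: word m t k)); last first.
  by apply/funext => t; case: ifP.
apply: measurable_fun_ifT; [|exact: (IH _ _ (fun w => g (true :: w)))
  |exact: (IH _ _ (fun w => g (false :: w)))].
by apply: measurable_fun_ler => //; exact: (IH _ _ (fun w => lo m w + m (false :: w))).
Qed.

Lemma eq_integral_U01 (f g : R -> \bar R) :
  measurable_fun setT f -> measurable_fun setT g ->
  (forall t, 0 <= f t)%E -> (forall t, 0 <= g t)%E ->
  (forall t, 0 <= t < 1 -> f t = g t) ->
  (\int[U01]_t f t = \int[U01]_t g t)%E.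
Proof.
move=> mf mg f0 g0 fg; rewrite !integral_uniform//; congr (_ * _)%E.
rewrite -integral_itv_bndo_bndc; last exact: measurable_funS mf.
rewrite -integral_itv_bndo_bndc; last exact: measurable_funS mg.
by apply: eq_integral => t; rewrite inE /= in_itv /=; exact: fg.
Qed.

Lemma integral_word_law k (g : seq bool -> R) : (forall w, 0 <= g w) ->
  (\int[U01]_t (g (word m t k))%:E =
   (\sum_(w : k.-tuple bool) g w * m w)%:E)%E.
Proof.
move=> g0; rewrite (@eq_integral_U01 _ (word_sum m k (EFin \o g))); first last.
- by move=> t t01; rewrite word_sumE// => w; rewrite lee_fin.
- by move=> t; apply: sume_ge0 => w _; rewrite mule_ge0// lee_fin.
- by move=> t; rewrite lee_fin.
- by apply: measurable_word_sum => w; rewrite lee_fin.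
- exact: (@measurable_word _ _ k (EFin \o g)).
by rewrite integral_word// -sumEFin.
Qed.

Lemma integral_word_law2 k (g : seq bool -> seq bool -> R) :
  (forall v w, 0 <= g v w) ->
  (\int[U01]_t \int[U01]_s (g (word m t k) (word m s k))%:E =
   (\sum_(v : k.-tuple bool) \sum_(w : k.-tuple bool) g v w * m v * m w)%:E)%E.
Proof.
move=> g0; pose h v := \sum_(w : k.-tuple bool) g v w * m w.
under eq_integral do rewrite integral_word_law//.
rewrite (@integral_word_law k h); last first.
  by move=> v; apply: sumr_ge0 => w _; rewrite mulr_ge0.
congr EFin; apply: eq_bigr => v _; rewrite /h mulr_suml.
by apply: eq_bigr => w _; rewrite mulrAC.
Qed.

Context (L : R) (L0 : 0 < L) {d : nat}.

Definition limit_point (t : measurableTypeR R) : 'rV[R]_d := point L (letter m t).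

Lemma decode_word k (t : R) :
  decode L k (extend (word m t (k * d))) = decode L k (letter m t) :> 'rV[R]_d.
Proof. by rewrite wordE decode_extend. Qed.

Lemma measurable_limit_point : measurable_fun setT limit_point.
Proof.
apply: measurable_rV => i.
apply: (@measurable_fun_cvg _ _ _ _
  (fun k t => partial L (fun l => letter m t (l * d + i)) k)).
  move=> k; apply: measurable_sum => l.
  apply: measurable_funM => //.
  (* The latest letter of the word of length l d + i + 1 is the letter of index l d + i. *)
  exact: (@measurable_word _ R (l * d + i).+1 (fun w => (head false w)%:R)).
by move=> t _; rewrite mxE; exact: partial_cvg.
Qed.

End limit_law.

Lemma measurable_continuous_rV {R : realType} d (f : 'rV[R]_d -> R) :
  continuous f -> measurable_fun setT f.
Proof.
move=> cf; apply: (measurability _ (RGenOpens.measurableE R)).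
move=> _ [_ [a [b ->] <-]]; rewrite setTI.
apply: open_measurable_rV; apply: open_comp; last exact: interval_open.
by move=> x _; exact: cf.
Qed.

Lemma integral_cst1 d (T : measurableType d) (R : realType)
    (P : {measure set T -> \bar R}) (r : \bar R) :
  P setT = 1%E -> (\int[P]_x r = r)%E.
Proof. by move=> P1; rewrite -[RHS]mule1 -P1; exact: integral_cst. Qed.

(** For c < 0 the function g + c may change sign. If g has infinite integral, the negative part of g
    + c has integral at most - c, so its positive part has infinite integral. *)
Lemma integral_shift d (T : measurableType d) (R : realType)
    (P : {measure set T -> \bar R}) (g : T -> \bar R) (c : R) :
  P setT = 1%E -> measurable_fun setT g -> (forall x, 0 <= g x)%E ->
  (\int[P]_x (g x + c%:E) = \int[P]_x g x + c%:E)%E.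
Proof.
move=> P1 mg g0.
have cstE (r : \bar R) : (\int[P]_x r = r)%E by exact: integral_cst1.
have [c0|c0] := leP 0 c.
  by rewrite ge0_integralD// cstE.
have [gfin|goo] := ltP (\int[P]_x g x)%E +oo%E.
  have ig : P.-integrable setT g.
    apply/integrableP; split => //.
    by rewrite (eq_integral g)// => x _; rewrite gee0_abs.
  have ic : P.-integrable setT (cst c%:E).
    apply/integrableP; split => //.
    by rewrite (eq_integral (fun=> `|c|%:E))// cstE ltry.
  by rewrite integralD// cstE.
have -> : (\int[P]_x g x = +oo)%E by apply/eqP; rewrite -leye_eq.
rewrite addye//.
have mgc : measurable_fun setT (fun x => g x + c%:E)%E by exact: emeasurable_funD.
have b0 : 0 <= - c by rewrite oppr_ge0 ltW.
rewrite integralE.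
have negle : (\int[P]_x ((fun x => g x + c%:E)^\- x) <= (- c)%:E)%E.
  rewrite -[leRHS]cstE; apply: ge0_le_integralT => // x.
  rewrite funenegE ge_max lee_fin b0 andbT.
  by rewrite EFinN leeN2 leeDr.
have -> : (\int[P]_x ((fun x => g x + c%:E)^\+ x) = +oo)%E.
  apply/eqP; rewrite -leye_eq -(leeD2rE (x := (- c)%:E))// addye//.
  apply: le_trans goo _; rewrite -[X in (_ + X)%E]cstE -ge0_integralD//; last first.
    exact: measurable_funepos.
  apply: ge0_le_integralT => // x; rewrite funeposE.
  apply: (@le_trans _ _ (g x + c%:E + (- c)%:E)%E).
    by rewrite -addeA -EFinD subrr adde0.
  by rewrite leeD2r// le_max lexx.
by rewrite addye// eqe_oppLR lt_eqF// (le_lt_trans negle)// ltry.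
Qed.

Lemma mfun_law {d1 d2} {T1 : measurableType d1} {T2 : measurableType d2}
    {R : realType} (P : probability T1 R) (X : T1 -> T2) :
  measurable_fun setT X ->
  exists rho : probability T2 R, forall f : T2 -> \bar R,
    measurable_fun setT f -> (forall x, 0 <= f x)%E ->
    (\int[rho]_x f x = \int[P]_t f (X t))%E.
Proof.
move=> mX.
pose X' : {mfun T1 >-> T2} := HB.pack_for {mfun T1 >-> T2} X
  (isMeasurableFun.Build _ _ _ _ X mX).
exists (distribution P X') => f mf f0.
by rewrite /distribution ge0_integral_pushforward//.
Qed.

(** * Narrow limits of empirical measures and lower semicontinuity of the energy *)

Section compactness.
Context {R : realType} {d : nat}.
Variables (L : R) (N : nat -> nat).
Variable Y : forall n, 'I_(N n) -> 'rV[R]_d.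
Arguments Y : clear implicits.
Hypotheses (L0 : 0 < L) (N0 : forall n, (0 < N n)%N).
Hypothesis YL : forall n i k, 0 <= Y n i ord0 k < L.
Local Notation U01 := (uniform_prob (@ltr01 R)).

Definition freq n (w : seq bool) : R :=
  (N n)%:R^-1 * \sum_(i < N n) (prefix (code L (Y n i)) (size w) == w)%:R.

(** An average over the particles that depends on k letters only is a linear expression in finitely
    many frequencies, hence converges with them. *)
Lemma freq_avg n k (g : seq bool -> R) :
  (N n)%:R^-1 * \sum_(i < N n) g (prefix (code L (Y n i)) k) =
  \sum_(w : k.-tuple bool) g w * freq n w.
Proof.
under [RHS]eq_bigr do rewrite /freq mulrCA mulr_sumr.
rewrite -mulr_sumr exchange_big /=; congr (_ * _); apply: eq_bigr => i _.
rewrite -(@big_mem_tuple _ k _ g (size_prefix _ _)).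
by apply: eq_bigr => w _; rewrite size_tuple.
Qed.

Lemma freq_bound n w : 0 <= freq n w <= 1.
Proof.
have Np : 0 < (N n)%:R :> R by rewrite ltr0n.
rewrite mulr_ge0 ?invr_ge0 ?sumr_ge0//= ler_pdivrMl// mulr1.
rewrite -[X in _ <= X%:R](card_ord (N n)) -sumr_const.
by apply: ler_sum => i _; case: (_ == _).
Qed.

Lemma freq_nil n : freq n [::] = 1.
Proof.
rewrite /freq (eq_bigr (fun=> 1)) => [|i _]; last by rewrite /prefix eqxx.
by rewrite sumr_const card_ord mulVf// pnatr_eq0 -lt0n.
Qed.

Lemma freq_cons n w : freq n w = freq n (false :: w) + freq n (true :: w).
Proof.
rewrite /freq -mulrDr -big_split; congr (_ * _); apply: eq_bigr => i _ /=.
rewrite prefixS !eqseq_cons; case: (code _ _ _) => /=.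
  by rewrite add0r.
by rewrite addr0.
Qed.

Lemma narrow_compactness : (forall M, exists n0, forall n, (n0 <= n)%N -> (M <= N n)%N) ->
  exists (phi : nat -> nat) (rho : probability 'rV[R]_d R),
  [/\ {homo phi : m n / (m < n)%N},
      narrow_cvg (fun n => empirical (Y (phi n))) rho &
      forall (W : 'rV[R]_d -> \bar R) (e : \bar R), (forall x, 0 <= W x)%E ->
        measurable_fun setT W -> lower_semicontinuous W ->
        (forall n, discrete_energy W (Y n) <= e)%E -> (energy W rho <= e)%E].
Proof.
move=> Noo.
have [phi [m [phi_lt mP]]] := bounded_subsequence freq_bound.
have phi_ge n : (n <= phi n)%N.
  by elim: n => // n IH; rewrite (leq_ltn_trans IH)// phi_lt.
have m0 w : 0 <= m w.
  rewrite -(cvg_lim (@Rhausdorff R) (mP w)); apply: limr_ge.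
    by apply/cvg_ex; exists (m w).
  by apply: nearW => n; have /andP[] := freq_bound (phi n) w.
have m1 : m [::] = 1.
  rewrite -(cvg_lim (@Rhausdorff R) (mP [::])).
  rewrite (_ : (fun n => _) = fun=> 1); first exact: lim_cst.
  by apply/funext => n; exact: freq_nil.
have mD w : m w = m (false :: w) + m (true :: w).
  rewrite -(cvg_lim (@Rhausdorff R) (mP w)); apply/cvg_lim => //.
  rewrite (_ : (fun n => _) =
    (fun n => freq (phi n) (false :: w) + freq (phi n) (true :: w))).
    by apply: cvgD; exact: mP.
  by apply/funext => n; exact: freq_cons.
pose X (t : measurableTypeR R) : 'rV[R]_d := limit_point m L t.
have mX : measurable_fun setT X by exact: measurable_limit_point.
have [rho rhoE] := mfun_law U01 mX.
have conv1 k (g : seq bool -> R) :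
  (N (phi n))%:R^-1 * \sum_(i < N (phi n)) g (prefix (code L (Y (phi n) i)) k)
    @[n --> \oo] --> \sum_(w : k.-tuple bool) g w * m w.
  under eq_fun do rewrite freq_avg.
  by apply: cvg_fin_sum => w; apply: cvgM; [exact: cvg_cst|exact: mP].
have U1 : U01 setT = 1%E by exact: probability_setT.
have YB n i : box L (Y n i).
  by move=> k; have /andP[-> /ltW ->] := YL i k.
exists phi, rho; split => //.
  move=> f cf [M fM].
  have mf := measurable_continuous_rV cf.
  have M0 : 0 <= M by rewrite (le_trans _ (fM 0)).
  pose h x := f x + M.
  have h0 x : 0 <= h x.
    by rewrite /h -lerBlDr sub0r; have := fM x; rewrite ler_norml => /andP[].
  have hM x : h x <= 2 * M.
    by have := fM x; rewrite ler_norml /h => /andP[_]; lra.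
  have mh : measurable_fun setT (EFin \o h).
    by apply/measurable_EFinP; exact: measurable_funD.
  have shift (P : {measure set 'rV[R]_d -> \bar R}) : P setT = 1%E ->
      (\int[P]_x (f x)%:E = \int[P]_x (h x)%:E - M%:E)%E.
    move=> P1; rewrite -integral_shift//.
    by apply: eq_integral => x _; rewrite -EFinD /h addrK.
  pose A n := (N (phi n))%:R^-1 * \sum_(i < N (phi n)) h (Y (phi n) i).
  have AE n : (\int[empirical (Y (phi n))]_x (h x)%:E = (A n)%:E)%E.
    rewrite integral_empirical//.
    by rewrite sumEFin -EFinM.
  have Ifin : (\int[rho]_x (h x)%:E)%E \is a fin_num.
    rewrite ge0_fin_numE; last by apply: integral_ge0 => x _; rewrite lee_fin.
    apply: (@le_lt_trans _ _ (\int[rho]_x (2 * M)%:E)%E).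
      by apply: ge0_le_integralT => x; rewrite lee_fin.
    by rewrite integral_cst1 ?ltry//; exact: probability_setT.
  rewrite shift; last exact: probability_setT.
  rewrite (_ : (fun n => _) = fun n => ((A n)%:E - M%:E)%E); last first.
    by apply/funext => n; rewrite shift ?AE//; exact: empirical_setT.
  rewrite -(fineK Ifin) -EFinB.
  apply: cvg_EFin; first by apply: nearW => n.
  rewrite (_ : fine \o _ = fun n => A n - M); last by apply/funext.
  apply: cvgB; last exact: cvg_cst.
  apply/cvgrPdist_le => e e0.
  (* The tolerance is shared by three errors: replacing points by words under rho, replacing limit
     masses by frequencies, and replacing words by the actual particles. *)
  have e3 : 0 < e / 3 by rewrite divr_gt0.
  have [r r0 rP] := compact_unif_continuous (@box_compact R d L)
    (fun x _ => cf x) e3.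
  have [k kr] : exists k, L / 2 ^+ k < r.
    have [k _ kP] := @near_infty_natSinv_expn_lt R (PosNum (divr_gt0 r0 L0)).
    exists k; have /= := kP k (leqnn k).
    by rewrite ltr_pdivlMr// mulrC div1r.
  pose g w := h (decode L k (extend w)).
  have g0 w : 0 <= g w by exact: h0.
  have hu x y : box L x -> `|x - y| <= L / 2 ^+ k -> `|h y - h x| <= e / 3.
    move=> xL xy; rewrite /h opprD addrACA subrr addr0.
    by apply/ltW/rP => //; rewrite distrC (le_lt_trans xy).
  have IE : (\int[rho]_x (h x)%:E = \int[U01]_t (h (X t))%:E)%E.
    by rewrite rhoE//.
  pose b := \sum_(w : (k * d).-tuple bool) g w * m w.
  have bE : (\int[U01]_t (g (word m t (k * d)))%:E = b%:E)%E.
    by rewrite integral_word_law.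
  have gX t : `|h (X t) - g (word m t (k * d))| <= e / 3.
    rewrite /g decode_word distrC; apply: hu; first exact: point_box.
    exact: decode_point.
  have mgw : measurable_fun setT (fun t : measurableTypeR R => (g (word m t (k * d)))%:E).
    apply: (@measurable_word R m _ _ (k * d) (fun w => (g w)%:E)).
  have mhX : measurable_fun setT (fun t : measurableTypeR R => (h (X t))%:E).
    exact: (measurableT_comp mh mX).
  have IbE : `|fine (\int[rho]_x (h x)%:E)%E - b| <= e / 3.
    rewrite ler_distl -!lee_fin EFinB EFinD fineK// -bE IE.
    rewrite leeBlDr// -!integral_shift//; do ?[by move=> t; rewrite lee_fin].
    apply/andP; split; apply: ge0_le_integralT => t; rewrite ?lee_fin//.
    - by have := gX t; rewrite ler_distl => /andP[+ _]; rewrite lerBlDr.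
    - by have := gX t; rewrite ler_distl => /andP[_ +].
  have := conv1 (k * d)%N g => /cvgrPdist_le/(_ _ e3); apply: filterS => n.
  set An := (X in `|_ - X|) => bA.
  have AAn : `|An - A n| <= e / 3.
    rewrite /An /A -mulrBr -sumrB normrM ger0_norm ?invr_ge0//.
    have Np : 0 < (N (phi n))%:R :> R by rewrite ltr0n.
    rewrite ler_pdivrMl//.
    rewrite -[X in _ <= X%:R * _](card_ord (N (phi n))) mulr_natl -sumr_const.
    apply: le_trans (ler_norm_sum _ _ _) _; apply: ler_sum => i _.
    rewrite /g decode_extend; apply: hu => //.
    by apply: decode_code.
  rewrite (_ : _ - A n = (fine (\int[rho]_x (h x)%:E)%E - b) + (b - An) + (An - A n)).
    rewrite (le_trans (ler_normD _ _))// (_ : e = e / 3 + e / 3 + e / 3); last lra.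
    by rewrite lerD// (le_trans (ler_normD _ _))// lerD.
  by ring.
move=> W e W0 mW lW We.
have {We} : forall n, (pair_sum W (Y n) <= (2 * (N n)%:R ^+ 2)%:E * e)%E.
  move=> n; have := We n; rewrite discrete_energyE lee_pdivrMl//.
  by rewrite mulr_gt0// exprn_gt0// ltr0n.
case: e => [e||] We; last 2 first.
- exact: leey.
- have := We 0%N; rewrite mulrNy gtr0_sg ?mul1e; last first.
    by rewrite mulr_gt0// exprn_gt0// ltr0n.
  by rewrite leeNy_eq gt_eqF// (lt_le_trans (ltNyr 0))// sume_ge0// => i _; exact: sume_ge0.
(* [wk k] is W truncated at k and minimised over a neighbourhood of radius 2 L / 2^k. This radius
   covers the error on a difference of two points known to k digits, so that [wk k] at decoded
   points is a lower bound of W at the true ones; lower semicontinuity recovers W as k grows. *)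
pose D k (z : 'rV[R]_d) := [set z' : 'rV[R]_d | `|z' - z| <= 2 * (L / 2 ^+ k)].
pose wk k z : R := fine (ereal_inf [set Order.min (W z') k%:R%:E | z' in D k z]).
have wkE k z : (wk k z)%:E = ereal_inf [set Order.min (W z') k%:R%:E | z' in D k z].
  have Dz : D k z z by rewrite /D /= subrr normr0 mulr_ge0// ltW// pow_gt0.
  rewrite /wk fineK// ge0_fin_numE.
    apply: (@le_lt_trans _ _ (Order.min (W z) k%:R%:E)).
      by apply: ereal_inf_lbound; exists z.
    by rewrite gt_min ltry orbT.
  by apply: le_ereal_inf_tmp => _ [y _ <-]; rewrite le_min W0 lee_fin /= ler0n.
have wkP k z z' : D k z z' -> 0 <= wk k z <= k%:R /\ ((wk k z)%:E <= W z')%E.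
  move=> Dz'; rewrite -!lee_fin wkE.
  have IW : (ereal_inf [set Order.min (W z') k%:R%:E | z' in D k z] <=
      Order.min (W z') k%:R%:E)%E by apply: ereal_inf_lbound; exists z'.
  split; last by apply: le_trans IW _; rewrite ge_min lexx.
  apply/andP; split; last by apply: le_trans IW _; rewrite ge_min lexx orbT.
  by apply: le_ereal_inf_tmp => _ [y _ <-]; rewrite le_min W0 lee_fin /= ler0n.
have wk_near k z z' : `|z' - z| <= 2 * (L / 2 ^+ k) -> ((wk k z)%:E <= W z')%E.
  by move=> /wkP[].
have wk_bnd k z : 0 <= wk k z <= k%:R.
  by apply: (wkP k z z _).1; rewrite /D /= subrr normr0 mulr_ge0// ltW// pow_gt0.
pose g k v w := wk k (decode L k (extend v) - decode L k (extend w)).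
have g0 k v w : 0 <= g k v w by have /andP[] := wk_bnd k (decode L k (extend v) - decode L k (extend w)).
pose A n k := (N (phi n))%:R^-1 * \sum_(i < N (phi n)) ((N (phi n))%:R^-1 *
  \sum_(j < N (phi n)) g k (prefix (code L (Y (phi n) i)) (k * d))
    (prefix (code L (Y (phi n) j)) (k * d))).
(* The double average contains the diagonal, absent from the discrete energy. The truncation bounds
   each diagonal term by k, hence their total contribution by k / N, which vanishes in the limit. *)
have A_le n k : A n k <= 2 * e + k%:R / (N (phi n))%:R.
  have Np : 0 < (N (phi n))%:R :> R by rewrite ltr0n.
  rewrite /A -mulr_sumr !ler_pdivrMl// -lee_fin -sumEFin.
  under eq_bigr do rewrite -sumEFin.
  apply: (@le_trans _ _ (((N (phi n))%:R * k%:R)%:E + pair_sum W (Y (phi n)))%E).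
    rewrite mulr_natl -[X in _ *+ X](card_ord (N (phi n))) -sumr_const -sumEFin.
    rewrite -big_split; apply: lee_sum => i _; rewrite (bigD1 i)//=.
    apply: leeD; first by rewrite lee_fin; have /andP[] := wk_bnd k
      (decode L k (extend (prefix (code L (Y (phi n) i)) (k * d))) -
       decode L k (extend (prefix (code L (Y (phi n) i)) (k * d)))).
    apply: lee_sum => j ji; apply: wk_near; rewrite !decode_extend.
    set y := Y _ i; set z := Y _ j.
    rewrite (_ : _ - _ = (y - decode L k (code L y)) - (z - decode L k (code L z))).
      rewrite (le_trans (ler_normB _ _))// mulr_natl mulr2n lerD//.
        by apply: decode_code => // l; exact: YL.
      by apply: decode_code => // l; exact: YL.
    by apply/rowP => l; rewrite !mxE; ring.
  apply: (le_trans (leeD2l _ (We _))); rewrite -EFinM -EFinD lee_fin.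
  by rewrite le_eqVlt; apply/orP; left; apply/eqP; field; rewrite gt_eqF.
have A_lim k : A n k @[n --> \oo] --> \sum_(v : (k * d).-tuple bool)
    \sum_(w : (k * d).-tuple bool) g k v w * m v * m w.
  rewrite (_ : (fun n => _) = fun n => \sum_(v : (k * d).-tuple bool)
    \sum_(w : (k * d).-tuple bool) g k v w * freq (phi n) v * freq (phi n) w).
    apply: cvg_fin_sum => v; apply: cvg_fin_sum => w.
    by apply: cvgM; [apply: cvgM; [exact: cvg_cst|exact: mP]|exact: mP].
  apply/funext => n; rewrite /A.
  under eq_bigr do rewrite freq_avg.
  rewrite (freq_avg (phi n) (k * d) (fun v => \sum_(w : (k * d).-tuple bool)
    g k v w * freq (phi n) w)).
  by apply: eq_bigr => v _; rewrite mulr_suml; apply: eq_bigr => w _; rewrite mulrAC.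
have I_le k : (\int[U01]_t \int[U01]_s
    (g k (word m t (k * d)) (word m s (k * d)))%:E <= (2 * e)%:E)%E.
  rewrite (integral_word_law2 m0 m1 mD)// lee_fin.
  apply/ler_addgt0Pr => eta eta0.
  rewrite -(cvg_lim (@Rhausdorff R) (A_lim k)); apply: limr_le.
    by apply/cvg_ex; eexists; exact: A_lim.
  have [M Mk] : exists M : nat, k%:R / eta < M%:R.
    by exists (Num.truncn (k%:R / eta)).+1; exact: truncnS_gt.
  have [n0 n0P] := Noo M.
  exists n0 => // n /= n0n; apply: le_trans (A_le n k) _; rewrite lerD2l.
  have NM : (M <= N (phi n))%N by apply: n0P; exact: leq_trans (phi_ge n).
  rewrite ler_pdivrMr ?ltr0n// -ler_pdivrMl// mulrC.
  by rewrite (le_trans (ltW Mk))// ler_nat.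
have WX t s : (W (X t - X s)%R <=
    limn_einf (fun k => (g k (word m t (k * d)) (word m s (k * d)))%:E))%E.
  apply: limn_einf_ge => a /lW[V /nbhs_normP[r /= r0 rV] VW].
  (* Of the four errors L / 2^k, one is due to X t, one to X s and two to the radius of [D k].
     Moreover k must exceed |a| for the truncation to stay above a. *)
  have [k0 _ k0P] := @near_infty_natSinv_expn_lt R (PosNum (divr_gt0 r0 (mulr_gt0 (ltr0n R 4) L0))).
  exists (maxn k0 (Num.truncn `|a|).+1) => k; rewrite geq_max => /andP[k0k ak].
  have kr : 4 * (L / 2 ^+ k) < r.
    have := k0P _ k0k; rewrite /= ltr_pdivlMr ?mulr_gt0// div1r.
    by rewrite mulrA [X in X < _]mulrC.
  rewrite /g !decode_word wkE.
  apply: le_ereal_inf_tmp => _ [z' zz' <-]; rewrite le_min; apply/andP; split.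
    apply/ltW/VW/rV => /=; apply: le_lt_trans kr.
    have ht := decode_point (d := d) L0 k (letter m t).
    have hs := decode_point (d := d) L0 k (letter m s).
    rewrite (_ : X t - X s - z' = (X t - decode L k (letter m t)) +
      ((decode L k (letter m s) - X s) +
       ((decode L k (letter m t) - decode L k (letter m s)) - z'))).
      have {}zz' := zz'; rewrite /D /= distrC in zz'.
      have -> : 4 * (L / 2 ^+ k) = L / 2 ^+ k + (L / 2 ^+ k + 2 * (L / 2 ^+ k)) by ring.
      do 2 (rewrite (le_trans (ler_normD _ _))//; apply: lerD => //).
      by rewrite distrC.
    apply/rowP => i; rewrite !mxE; ring.
  rewrite lee_fin (le_trans (ler_norm a))// ltW// (lt_le_trans (truncnS_gt _))//.
  by rewrite ler_nat.
have mu_ k : measurable_fun setT (fun t : measurableTypeR R => \int[U01]_s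
    (g k (word m t (k * d)) (word m s (k * d)))%:E)%E.
  rewrite (_ : (fun t => _) = fun t : measurableTypeR R =>
    (\sum_(w : (k * d).-tuple bool) g k (word m t (k * d)) w * m w)%:E).
    exact: (@measurable_word _ m _ _ (k * d) (fun v =>
      (\sum_(w : (k * d).-tuple bool) g k v w * m w)%:E)).
  by apply/funext => t; rewrite (integral_word_law m0 m1 mD).
have mg_ k v : measurable_fun setT (fun s : measurableTypeR R =>
    (g k v (word m s (k * d)))%:E).
  exact: (@measurable_word _ m _ _ (k * d) (fun w => (g k v w)%:E)).
rewrite /energy.
have -> : (\int[rho]_x \int[rho]_y W (x - y)%R =
    \int[U01]_t \int[U01]_s W (X t - X s)%R)%E.
  rewrite rhoE; last 2 first.
  - exact: measurable_potential.
  - by move=> x; exact: integral_ge0.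
  apply: eq_integral => t _; rewrite rhoE//; exact: measurable_kernel_l.
have : (\int[U01]_t \int[U01]_s W (X t - X s)%R <= (2 * e)%:E)%E.
  apply: (@le_trans _ _ (\int[U01]_t limn_einf (fun k => \int[U01]_s
    (g k (word m t (k * d)) (word m s (k * d)))%:E))%E).
    apply: ge0_le_integralT => t; first exact: integral_ge0.
    apply: le_trans (fatou U01 measurableT (fun k => mg_ k (word m t (k * d))) _).
      by apply: ge0_le_integralT => s //; exact: WX.
    by move=> k s _; rewrite lee_fin.
  apply: le_trans (fatou U01 measurableT mu_ _) _.
    by move=> k t _; apply: integral_ge0 => s _; rewrite lee_fin.
  by apply: limn_einf_le => k; exact: I_le.
move=> /(lee_wpmul2l (x := (2^-1)%:E)); rewrite lee_fin invr_ge0 => /(_ (ler0n _ 2)).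
by move=> /le_trans; apply; rewrite -EFinM mulrA mulVf ?mul1r// pnatr_eq0.
Qed.
End compactness.

(** * Diameter of minimisers *)

(* Replacing a particle by a random perturbation, of law [nu], of another one is
   an admissible comparison. *)
Definition doubling {R : realType} {d : nat} (W : 'rV[R]_d -> \bar R)
    (e : R) (Winf : \bar R) :=
  exists (nu : {measure set 'rV[R]_d -> \bar R}) (a g : R),
    [/\ nu setT = 1%E, (\int[nu]_y W y < +oo)%E,
        forall z, (\int[nu]_y W (z + y)%R <= a%:E * W z + g%:E)%E &
        [/\ 1 <= a, 0 <= g & ((a * e + g)%:E < Winf)%E]].

Section diameter_bound.
Context {R : realType} {d : nat}.
Variables (W : 'rV[R]_d -> \bar R) (RW : R).
Hypotheses (W0 : forall x, (0 <= W x)%E) (RW0 : 0 < RW)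
  (Wi : radially_strictly_increasing RW W) (mW : measurable_fun setT W)
  (Ws : forall x, W (- x) = W x).

Lemma pair_sum_split N (X : 'I_N -> 'rV[R]_d) i :
  (pair_sum W X = \sum_(j < N | j != i) W (X i - X j)%R +
    (\sum_(j < N | j != i) W (X i - X j)%R +
     \sum_(j < N | j != i) \sum_(k < N | (k != j) && (k != i)) W (X j - X k)%R))%E.
Proof.
rewrite /pair_sum (bigD1 i)//=; congr (_ + _)%E.
rewrite -big_split /=; apply: eq_bigr => j ji.
by rewrite (bigD1 i) 1?eq_sym//= -Ws opprB.
Qed.

Section fixed_size.
Variables (N : nat) (X : 'I_N -> 'rV[R]_d).
Hypotheses (Xmin : forall Y : 'I_N -> 'rV[R]_d, (pair_sum W X <= pair_sum W Y)%E)
  (Xfin : (pair_sum W X < +oo)%E).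

(** Only particle i is moved to y. Its pairs are counted twice in the pair sum, and the remaining
    pairs cancel because the total is finite. *)
Lemma euler_lagrange i y : (\sum_(j < N | j != i) W (X i - X j)%R <=
  \sum_(j < N | j != i) W (y - X j)%R)%E.
Proof.
pose X' j := if j == i then y else X j.
have := Xmin X'; rewrite (pair_sum_split X i) (pair_sum_split X' i).
set S := (\sum_(j < N | j != i) W (X i - X j)%R)%E.
rewrite (_ : (\sum_(j < N | j != i) W (X' i - X' j)%R)%E =
  (\sum_(j < N | j != i) W (y - X j)%R)%E); last first.
  by apply: eq_bigr => j ji; rewrite /X' eqxx (negPf ji).
set S' := (\sum_(j < N | j != i) W (y - X j)%R)%E.
set rest := (X in (S + (S + X) <= _)%E).
rewrite (_ : (\sum_(j < N | j != i) \sum_(k < N | (k != j) && (k != i))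
  W (X' j - X' k)%R)%E = rest); last first.
  apply: eq_bigr => j ji; apply: eq_bigr => k /andP[kj ki].
  by rewrite /X' (negPf ji) (negPf ki).
have S0 : (0 <= S)%E by exact: sume_ge0.
have S'0 : (0 <= S')%E by exact: sume_ge0.
have rest0 : (0 <= rest)%E by apply: sume_ge0 => j _; exact: sume_ge0.
move: Xfin; rewrite (pair_sum_split X i) -/S -/rest.
move: S0 S'0 rest0; case: S => [s||]; case: S' => [s'||]; case: rest => [r||] //=.
  by move=> _ _ _ _; rewrite -!EFinD !lee_fin; lra.
by move=> *; exact: leey.
Qed.

Variables (e : R) (Winf : \bar R).
Hypotheses (e0 : 0 <= e) (N2 : (2 <= N)%N)
  (Xe : (pair_sum W X <= ((N * N.-1)%:R * e)%:E)%E).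

(** Some i0 has potential at most the mean (N - 1) e; particle i is moved to X i0 + y with y of law
    nu. Its new interaction with i0 has mean at most w and occurs once, so that this error does not
    grow with N. *)
Lemma potential_bound (nu : {measure set 'rV[R]_d -> \bar R}) (a g w : R) :
  nu setT = 1%E -> (\int[nu]_y W y <= w%:E)%E ->
  (forall z, (\int[nu]_y W (z + y)%R <= a%:E * W z + g%:E)%E) ->
  1 <= a -> 0 <= g -> 0 <= w ->
  forall i, (\sum_(j < N | j != i) W (X i - X j)%R <=
    (N%:R * (a * e + g) + w)%:E)%E.
Proof.
move=> nu1 nuw nuD a1 g0 w0 i.
have Np : 0 < N%:R :> R by rewrite ltr0n (leq_trans _ N2).
have a0 : 0 <= a by exact: le_trans a1.
have N1 : N.-1%:R = N%:R - 1 :> R.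
  by rewrite -subn1 natrB// (leq_trans _ N2).
have [i0 i0P] : exists i0, (\sum_(j < N | j != i0) W (X i0 - X j)%R <=
    (N.-1%:R * e)%:E)%E.
  apply: contrapT => /forallNP all_gt.
  have : (((N * N.-1)%:R * e)%:E < pair_sum W X)%E; last by rewrite ltNge Xe.
  rewrite natrM -mulrA mulr_natl -[X in _ *+ X](card_ord N) -sumr_const -sumEFin.
  pose i1 : 'I_N := Ordinal (leq_trans (ltn0Sn 1) N2).
  rewrite /pair_sum (bigD1 i1)//= [ltRHS](bigD1 i1)//=.
  apply: lte_leD.
  - by rewrite sumEFin.
  - by rewrite ltNge; apply/negP/all_gt.
  - by apply: lee_sum => j _; rewrite leNgt; apply/negP => /ltW/(all_gt j).
have e_le : (N.-1%:R * e) <= N%:R * (a * e + g) + w.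
  have : e <= a * e by rewrite ler_peMl.
  rewrite N1 => ae; have : N%:R * e <= N%:R * (a * e) by rewrite ler_pM2l.
  have Ng : 0 <= N%:R * g by exact: mulr_ge0.
  have := e0; lra.
have [<-|ii0] := eqVneq i0 i.
  by apply: le_trans i0P _; rewrite lee_fin.
have mK j : measurable_fun setT (fun y : 'rV[R]_d => W ((X i0 - X j) + y)).
  apply: (measurableT_comp mW); apply: measurable_rV => k.
  rewrite (_ : (fun t => _) = fun y : 'rV[R]_d => (X i0 - X j) ord0 k + y ord0 k).
    by apply: measurable_funD => //; exact: measurable_coord.
  by apply/funext => y; rewrite mxE.
apply: (@le_trans _ _
    (\int[nu]_y \sum_(j < N | j != i) W ((X i0 - X j) + y)%R)%E).
  rewrite -[leLHS](integral_cst1 _ nu1); apply: ge0_le_integralT => y.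
    exact: sume_ge0.
  apply: le_trans (euler_lagrange i (X i0 + y)) _.
  by apply: lee_sum => j _; rewrite addrAC.
under eq_integral do rewrite big_mkcond.
rewrite ge0_integral_sum//; last 2 first.
- by move=> j; case: (j != i) => //; exact: measurable_cst.
- by move=> j y _; case: ifP.
rewrite (bigD1 i0)//= ii0 subrr.
under eq_integral do rewrite add0r.
rewrite (_ : (N%:R * (a * e + g) + w)%:E = w%:E + (N%:R * (a * e + g))%:E)%E; last first.
  by rewrite -EFinD addrC.
apply: leeD => //.
apply: (@le_trans _ _ (\sum_(j < N | j != i0) (a%:E * W (X i0 - X j) + g%:E))%E).
  apply: lee_sum => j _; case: (j != i); first exact: nuD.
  by rewrite integral0 adde_ge0// mule_ge0// lee_fin.
rewrite big_split /= -ge0_sume_distrr//.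
apply: (@le_trans _ _ (a%:E * (N.-1%:R * e)%:E + (N%:R * g)%:E)%E).
  apply: leeD; first by rewrite lee_wpmul2l// lee_fin.
  rewrite sumEFin lee_fin sumr_const -[leLHS]mulr_natl ler_wpM2r// ler_nat.
  by rewrite -[leqRHS](card_ord N) max_card.
rewrite -EFinM -EFinD lee_fin mulrDr lerD2r mulrCA ler_wpM2r ?mulr_ge0//.
by rewrite ler_nat leq_pred.
Qed.

End fixed_size.
End diameter_bound.

Lemma coord_spread_bound {R : realType} {d : nat} (W : 'rV[R]_d -> \bar R)
    (RW e : R) (Winf : \bar R) :
  (forall x, (0 <= W x)%E) -> 0 < RW -> radially_strictly_increasing RW W ->
  measurable_fun setT W -> (forall x, W (- x) = W x) ->
  (forall r : R, (r%:E < Winf)%E ->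
    exists M : R, forall x, M < enorm x -> (r%:E <= W x)%E) ->
  0 <= e -> doubling W e Winf ->
  exists C : R, forall N (X : 'I_N -> 'rV[R]_d), (2 <= N)%N ->
    (forall Y : 'I_N -> 'rV[R]_d, (pair_sum W X <= pair_sum W Y)%E) ->
    (pair_sum W X <= ((N * N.-1)%:R * e)%:E)%E ->
    forall i j k, X j ord0 k - X i ord0 k <= C.
Proof.
move=> W0 RW0 Wi mW Ws Wlim e0 [nu [a [g [nu1 nuW nuD [a1 g0 agW]]]]].
set G := a * e + g in agW.
have G0 : 0 <= G by rewrite addr_ge0// mulr_ge0// (le_trans _ a1).
have [q /andP[Gq /Wlim[M MP]]] := ereal_dense agW; rewrite lte_fin in Gq.
have q0 : 0 < q by exact: le_lt_trans Gq.
pose r := Num.max M 0 + 1.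
have r0 : 0 < r by rewrite ltr_wpDl// le_max lexx orbT.
have rP x : r <= enorm x -> (q%:E <= W x)%E.
  move=> rx; apply: MP; apply: lt_le_trans rx; rewrite /r.
  by rewrite (@le_lt_trans _ _ (Num.max M 0)) ?ltrDl// le_max lexx.
pose w := fine (\int[nu]_y W y)%E.
have wE : (\int[nu]_y W y = w%:E)%E.
  by rewrite /w fineK// ge0_fin_numE//; exact: integral_ge0.
have w0 : 0 <= w by rewrite -lee_fin -wE; exact: integral_ge0.
(* Since W >= q at distance at least r, each particle has at most (N G + w) / q particles that far
   away. Half of the remaining fraction 1 - G / q is given up to absorb w, as is possible for N >
   N0. *)
pose m1 := (q - G) / (2 * q).
have m10 : 0 < m1 by rewrite divr_gt0 ?subr_gt0// mulr_gt0.
pose N0 := (Num.truncn (w / (q * m1))).+1.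
have N0P : w <= N0%:R * (q * m1).
  rewrite -ler_pdivrMr; last exact: mulr_gt0.
  exact: (ltW (truncnS_gt _)).
(* For N <= N0 the particle itself is a fraction at least 1 / N0 of all. *)
pose m := Num.min m1 N0%:R^-1.
have m0 : 0 < m by rewrite lt_min m10 invr_gt0 ltr0n.
pose K := (Num.truncn m^-1).+1.
have Km : 1 < K%:R * m by rewrite -ltr_pdivrMr// div1r; exact: truncnS_gt.
exists (K.+1%:R * (2 * r + 2 * RW)) => N X N2 Xmin Xe.
have Xfin : (pair_sum W X < +oo)%E by apply: le_lt_trans Xe _; rewrite ltry.
move=> i j k; apply: (@spread_bound R N (fun i => X i ord0 k) RW r m K) => //.
  by apply: no_gap => //.
move=> {}i; pose far := [pred j | r <= enorm (X i - X j)].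
have farq : #|far|%:R * q <= N%:R * G + w.
  rewrite -lee_fin; apply: le_trans (potential_bound W0 mW Ws Xmin Xfin e0 N2 Xe
    nu1 _ nuD a1 g0 w0 i); last by rewrite wE.
  rewrite mulr_natl -sumr_const -sumEFin big_mkcond [leRHS]big_mkcond.
  apply: lee_sum => l _; have [->|li] := eqVneq l i => /=.
    by have -> : (i \in far) = false by rewrite inE /= subrr enorm0 leNgt r0.
  by case: ifP => // lf; exact: rP.
have nf : #|[pred j | `|X j ord0 k - X i ord0 k| < r]|%:R >= N%:R - #|far|%:R :> R.
  rewrite lerBlDr -natrD ler_nat -[leqLHS](card_ord N) -(cardC far) addnC leq_add2r.
  apply: subset_leq_card; apply/fintype.subsetP => l; rewrite !inE -ltNge; apply: le_lt_trans.
  by rewrite distrC; have := coord_le_enorm (X i - X l) k; rewrite !mxE.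
have near1 : 1 <= #|[pred j | `|X j ord0 k - X i ord0 k| < r]|%:R :> R.
  rewrite ler1n lt0n; apply/eqP => /card0_eq /(_ i).
  by rewrite !inE subrr normr0 r0.
have Np : 0 < N%:R :> R by rewrite ltr0n (leq_trans _ N2).
have [NN0|N0N] := leqP N N0.
  apply: le_trans near1; rewrite (@le_trans _ _ (N0%:R^-1 * N%:R))//.
    by rewrite ler_pM2r// ge_min lexx orbT.
  by rewrite ler_pdivrMl ?ltr0n// mulr1 ler_nat.
apply: le_trans nf; rewrite (@le_trans _ _ (m1 * N%:R))//.
  by rewrite ler_pM2r// ge_min lexx.
rewrite -(ler_pM2r q0) mulrBl lerBrDr (le_trans (lerD (lexx _) farq))//.
have wN : w <= N%:R * (q * m1).
  apply: le_trans N0P _; apply: ler_wpM2r; first by rewrite mulr_ge0// ltW.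
  by rewrite ler_nat ltnW.
have qm : q * m1 = (q - G) / 2 by rewrite /m1; field; rewrite gt_eqF.
rewrite qm in wN.
have -> : m1 * N%:R * q = N%:R * ((q - G) / 2) by rewrite -qm; ring.
by have -> : N%:R * q = N%:R * ((q - G) / 2) + (N%:R * G + N%:R * ((q - G) / 2)); [field|lra].
Qed.

(** * Lebesgue measure of boxes and balls *)

Lemma limf_einf_ge {T : choiceType} {X : filteredType T} {R : realType}
    (f : X -> \bar R) (F : set_system X) (K : \bar R) :
  F [set x | K <= f x]%E -> (K <= limf_einf f F)%E.
Proof.
move=> FK; rewrite /limf_einf leeNr limf_esupE.
apply: (@le_trans _ _ (ereal_sup [set (- f x)%E | x in [set x | (K <= f x)%E]])).
  by apply: ereal_inf_lbound; exists [set x | (K <= f x)%E].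
by apply: ge_ereal_sup => _ [x /= Kx <-]; rewrite leeN2.
Qed.

Lemma le_integral_lower d (T : measurableType d) (R : realType)
    (mu : {measure set T -> \bar R}) (D : set T) (f g : T -> \bar R) :
  measurable D -> measurable_fun D f -> mu.-integrable D g ->
  (forall x, D x -> g x <= f x)%E ->
  (\int[mu]_(x in D) g x <= \int[mu]_(x in D) f x)%E.
Proof.
move=> mD mf ig gf; have mg := measurable_int _ ig.
rewrite integralE [leRHS]integralE; apply: leeB.
  apply: ge0_le_integral => //; do ?exact: measurable_funepos.
  move=> x Dx; rewrite !funeposE ge_max !le_max lexx orbT andbT.
  by rewrite gf.
apply: ge0_le_integral => //; do ?exact: measurable_funeneg.
by move=> x Dx; rewrite !funenegE ge_max !le_max lexx orbT andbT leeN2 gf.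
Qed.

(** * Reflection invariance of the Lebesgue measure, for integrals of odd functions *)

Section lebesgue_reflection.
Context {R : realType}.
Local Open Scope ereal_scope.

Lemma integral_lebesgueN (f : R -> \bar R) :
  measurable_fun setT f -> (forall t, 0 <= f t) ->
  \int[@lebesgue_measure R]_t f (- t)%R = \int[@lebesgue_measure R]_t f t.
Proof.
move=> mf f0.
have mN : measurable_fun setT (-%R : measurableTypeR R -> measurableTypeR R).
  exact: oppr_measurable.
rewrite -(@ge0_integral_pushforward _ _ _ _ _ _ mN lebesgue_measure setT f)//.
by apply: eq_measure_integral => A mA _; exact: lebesgue_measureN.
Qed.

Lemma measurable_oppr_rV d : measurable_fun setT (-%R : 'rV[R]_d -> 'rV[R]_d).
Proof.
apply: measurable_rV => i.
rewrite (_ : (fun _ => _) = (fun x : 'rV[R]_d => - x ord0 i)%R).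
  by apply: measurableT_comp => //; exact: measurable_coord.
by apply/funext => x; rewrite mxE.
Qed.

Lemma consrVN d t (y : 'rV[R]_d) : consrV (- t, - y)%R = (- consrV (t, y))%R.
Proof.
apply/rowP => i; rewrite [RHS]mxE; have [j ->|->] := unliftP ord0 i.
  by rewrite !consrVES /= mxE.
by rewrite !consrVE0.
Qed.

(** Induction on the dimension: the hypothesis reflects the section over t, and one-dimensional
    reflection then changes - t into t. *)
Lemma lebesgue_rVN d (A : set 'rV[R]_d) : measurable A ->
  lebesgue_rV d (-%R @^-1` A) = lebesgue_rV d A.
Proof.
elim: d A => [|d IH] A mA.
  rewrite (_ : -%R @^-1` A = A)//; apply/seteqP.
  have E (x : 'rV[R]_0) : (- x)%R = x by apply/rowP => -[].
  by split => x /=; rewrite E.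
pose B := @consrV R d @^-1` A.
have mB : measurable B by rewrite -[B]setTI; exact: measurable_consrV.
rewrite /= /lebesgue_step /product_measure1 /=.
transitivity (\int[@lebesgue_measure R]_t (lebesgue_rV d (xsection B (- t)%R))).
  apply: eq_integral => t _.
  rewrite -IH; last exact: measurable_xsection.
  congr (lebesgue_rV d _); apply/seteqP; split => y;
    rewrite /xsection /= !inE /B /preimage /=.
  - by rewrite consrVN.
  - by rewrite consrVN.
rewrite (@integral_lebesgueN (fun t => lebesgue_rV d (xsection B t)))//.
exact: measurable_fun_xsection.
Qed.

Lemma integral_rVN d (D : set 'rV[R]_d) (f : 'rV[R]_d -> \bar R) :
  measurable D -> -%R @^-1` D = D -> measurable_fun setT f ->
  (lebesgue_rV d).-integrable D (f \o -%R) ->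
  \int[lebesgue_rV d]_(y in D) f (- y)%R = \int[lebesgue_rV d]_(y in D) f y.
Proof.
move=> mD ND mf intf.
rewrite -ND in intf.
rewrite -{1}ND -[LHS](integral_pushforward (@measurable_oppr_rV d) mf intf mD).
apply: eq_measure_integral; first exact: measurable_oppr_rV.
by move=> mN A mA _; exact: lebesgue_rVN.
Qed.

End lebesgue_reflection.

Section eball.
Context {R : realType} {d : nat}.
Local Notation mu := (@lebesgue_rV R d).

Lemma enorm_continuous : continuous (enorm : 'rV[R]_d -> R).
Proof.
move=> x; apply: (@continuous_comp _ _ _
  (fun y : 'rV[R]_d => \sum_(i < d) y ord0 i ^+ 2) (@Num.sqrt R)).
  apply: cvg_big; do ?[exact: add_continuous|exact: nbhs_filter].
  move=> i _.
  apply: (@continuous_comp _ _ _ (fun y : 'rV[R]_d => y ord0 i) (fun t => t ^+ 2)).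
    exact: coord_continuous.
  exact: exprn_continuous.
exact: sqrt_continuous.
Qed.

Lemma eball0_open r : open (eball (0 : 'rV[R]_d) r).
Proof.
rewrite (_ : eball _ r = enorm @^-1` [set t | t < r]); last first.
  by rewrite /eball; apply/seteqP; split => x /=; rewrite subr0.
by apply: open_comp; [move=> x _; exact: enorm_continuous|exact: open_lt].
Qed.

Lemma measurable_eball0 r : measurable (eball (0 : 'rV[R]_d) r).
Proof. by apply: open_measurable_rV; exact: eball0_open. Qed.

Definition obox (a b : R) : set 'rV[R]_d := [set y | forall i, a < y ord0 i < b].

Lemma measurable_obox a b : measurable (obox a b).
Proof.
rewrite (_ : obox a b = [set y : 'rV[R]_d | forall i, `]a, b[%classic (y ord0 i)]).
  by apply: (@measurable_box R d (fun=> `]a, b[%classic)) => i.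
by apply/seteqP; split => y /= h i; have := h i; rewrite /= in_itv.
Qed.

Lemma lebesgue_obox a b : a <= b -> mu (obox a b) = ((b - a) ^+ d)%:E.
Proof.
move=> ab.
rewrite (_ : obox a b = [set y : 'rV[R]_d | forall i, `]a, b[%classic (y ord0 i)]).
  rewrite (lebesgue_rV_box (A := fun _ => `]a, b[%classic))//.
  rewrite (eq_bigr (fun=> (b - a)%:E)); last first.
    move=> i _; rewrite lebesgue_measure_itv /= lte_fin -EFinB.
    by case: ltgtP ab => // -> _; rewrite subrr.
  by rewrite prodEFin prodr_const card_ord.
by apply/seteqP; split => y /= h i; have := h i; rewrite /= in_itv.
Qed.

Lemma eball0_sub_obox r : 0 <= r -> eball 0 r `<=` obox (- r) r.
Proof.
move=> r0 y; rewrite /eball /= subr0 => yr i; rewrite -ltr_norml.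
by apply: le_lt_trans yr; exact: coord_le_enorm.
Qed.

(** This cube stays away from the coordinate hyperplanes: its coordinates exceed r / 2d, which
    bounds from below both the volume and the second moments of the ball. *)
Lemma obox_sub_eball0 r : (1 <= d)%N -> 0 < r ->
  obox (r / (2 * d%:R)) (r / d%:R) `<=` eball 0 r.
Proof.
move=> d1 r0 y yb; rewrite /eball /= subr0.
have dp : 0 < d%:R :> R by rewrite ltr0n.
apply: le_lt_trans (enorm_le_norm y) _; rewrite -ltr_pdivlMl// mulrC.
apply: norm_lt_coord => [|i]; first by rewrite divr_gt0.
have /andP[h1 h2] := yb i; rewrite gtr0_norm//; apply: lt_trans h1.
by rewrite divr_gt0// mulr_gt0.
Qed.

Lemma lebesgue_eball0_fin r : 0 < r -> (mu (eball 0 r) < +oo)%E.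
Proof.
move=> r0; apply: (@le_lt_trans _ _ (mu (obox (- r) r))).
  apply: le_measure; rewrite ?inE; [exact: measurable_eball0
    |exact: measurable_obox|exact/eball0_sub_obox/ltW].
by rewrite lebesgue_obox ?ltry//; lra.
Qed.

Lemma lebesgue_eball0_ge r : (1 <= d)%N -> 0 < r ->
  (((r / (2 * d%:R)) ^+ d)%:E <= mu (eball 0 r))%E.
Proof.
move=> d1 r0; have dp : 0 < d%:R :> R by rewrite ltr0n.
have h : r / (2 * d%:R) <= r / d%:R.
  by rewrite ler_pM2l// lef_pV2 ?posrE ?mulr_gt0// ler_peMl// ler1n.
apply: (@le_trans _ _ (mu (obox (r / (2 * d%:R)) (r / d%:R)))).
  rewrite lebesgue_obox// lee_fin.
  by rewrite le_eqVlt; apply/orP; left; apply/eqP; congr (_ ^+ _); field; rewrite gt_eqF.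
apply: le_measure; rewrite ?inE; [exact: measurable_obox
  |exact: measurable_eball0|exact: obox_sub_eball0].
Qed.

Lemma eball0N r : -%R @^-1` eball (0 : 'rV[R]_d) r = eball 0 r.
Proof. by rewrite /eball; apply/seteqP; split => y /=; rewrite !subr0 enormN. Qed.

Lemma integrable_eball0 r (f : 'rV[R]_d -> R) M : 0 < r ->
  measurable_fun setT f -> (forall y, eball 0 r y -> `|f y| <= M) ->
  mu.-integrable (eball 0 r) (EFin \o f).
Proof.
move=> r0 mf fM; apply: measurable_bounded_integrable.
- exact: measurable_eball0.
- exact: lebesgue_eball0_fin.
- exact: measurable_funS mf.
- by exists M; split => [|x Mx y /= yr]; [exact: num_real
    |exact: le_trans (fM _ yr) (ltW Mx)].
Qed.

Lemma integral_odd_eball0 r (f : 'rV[R]_d -> R) M : 0 < r ->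
  measurable_fun setT f -> (forall y, eball 0 r y -> `|f y| <= M) ->
  (forall y, f (- y) = - f y) -> (\int[mu]_(y in eball 0 r) (f y)%:E = 0)%E.
Proof.
move=> r0 mf fM fN; have intf := integrable_eball0 r0 mf fM.
have If : (\int[mu]_(y in eball 0 r) (f y)%:E)%E \is a fin_num.
  exact: (integrable_fin_num (measurable_eball0 r) intf).
have intN : mu.-integrable (eball 0 r) ((EFin \o f) \o -%R).
  rewrite (_ : _ \o -%R = EFin \o (fun y => - f y)).
    apply: (@integrable_eball0 _ _ M) => //; first exact: measurable_funN.
    by move=> y yr; rewrite normrN; exact: fM.
  by apply/funext => y /=; rewrite fN.
have mEf : measurable_fun setT (EFin \o f) by exact/measurable_EFinP.
have := integral_rVN (measurable_eball0 r) (eball0N r) mEf intN.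
rewrite /= (eq_integral (fun y => - (f y)%:E)%E); last first.
  by move=> y _; rewrite fN.
rewrite integralN; last first.
  by rewrite fin_num_adde_defl// fin_numN; exact: (integrable_neg_fin_num (measurable_eball0 r) intf).
rewrite -(fineK If) -EFinN => -[] h; congr EFin; lra.
Qed.

End eball.

(** * Barriers for the generalised Laplacian *)

Section laplacian.
Context {R : realType} {d : nat}.
Hypothesis d1 : (1 <= d)%N.
Local Notation mu := (@lebesgue_rV R d).

Lemma lebesgue_eball0E r : 0 < r -> exists2 m : R, 0 < m & mu (eball 0 r) = m%:E.
Proof.
move=> r0; have mge := lebesgue_eball0_ge d1 r0.
have mfin := lebesgue_eball0_fin (d := d) r0.
have m0 : (0 < mu (eball 0 r))%E.
  apply: lt_le_trans mge; rewrite lte_fin exprn_gt0// divr_gt0// mulr_gt0//.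
  by rewrite ltr0n.
exists (fine (mu (eball 0 r))).
  by rewrite -lte_fin fineK// ge0_fin_numE.
by rewrite fineK// ge0_fin_numE.
Qed.

Lemma measurable_shift (W : 'rV[R]_d -> \bar R) (x : 'rV[R]_d) :
  measurable_fun setT W ->
  measurable_fun setT (fun y : 'rV[R]_d => W (x + y)).
Proof.
move=> mW; apply: (measurableT_comp mW); apply: measurable_rV => k.
rewrite (_ : (fun t => _) = fun y : 'rV[R]_d => x ord0 k + y ord0 k).
  by apply: measurable_funD => //; exact: measurable_coord.
by apply/funext => y; rewrite mxE.
Qed.

(* The linear part f of the expansion is odd, so it averages out over balls. *)
Lemma laplacian0_ge (W : 'rV[R]_d -> \bar R) (x : 'rV[R]_d) (w r s M1 M2 : R)
    (f k : 'rV[R]_d -> R) :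
  measurable_fun setT W -> W x = w%:E -> 0 < r ->
  measurable_fun setT f -> (forall y, f (- y) = - f y) ->
  (forall y, eball 0 r y -> `|f y| <= M1) ->
  measurable_fun setT k -> (forall y, eball 0 r y -> `|k y| <= M2) ->
  (forall y, eball 0 r y -> ((w + f y + k y)%:E <= W (x + y)%R)%E) ->
  (forall e, 0 < e < r -> ((s * e ^+ 2)%:E * mu (eball 0 e) <=
     \int[mu]_(y in eball 0 e) (k y)%:E)%E) ->
  ((2 * (d%:R + 2) * s)%:E <= laplacian0 W x)%E.
Proof.
move=> mW Wx r0 mf fN fM mk kM Wge kint; apply: limf_einf_ge.
near=> e.
have e0 : 0 < e by near: e; exact: nbhs_right_gt.
have er : e < r by near: e; exact: nbhs_right_lt.
have sub y : eball 0 e y -> eball (0 : 'rV[R]_d) r y.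
  by rewrite /eball /= => /lt_trans; apply.
have [m m0 mE] := lebesgue_eball0E e0.
have If : mu.-integrable (eball 0 e) (EFin \o f).
  by apply: (@integrable_eball0 _ _ _ _ M1) => // y /sub; exact: fM.
have Ik : mu.-integrable (eball 0 e) (EFin \o k).
  by apply: (@integrable_eball0 _ _ _ _ M2) => // y /sub; exact: kM.
have Iw : mu.-integrable (eball 0 e) (fun=> w%:E).
  by apply: (@integrable_eball0 _ _ _ (fun=> w) `|w|).
have mB := measurable_eball0 (d := d) e.
have le : (((w + s * e ^+ 2) * m)%:E <= \int[mu]_(y in eball 0 e) W (x + y)%R)%E.
  apply: (@le_trans _ _ (\int[mu]_(y in eball 0 e) (w%:E + ((f y)%:E + (k y)%:E)))%E).
    rewrite integralD//; last exact: integrableD.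
    rewrite integralD// integral_cst//.
    rewrite (integral_odd_eball0 (M := M1) e0 mf)//; last by move=> y /sub; exact: fM.
    rewrite add0e mulrDl EFinD; apply: leeD; first by rewrite EFinM -mE; exact: lexx.
    by rewrite EFinM -mE; apply: kint; rewrite e0 er.
  apply: le_integral_lower => //.
  - apply: measurable_funS (measurable_shift x mW) => //.
  - by apply: integrableD => //; exact: integrableD.
  - by move=> y /sub yr; rewrite -!EFinD addrA; exact: Wge.
rewrite /= /laplacian_eps mE inver gt_eqF// Wx.
have e2 : 0 < e ^+ 2 by rewrite exprn_gt0.
have c0 : 0 < 2 * (d%:R + 2) / e ^+ 2 by rewrite divr_gt0// mulr_gt0// ltr_wpDl.
have -> : (2 * (d%:R + 2) * s)%:E =
    ((2 * (d%:R + 2) / e ^+ 2)%:E * (s * e ^+ 2)%:E)%E.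
  by rewrite -EFinM; congr EFin; field; rewrite gt_eqF.
rewrite lee_pmul2l//.
rewrite leeBrDr// -EFinD addrC.
rewrite (_ : (w + s * e ^+ 2)%:E = ((m^-1)%:E * ((w + s * e ^+ 2) * m)%:E)%E).
  by rewrite lee_pmul2l// lte_fin invr_gt0.
by rewrite -EFinM; congr EFin; field; rewrite gt_eqF.
Unshelve. all: by end_near. Qed.

(** A crude lower bound for the mean of (y_k / e)^2 over the ball of radius e: the square of the
    least coordinate 1 / 2d in the inner cube, times the ratio of the volumes of that cube and of
    the cube of side 2 e around the ball. *)
Definition second_moment : R := (4 * d%:R ^+ 2)^-1 * (4 * d%:R)^-1 ^+ d.

Lemma second_moment_gt0 : 0 < second_moment.
Proof.
have dp : 0 < d%:R :> R by rewrite ltr0n.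
by rewrite mulr_gt0// ?exprn_gt0// invr_gt0 mulr_gt0// exprn_gt0.
Qed.

Lemma integral_sqr_coord e (k : 'I_d) : 0 < e ->
  ((second_moment * e ^+ 2)%:E * mu (eball 0 e) <=
   \int[mu]_(y in eball 0 e) (y ord0 k ^+ 2)%:E)%E.
Proof.
move=> e0; have dp : 0 < d%:R :> R by rewrite ltr0n.
set a := e / (2 * d%:R); set b := e / d%:R.
have a0 : 0 < a by rewrite divr_gt0// mulr_gt0.
have ab : b = a + a by rewrite /a /b; field; rewrite gt_eqF.
have mP := measurable_obox (d := d) a b.
have mk : measurable_fun setT (fun y : 'rV[R]_d => (y ord0 k ^+ 2)%:E).
  by apply/measurable_EFinP; apply: measurable_funX; exact: measurable_coord.
apply: (@le_trans _ _ (\int[mu]_(y in obox a b) (y ord0 k ^+ 2)%:E)%E); last first.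
  apply: ge0_subset_integral => //.
  - exact: measurable_eball0.
  - exact: measurable_funS mk.
  - by move=> y _; rewrite lee_fin sqr_ge0.
  - exact: obox_sub_eball0.
apply: (@le_trans _ _ (\int[mu]_(y in obox a b) (a ^+ 2)%:E)%E); last first.
  apply: ge0_le_integral => //.
  - by move=> y _; rewrite lee_fin sqr_ge0.
  - exact: measurable_funS mk.
  - move=> y yb; have /andP[h _] := yb k; rewrite lee_fin.
    by rewrite ler_sqr ?nnegrE; rewrite ?ltW// (lt_trans a0).
rewrite integral_cst//.
rewrite [X in (_ <= _ * X)%E](_ : _ = ((b - a) ^+ d)%:E); last first.
  by apply: lebesgue_obox; lra.
apply: (@le_trans _ _ ((second_moment * e ^+ 2)%:E * ((e + e) ^+ d)%:E)%E).
  apply: lee_wpmul2l; first by rewrite lee_fin mulr_ge0// ?sqr_ge0// ltW// second_moment_gt0.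
  have <- : mu (obox (- e) e) = ((e + e) ^+ d)%:E.
    by rewrite lebesgue_obox ?opprK//; lra.
  apply: le_measure; rewrite ?inE; [exact: measurable_eball0
    |exact: measurable_obox|exact/eball0_sub_obox/ltW].
rewrite -!EFinM lee_fin ab addrK le_eqVlt; apply/orP; left; apply/eqP.
rewrite /second_moment /a.
have <- : (4 * d%:R)^-1 ^+ d * (e + e) ^+ d = (e / (2 * d%:R)) ^+ d.
  by rewrite -exprMn; congr (_ ^+ _); field; rewrite gt_eqF.
move: ((4 * d%:R)^-1 ^+ d) ((e + e) ^+ d) => u v.
by field; rewrite gt_eqF.
Qed.

End laplacian.

(** At a minimum point x of W - h on K, a translate of the graph of h touches W from below. No two
    values of W are subtracted, as they may be infinite. *)
Lemma barrier_min {R : realType} {T : topologicalType} (W : T -> \bar R)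
    (h : T -> R) (K : set T) : lower_semicontinuous W -> (forall x, -oo < W x)%E ->
  continuous h -> compact K -> K !=set0 ->
  exists2 x, K x & forall y, K y -> (W x + (h y - h x)%:E <= W y)%E.
Proof.
move=> lW WNy ch cK K0.
have lu : lower_semicontinuous (fun x => W x + (- h x)%:E)%E.
  move=> x a; rewrite -lteBlDr// => /ereal_dense[b /andP[ab /lW[V nV VW]]].
  rewrite -EFinB opprK lte_fin in ab.
  have e0 : 0 < b - (a + h x) by rewrite subr_gt0.
  have /cvgrPdist_lt/(_ _ e0) nh := ch x.
  exists (V `&` [set y | `|h x - h y| < b - (a + h x)]); first exact: filterI.
  move=> y [/VW Wy /= hy]; rewrite -lteBlDr// -EFinB opprK; apply: lt_trans Wy.
  by rewrite lte_fin; move: hy; rewrite ltr_norml => /andP[hy _]; lra.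
have [x Kx xmin] := lsc_compact_min lu cK K0.
exists x => // y Ky; move: (xmin y Ky) (WNy x) (WNy y).
case: (W x) => [u||]; case: (W y) => [v||] //= + _ _.
  by rewrite -!EFinD !lee_fin; lra.
by move=> _; exact: leey.
Qed.

Section enorm_sq.
Context {R : realType} {d : nat}.
Implicit Types x y : 'rV[R]_d.

Definition dot x y : R := \sum_(i < d) x ord0 i * y ord0 i.

Lemma sqr_enormD x y :
  enorm (x + y) ^+ 2 = enorm x ^+ 2 + 2 * dot x y + enorm y ^+ 2.
Proof.
rewrite !sqr_enorm /dot mulr_sumr -!big_split /=; apply: eq_bigr => i _.
by rewrite mxE; ring.
Qed.

Lemma dotNr x y : dot x (- y) = - dot x y.
Proof. by rewrite /dot -sumrN; apply: eq_bigr => i _; rewrite mxE mulrN. Qed.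

Lemma dot_le x y : `|dot x y| <= d%:R * (enorm x * enorm y).
Proof.
apply: le_trans (ler_norm_sum _ _ _) _.
rewrite -[X in _ <= X%:R * _](card_ord d) mulr_natl -sumr_const.
by apply: ler_sum => i _; rewrite normrM ler_pM// coord_le_enorm.
Qed.

Lemma measurable_dot x : measurable_fun setT (dot x).
Proof.
apply: measurable_sum => i; apply: measurable_funM => //.
exact: measurable_coord.
Qed.

Lemma enorm_near x r : enorm x < r ->
  exists2 e, 0 < e & forall y, enorm y < e -> enorm (x + y) < r.
Proof.
move=> xr; have := @open_lt R r; rewrite openE => /(_ _ xr) nr.
have /nbhs_normP[e /= e0 eP] := @enorm_continuous R d x _ nr.
exists e => // y ye; apply: (eP (x + y)) => /=.
by rewrite opprD addNKr normrN (le_lt_trans (norm_le_enorm y)).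
Qed.

Lemma closed_eball_compact r : compact [set x : 'rV[R]_d | enorm x <= r].
Proof.
apply: bounded_closed_compact.
  exists r; split; first exact: num_real.
  by move=> M rM x /= xr; rewrite (le_trans (norm_le_enorm x))// (le_trans xr)// ltW.
rewrite (_ : [set _ | _] = enorm @^-1` [set t | t <= r])//.
by apply: closed_comp; [move=> x _; exact: enorm_continuous|exact: closed_le].
Qed.

End enorm_sq.

Section power.
Context {R : realType}.

Lemma ln_le_sub1 (u : R) : 0 < u -> ln u <= u - 1.
Proof.
move=> u0; rewrite -[X in ln X](subrK 1) addrC; apply: le_ln1Dx; lra.
Qed.

(** The convex function t^(-p) lies above its tangent; this follows from exp u >= 1 + u and ln u <=
    u - 1. *)
Lemma power_tangent (p t t' : R) : 0 < p -> 0 < t -> 0 < t' ->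
  expR (- p * ln t) - p * expR (- p * ln t) / t * (t' - t) <= expR (- p * ln t').
Proof.
move=> p0 t0 t'0.
have -> : - p * ln t' = - p * ln t + - p * ln (t' / t).
  by rewrite ln_div ?posrE//; ring.
rewrite expRD; set E := expR (- p * ln t); have E0 : 0 < E by exact: expR_gt0.
have -> : E - p * E / t * (t' - t) = E * (1 - p * (t' / t - 1)).
  by field; rewrite gt_eqF.
rewrite ler_pM2l//; apply: le_trans (expR_ge1Dx _).
rewrite lerD2l mulNr lerN2 ler_pM2l//; apply: ln_le_sub1.
by rewrite divr_gt0.
Qed.

End power.

Section barriers.
Context {R : realType} {d : nat}.
Hypothesis d1 : (1 <= d)%N.
Variables (W : 'rV[R]_d -> \bar R) (c0 : R).
Hypotheses (mW : measurable_fun setT W) (lW : lower_semicontinuous W)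
  (Wc : forall x, (c0%:E <= W x)%E).

Let WNy x : (-oo < W x)%E. Proof. by apply: lt_le_trans (Wc x); rewrite ltNyr. Qed.

(* Comparison with the quadratic c0 + L (x_1 - s)^2 on a cap of a ball. *)
Lemma growth_bound (RW CW : R) : 0 < RW -> radially_strictly_increasing RW W ->
  0 < CW -> (forall x, (laplacian0 W x <= CW%:E)%E) ->
  exists2 B, 0 <= B & forall z q, RW + 4 <= enorm z -> RW <= enorm q ->
    enorm q <= enorm z + 1 -> (W q - c0%:E <= 16%:E * (W z - c0%:E) + B%:E)%E.
Proof.
move=> RW0 Wi CW0 lap.
have Wfin x : RW <= enorm x -> W x \is a fin_num.
  by move=> xR; rewrite fin_numE (gt_eqF (WNy x)) (lt_eqF (increasing_fin RW0 Wi xR)).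
pose s0 := @second_moment R d; have s00 : 0 < s0 by exact: second_moment_gt0.
pose D := 2 * (d%:R + 2) * s0.
have D0 : 0 < D by rewrite mulr_gt0// mulr_gt0// ltr_wpDl.
exists (16 * CW / D); first by rewrite divr_ge0// ?mulr_ge0// ltW.
move=> z q zR qR qz.
have [m mE] : exists m, W z = m%:E.
  by exists (fine (W z)); rewrite fineK// Wfin//; lra.
have [M ME] : exists M, W q = M%:E by exists (fine (W q)); rewrite fineK// Wfin.
have cm : c0 <= m by rewrite -lee_fin -mE.
have cM : c0 <= M by rewrite -lee_fin -ME.
rewrite mE ME -!EFinB -EFinM -EFinD lee_fin.
set rho := enorm z in zR qz.
(* On the spherical part of the boundary of the cap x_1 - (rho - 2) <= 4, so this L gives h <= c0 +
   16 L = M = W q there. *)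
pose L := (M - c0) / 16; have L0 : 0 <= L by rewrite divr_ge0// subr_ge0.
(* If D L <= CW, then M - c0 = 16 L is within the additive constant. Otherwise W cannot be touched
   from below by h in the interior of the cap, where its generalised Laplacian would be at least D L
   > CW. *)
have [LD|LD] := leP (D * L) CW.
  have : L <= CW / D by rewrite ler_pdivlMr// mulrC.
  have -> : 16 * CW / D = 16 * (CW / D) by rewrite mulrA.
  have : M - c0 = 16 * L by rewrite /L; field.
  have CD : 0 <= CW / D by rewrite divr_ge0// ltW.
  lra.
pose i0 : 'I_d := Ordinal d1.
pose h (x : 'rV[R]_d) := c0 + L * (x ord0 i0 - (rho - 2)) ^+ 2.
have ch : continuous h.
  move=> x; apply: (@continuous_comp _ _ _ (fun y : 'rV[R]_d => y ord0 i0)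
    (fun t => c0 + L * (t - (rho - 2)) ^+ 2)); first exact: coord_continuous.
  apply: continuousD; first exact: cst_continuous.
  apply: continuousM; first exact: cst_continuous.
  apply: (@continuous_comp _ _ _ (fun t => t - (rho - 2)) (fun t => t ^+ 2)).
    by apply: continuousB; [exact: cvg_id|exact: cst_continuous].
  exact: exprn_continuous.
pose K := [set x : 'rV[R]_d | enorm x <= rho + 2] `&`
  [set x : 'rV[R]_d | rho - 2 <= x ord0 i0].
have cK : compact K.
  apply: compact_closedI; first exact: closed_eball_compact.
  rewrite (_ : [set _ | _] = (fun x : 'rV[R]_d => x ord0 i0) @^-1` [set t | rho - 2 <= t])//.
  by apply: closed_comp; [move=> x _; exact: coord_continuous|exact: closed_ge].
pose p : 'rV[R]_d := (rho - 1) *: 'e_i0.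
have enp : enorm p = rho - 1.
  rewrite enormZ ger0_norm; last by lra.
  rewrite /enorm (bigD1 i0)//= big1 => [|i ii0].
    by rewrite addr0 mxE !eqxx expr1n sqrtr1 mulr1.
  by rewrite mxE (negPf ii0) andbF expr0n.
have pi0 : p ord0 i0 = rho - 1 by rewrite !mxE !eqxx mulr1.
have Kp : K p by split; rewrite /= ?enp ?pi0; lra.
have [x [/= xb xc] xmin] := barrier_min lW WNy ch cK (ex_intro _ p Kp).
have xR : RW <= enorm x.
  by apply: le_trans (coord_le_enorm x i0); rewrite (le_trans _ (ler_norm _)); lra.
have [w wE] : exists w, W x = w%:E by exists (fine (W x)); rewrite fineK// Wfin.
(* If h <= W at the touching point, then also at p, where h = c0 + L; since |p| = rho - 1 < |z|,
   this yields c0 + L <= W z. It covers both parts of the boundary: on the flat one h = c0 <= W, on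
   the spherical one h <= M = W q < W. *)
have goalP : h x <= w -> M - c0 <= 16 * (m - c0) + 16 * CW / D.
  move=> hw; have := xmin p Kp.
  have : (W p < W z)%E by apply: Wi; rewrite enp -/rho; lra.
  rewrite mE wE => Wpz /le_lt_trans/(_ Wpz); rewrite -EFinD lte_fin /h pi0 => hp.
  have -> : M - c0 = 16 * L by rewrite /L; field.
  have : 0 <= 16 * CW / D by rewrite divr_ge0// ?mulr_ge0// ltW.
  rewrite -/(h x) in hp; nra.
have [xc2|xc2] := leP (x ord0 i0) (rho - 2).
  apply: goalP; rewrite /h (_ : x ord0 i0 = rho - 2); last by apply/eqP; rewrite eq_le xc2 xc.
  by rewrite subrr expr0n mulr0 addr0 -lee_fin -wE.
have [xb2|xb2] := leP (rho + 2) (enorm x).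
  apply: goalP; have : (W q < W x)%E by apply: Wi => //; lra.
  rewrite wE ME lte_fin => Mw; apply: le_trans (ltW Mw).
  have xi : x ord0 i0 - (rho - 2) <= 4.
    by have := coord_le_enorm x i0; rewrite ler_norml => /andP[_]; lra.
  have x0 : 0 <= x ord0 i0 - (rho - 2) by rewrite subr_ge0.
  have : (x ord0 i0 - (rho - 2)) ^+ 2 <= 16 by nra.
  rewrite /h /L; nra.
exfalso; have := lap x; apply/negP; rewrite -ltNge.
have [e1 e10 e1P] := enorm_near xb2.
pose r := Num.min e1 (x ord0 i0 - (rho - 2)).
have r0 : 0 < r by rewrite lt_min e10 subr_gt0.
apply: (@lt_le_trans _ _ (2 * (d%:R + 2) * (L * s0))%:E).
  by rewrite lte_fin mulrA -mulrAC -/D.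
set g := L * (2 * (x ord0 i0 - (rho - 2))).
have yr y : eball 0 r y -> `|y ord0 i0| <= r.
  by rewrite /eball /= subr0 => yr; apply: le_trans (coord_le_enorm _ _) (ltW yr).
apply: (@laplacian0_ge R d d1 W x w r (L * s0) (`|g| * r) (L * r ^+ 2)
  (fun y => g * y ord0 i0) (fun y => L * y ord0 i0 ^+ 2)) => //.
- by apply: measurable_funM => //; exact: measurable_coord.
- by move=> y; rewrite mxE mulrN.
- by move=> y /yr yr'; rewrite normrM ler_wpM2l.
- by apply: measurable_funM => //; apply: measurable_funX; exact: measurable_coord.
- move=> y /yr yr'; rewrite normrM (ger0_norm L0) ler_wpM2l// ger0_norm ?sqr_ge0//.
  by rewrite -[leLHS]real_normK ?num_real// ler_sqr ?nnegrE// ltW.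
- move=> y; rewrite /eball /= subr0 => yr'.
  have Kxy : K (x + y).
    split => /=; first by apply/ltW/e1P; apply: lt_le_trans yr' _; rewrite ge_min lexx.
    have : `|y ord0 i0| < x ord0 i0 - (rho - 2).
      apply: (le_lt_trans (coord_le_enorm _ _)); apply: lt_le_trans yr' _.
      by rewrite ge_min lexx orbT.
    by rewrite ltr_norml mxE => /andP[+ _]; lra.
  apply: le_trans (xmin _ Kxy); rewrite wE -EFinD lee_fin /h !mxE /g.
  by rewrite le_eqVlt; apply/orP; left; apply/eqP; ring.
- move=> e /andP[e0 er]; rewrite -mulrA EFinM -muleA.
  apply: (@le_trans _ _ (L%:E * \int[lebesgue_rV d]_(y in eball 0 e) (y ord0 i0 ^+ 2)%:E)%E).
    by apply: lee_wpmul2l; [rewrite lee_fin|exact: integral_sqr_coord].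
  rewrite -ge0_integralZl_EFin//.
  + exact: measurable_eball0.
  + by move=> y _; rewrite lee_fin sqr_ge0.
  + apply/measurable_EFinP; apply: (@measurable_funS _ _ _ _ setT) => //.
    by apply: measurable_funX; exact: measurable_coord.
Qed.

End barriers.

Section singularity.
Context {R : realType} {d : nat}.
Hypothesis d1 : (1 <= d)%N.
Variables (W : 'rV[R]_d -> \bar R) (c0 : R).
Hypotheses (mW : measurable_fun setT W) (lW : lower_semicontinuous W)
  (Wc : forall x, (c0%:E <= W x)%E).

Let WNy x : (-oo < W x)%E. Proof. by apply: lt_le_trans (Wc x); rewrite ltNyr. Qed.

(* Comparison with the regularised Riesz potentials (|x|^2 + s^2)^(1 - b/2). *)
Lemma singular_lower (b : R) : 2 < b -> repulsive b W ->
  (forall x, x != 0 -> W x \is a fin_num) ->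
  exists c1 r C : R, [/\ 0 < c1, 0 < r & forall s x, 0 < s -> enorm x <= r ->
    ((c1 * expR (- ((b - 2) / 2) * ln (enorm x ^+ 2 + s ^+ 2)) - C)%:E <= W x)%E].
Proof.
move=> b2 [_ [delta [C [delta0 C0 rep rep0]]]] Wfin.
pose p := (b - 2) / 2; have p0 : 0 < p by rewrite divr_gt0// subr_gt0.
pose D : R := 2 * (d%:R + 2); have D0 : 0 < D by rewrite mulr_gt0// ltr_wpDl.
(* With this c1, touching at an interior point x0 gives a generalised Laplacian at least - C t^(- b
   / 2) with t = |x0|^2 + s^2, and t > |x0|^2 contradicts repulsiveness. All constants are
   independent of s. *)
pose c1 := C / (D * p); have c10 : 0 < c1 by rewrite divr_gt0// mulr_gt0.
pose r := delta / 2; have r0 : 0 < r by rewrite divr_gt0.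
have rd : r < delta by rewrite ltr_pdivrMr// ltr_pMr// ltr1n.
pose phi t := expR (- p * ln t).
exists c1, r, (c1 * phi (r ^+ 2) - c0); split => // s x s0 xr.
pose h (y : 'rV[R]_d) := c1 * phi (enorm y ^+ 2 + s ^+ 2).
have tpos (y : 'rV[R]_d) : 0 < enorm y ^+ 2 + s ^+ 2.
  by rewrite ltr_wpDl ?sqr_ge0// exprn_gt0.
have ch : continuous h.
  move=> y; apply: (@continuous_comp _ _ _ enorm
    (fun u => c1 * expR (- p * ln (u ^+ 2 + s ^+ 2)))); first exact: enorm_continuous.
  have c1' : {for enorm y, continuous (fun u : R => u ^+ 2 + s ^+ 2)}.
    by apply: continuousD; [exact: exprn_continuous|exact: cst_continuous].
  have c2' : {for enorm y, continuous (fun u : R => ln (u ^+ 2 + s ^+ 2))}.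
    by apply: (continuous_comp c1'); exact/continuous_ln/tpos.
  have c3' : {for enorm y, continuous (fun u : R => - p * ln (u ^+ 2 + s ^+ 2))}.
    by apply: cvgM; [exact: cvg_cst|exact: c2'].
  have c4' : {for enorm y, continuous (fun u : R => expR (- p * ln (u ^+ 2 + s ^+ 2)))}.
    by apply: (continuous_comp c3'); exact: continuous_expR.
  by apply: cvgM; [exact: cvg_cst|exact: c4'].
pose K := [set y : 'rV[R]_d | enorm y <= r].
have K0 : K 0 by rewrite /K /= enorm0 ltW.
have [x0 /= x0r xmin] := barrier_min lW WNy ch (@closed_eball_compact R d r)
  (ex_intro _ 0 K0).
suff hx0 : ((h x0 - (c1 * phi (r ^+ 2) - c0))%:E <= W x0)%E.
  apply: le_trans (xmin x xr).
  rewrite (_ : (_ - _)%:E = (h x0 - (c1 * phi (r ^+ 2) - c0))%:E + (h x - h x0)%:E)%E.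
    by apply: leeD2r.
  by rewrite -EFinD /h /phi /p; congr EFin; ring.
have [x0r2|x0r2] := leP r (enorm x0).
  have hle : h x0 <= c1 * phi (r ^+ 2).
    rewrite /h ler_pM2l// ler_expR !mulNr lerN2 ler_pM2l//.
    rewrite ler_ln ?posrE ?exprn_gt0// (@le_trans _ _ (enorm x0 ^+ 2)) ?lerDl ?sqr_ge0//.
    by rewrite ler_sqr ?nnegrE ?enorm_ge0// ltW.
  by apply: le_trans (Wc x0); rewrite lee_fin; lra.
exfalso.
pose i0 : 'I_d := Ordinal d1.
(* The barrier inequality against a point of norm r, where W is finite, excludes W x0 = +oo. *)
have Wx0 : W x0 \is a fin_num.
  pose z : 'rV[R]_d := r *: 'e_i0.
  have zr : enorm z = r.
    rewrite enormZ gtr0_norm// /enorm (bigD1 i0)//= big1 => [|i ii0].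
      by rewrite addr0 mxE !eqxx expr1n sqrtr1 mulr1.
    by rewrite mxE (negPf ii0) andbF expr0n.
  have /(_ z) := xmin; rewrite zr lexx => /(_ isT) Wz.
  have zfin : W z \is a fin_num.
    by apply: Wfin; apply/eqP => z0; move: zr; rewrite z0 enorm0 => /eqP; rewrite lt_eqF.
  rewrite fin_numE (gt_eqF (WNy x0)) /=; apply/eqP => Woo.
  by move: Wz; rewrite Woo addye// leye_eq => /eqP Wzoo; rewrite Wzoo in zfin.
pose t := enorm x0 ^+ 2 + s ^+ 2; have t0 : 0 < t by exact: tpos.
(* - A is the slope of c1 t^(-p). By convexity h decreases at most by A times the increment 2 x0.y +
   |y|^2 of t, whose linear part averages out over balls. *)
pose A := c1 * (p * phi t / t).
have A0 : 0 < A by rewrite mulr_gt0// divr_gt0// mulr_gt0// expR_gt0.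
have lapA : ((D * - A)%:E <= laplacian0 W x0)%E.
  have [e1 e10 e1P] := enorm_near x0r2.
  have nA0 : - A * 2 = - (A * 2) by ring.
  apply: (@laplacian0_ge R d d1 W x0 (fine (W x0)) e1 (- A)
    (A * 2 * (d%:R * (enorm x0 * e1))) (A * e1 ^+ 2)
    (fun y => - A * 2 * dot x0 y) (fun y => - A * enorm y ^+ 2)) => //.
  - by rewrite fineK.
  - by apply: measurable_funM => //; exact: measurable_dot.
  - by move=> y; rewrite dotNr mulrN.
  - move=> y; rewrite /eball /= subr0 => /ltW ye.
    have A20 : 0 < A * 2 by rewrite mulr_gt0.
    rewrite nA0 mulNr normrN normrM (gtr0_norm A20) (ler_pM2l A20).
    apply: le_trans (dot_le _ _) _.
    by rewrite ler_wpM2l// ler_wpM2l// enorm_ge0.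
  - apply: measurable_funM => //; apply: measurable_funX.
    by apply: measurable_continuous_rV; exact: enorm_continuous.
  - move=> y; rewrite /eball /= subr0 => /ltW ye.
    rewrite mulNr normrN normrM (gtr0_norm A0) (ler_pM2l A0) ger0_norm ?sqr_ge0//.
    by rewrite ler_sqr ?nnegrE ?enorm_ge0// ltW.
  - move=> y; rewrite /eball /= subr0 => ye.
    apply: le_trans (xmin (x0 + y) _); last exact/ltW/e1P.
    rewrite -[X in (_ <= X + _)%E](fineK Wx0) -EFinD lee_fin -addrA lerD2l.
    have := power_tangent p0 t0 (tpos (x0 + y)); rewrite -/(phi t) -/(phi _).
    have -> : enorm (x0 + y) ^+ 2 + s ^+ 2 - t = 2 * dot x0 y + enorm y ^+ 2.
      by rewrite sqr_enormD /t; ring.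
    rewrite -(ler_pM2l c10) -/(h (x0 + y)) => tang.
    apply: le_trans (lerB tang (lexx (h x0))).
    rewrite /h -/t /A; move: (phi t) (p / t) => P q.
    by rewrite le_eqVlt; apply/orP; left; apply/eqP; ring.
  - move=> e /andP[e0 ee1].
    have mB := measurable_eball0 (d := d) e.
    rewrite -(integral_cst _ mB); apply: le_integral_lower => //.
    + apply/measurable_EFinP; apply: (@measurable_funS _ _ _ _ setT) => //.
      apply: measurable_funM => //; apply: measurable_funX.
      by apply: measurable_continuous_rV; exact: enorm_continuous.
    + exact: (@integrable_eball0 _ _ _ (fun=> - A * e ^+ 2) `|- A * e ^+ 2|).
    + move=> y; rewrite /eball /= subr0 => ye; rewrite lee_fin !mulNr lerN2 ler_pM2l//.
      by rewrite ler_sqr ?nnegrE ?enorm_ge0// ltW.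
have [x00|x00] := eqVneq x0 0.
  move: rep0; rewrite -x00 => /eqP; rewrite eqe_oppLR => /eqP h0.
  by move: lapA; rewrite h0 leeNy_eq.
have ex0 : 0 < enorm x0.
  apply: lt_le_trans (norm_le_enorm x0); by rewrite normr_gt0.
have := rep x0; rewrite ex0 (lt_trans x0r2 rd) => /(_ isT) repx.
have : ((C * enorm x0 `^ (- b))%:E <= (D * A)%:E)%E.
  apply: le_trans repx _; rewrite leeNl -EFinN.
  by rewrite -mulrN.
apply/negP; rewrite -ltNge lte_fin.
have -> : D * A = C * (phi t / t).
  by rewrite /A /c1; field; rewrite !gt_eqF.
rewrite (ltr_pM2l C0) /powR (gt_eqF ex0).
have -> : phi t / t = expR (- (b / 2) * ln t).
  rewrite -[X in _ / X](lnK t0) -expRN -expRD /p; congr expR; by field.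
rewrite ltr_expR.
have -> : - b * ln (enorm x0) = - (b / 2) * ln (enorm x0 ^+ 2).
  by rewrite lnXn// -[ln _ *+ 2]mulr_natl; field.
rewrite !mulNr ltrN2 ltr_pM2l; last by rewrite divr_gt0// (lt_trans _ b2).
by rewrite ltr_ln ?posrE ?exprn_gt0// ltrDl exprn_gt0.
Qed.

End singularity.

(** * Averages of singular potentials over cubes *)

Lemma le_integral_concentrated d (T : measurableType d) (R : realType)
    (nu : {measure set T -> \bar R}) (D : set T) (f g : T -> \bar R) :
  measurable D -> nu (~` D) = 0%E ->
  measurable_fun setT f -> measurable_fun setT g ->
  (forall x, 0 <= f x)%E -> (forall x, 0 <= g x)%E ->
  (forall x, D x -> f x <= g x)%E -> (\int[nu]_x f x <= \int[nu]_x g x)%E.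
Proof.
move=> mD nuD mf mg f0 g0 fg; apply: ae_ge0_le_integral => //.
exists (~` D); split => //; first exact: measurableC.
by move=> x /= nfg Dx; apply: nfg => _; exact: fg.
Qed.

Lemma nneseries_le {R : realType} (u : (\bar R)^nat) (M : \bar R) :
  (forall n, 0 <= u n)%E -> (forall n, \sum_(0 <= l < n) u l <= M)%E ->
  (\sum_(l <oo) u l <= M)%E.
Proof.
move=> u0 uM; apply: lime_le; first by apply: is_cvg_nneseries => n _ _.
exact: nearW.
Qed.

Section cube.
Context {R : realType} {d : nat}.
Local Notation mu := (@lebesgue_rV R d).

Lemma measurable_norm_ball (z : 'rV[R]_d) s : measurable [set y : 'rV[R]_d | `|z + y| < s].
Proof.
apply: open_measurable_rV.
rewrite (_ : [set _ | _] = (fun y => `|z + y|) @^-1` [set t | t < s])//.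
apply: open_comp; last exact: open_lt.
move=> y _; apply: (@continuous_comp _ _ _ (fun y : 'rV[R]_d => z + y) Num.norm).
  by apply: continuousD; [exact: cst_continuous|exact: cvg_id].
exact: norm_continuous.
Qed.

Lemma lebesgue_norm_ball (z : 'rV[R]_d) s : 0 < s ->
  mu [set y : 'rV[R]_d | `|z + y| < s] = ((2 * s) ^+ d)%:E.
Proof.
move=> s0.
rewrite (_ : [set y : 'rV[R]_d | `|z + y| < s] =
    [set y : 'rV[R]_d | forall i, `](- s - z ord0 i), (s - z ord0 i)[%classic (y ord0 i)]).
  rewrite (lebesgue_rV_box (A := fun i => `](- s - z ord0 i), (s - z ord0 i)[%classic))//.
  rewrite (eq_bigr (fun=> (2 * s)%:E)); last first.
    move=> i _; rewrite lebesgue_measure_itv /= lte_fin -EFinB ltrD2r.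
    by rewrite ifT; [congr EFin; ring|lra].
  by rewrite prodEFin prodr_const card_ord.
have key (y : 'rV[R]_d) i : (`|(z + y) ord0 i| < s) =
    (y ord0 i \in `](- s - z ord0 i), (s - z ord0 i)[).
  rewrite mxE in_itv /= ltr_norml; congr (_ && _); first by rewrite ltrBlDl.
  by rewrite ltrBrDl.
apply/seteqP; split => y /= h.
  by move=> i; rewrite -key; apply: le_lt_trans h; exact: coord_le_norm.
by apply: norm_lt_coord => // i; rewrite key; exact: h.
Qed.

(** Normalised Lebesgue measure of the cube |y| < e. The later estimates see this law only through
    its support and its mass on cubes. *)
Lemma cube_law (e : R) : 0 < e -> exists nu : {measure set 'rV[R]_d -> \bar R},
  [/\ nu setT = 1%E, nu (~` [set y : 'rV[R]_d | `|y| < e]) = 0%E &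
    forall (z : 'rV[R]_d) s, 0 < s ->
      (nu [set y : 'rV[R]_d | `|z + y| < s]%R <= ((s / e) ^+ d)%:E)%E].
Proof.
move=> e0; have e2 : 0 < 2 * e by rewrite mulr_gt0.
have k0 : 0 <= ((2 * e) ^+ d)^-1 by rewrite invr_ge0 exprn_ge0// ltW.
have B0E : [set y : 'rV[R]_d | `|y| < e] = [set y | `|0 + y| < e].
  by apply/seteqP; split => y /=; rewrite add0r.
have mD : measurable [set y : 'rV[R]_d | `|y| < e].
  by rewrite B0E; exact: measurable_norm_ball.
have muD : mu [set y | `|y| < e] = ((2 * e) ^+ d)%:E.
  by rewrite B0E; exact: lebesgue_norm_ball.
pose nu : {measure set 'rV[R]_d -> \bar R} := mscale (NngNum k0) (mrestr mu mD).
have nuE A : nu A = ((((2 * e) ^+ d)^-1)%:E * mu (A `&` [set y : 'rV[R]_d | `|y| < e]%R))%E by [].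
exists nu; split; rewrite ?nuE.
- by rewrite setTI muD -EFinM mulVf// expf_neq0// gt_eqF.
- by rewrite setICl measure0 mule0.
- move=> z s s0; rewrite nuE.
  apply: (@le_trans _ _ ((((2 * e) ^+ d)^-1)%:E * ((2 * s) ^+ d)%:E)%E).
    apply: lee_wpmul2l; first by rewrite lee_fin.
    rewrite -(lebesgue_norm_ball z s0); apply: le_measure; rewrite ?inE.
    + by apply: measurableI => //; exact: measurable_norm_ball.
    + exact: measurable_norm_ball.
    + by apply: subIsetl.
  rewrite -EFinM lee_fin -exprVn -exprMn le_eqVlt; apply/orP; left; apply/eqP.
  by congr (_ ^+ _); field; rewrite gt_eqF.
Qed.

End cube.

Section riesz.
Context {R : realType} {d : nat}.

Lemma powRN_le (x y a : R) : 0 < x -> x <= y -> 0 <= a -> y `^ (- a) <= x `^ (- a).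
Proof.
move=> x0 xy a0; have y0 : 0 < y by exact: lt_le_trans xy.
by rewrite !powRN lef_pV2 ?posrE ?powR_gt0// ge0_ler_powR ?nnegrE// ltW.
Qed.

(** The maximum norm is used because its balls are the cubes whose mass is controlled by
    [cube_law]. *)
Definition riesz (a : R) (u : 'rV[R]_d) : \bar R := sing_pow `|u| (- a).

Lemma riesz_ge0 a u : (0 <= riesz a u)%E.
Proof. by rewrite /riesz /sing_pow; case: ifP => // _; rewrite lee_fin powR_ge0. Qed.

Lemma measurable_sing_pow (a : R) : measurable_fun setT (fun r : R => sing_pow r a).
Proof.
apply: measurable_fun_ifT.
- exact: measurable_fun_eqr.
- exact: measurable_cst.
- by apply/measurable_EFinP; exact: measurable_powR.
Qed.

Lemma measurable_riesz a : measurable_fun setT (riesz a).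
Proof.
apply: (measurableT_comp (measurable_sing_pow (- a))).
by apply: measurable_continuous_rV; exact: norm_continuous.
Qed.

End riesz.

Section riesz_average.
Context {R : realType} {d : nat}.

(** For 0 < |u| < e, the term with e / 2^(l+1) <= |u| < e / 2^l already dominates. At u = 0 every
    term is at least e^(-a), so the series is infinite. *)
Lemma riesz_layers (a e : R) (u : 'rV[R]_d) : 0 < a -> 0 < e ->
  (riesz a u <= (e `^ (- a))%:E + \sum_(l <oo)
    (((e / 2 ^+ l.+1) `^ (- a))%:E * (`|u| < e / 2 ^+ l)%R%:R%:E))%E.
Proof.
move=> a0 e0; pose t l := (((e / 2 ^+ l.+1) `^ (- a))%:E * (`|u| < e / 2 ^+ l)%R%:R%:E)%E.
suff : (riesz a u <= (e `^ (- a))%:E + \sum_(l <oo) t l)%E by [].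
have t0 l : (0 <= t l)%E by rewrite mule_ge0// lee_fin ?powR_ge0.
have ep l : 0 < e / 2 ^+ l by rewrite divr_gt0// exprn_gt0.
have S0 : (0 <= \sum_(l <oo) t l)%E by exact: nneseries_ge0.
rewrite /riesz /sing_pow; case: ifPn => [/eqP u0|u0].
  suff -> : (\sum_(l <oo) t l = +oo)%E by rewrite addey.
  apply/eqP; rewrite -leye_eq leNgt; apply/negP => Sfin.
  pose c := e `^ (- a); have c0 : 0 < c by exact: powR_gt0.
  pose m := fine (\sum_(l <oo) t l)%E.
  have mE : (\sum_(l <oo) t l)%E = m%:E by rewrite /m fineK// ge0_fin_numE.
  have : (\sum_(0 <= l < (Num.truncn (m / c)).+1) t l <= m%:E)%E.
    by rewrite -mE; exact: nneseries_lim_ge.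
  apply/negP; rewrite -ltNge.
  apply: (@lt_le_trans _ _ (\sum_(0 <= l < (Num.truncn (m / c)).+1) c%:E)%E).
    rewrite sumEFin lte_fin sumr_const_nat subn0 -mulr_natl -ltr_pdivrMr//.
    exact: truncnS_gt.
  apply: lee_sum => l _; rewrite /t u0 ep mule1 lee_fin.
  apply: powRN_le => //; last exact: ltW.
  by rewrite ler_pdivrMr ?exprn_gt0// ler_peMr ?(ltW e0)// exprn_ege1// ler1n.
have un0 : 0 < `|u| by rewrite lt_def u0 normr_ge0.
have [eu|ue] := leP e `|u|.
  apply: (@le_trans _ _ (e `^ (- a))%:E); last by rewrite leeDl.
  by rewrite lee_fin; apply: powRN_le => //; exact: ltW.
have [n nP] : exists n, e / 2 ^+ n <= `|u|.
  have [n _ nP] := @near_infty_natSinv_expn_lt R (PosNum (divr_gt0 un0 e0)).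
  exists n; have := nP n (leqnn n); rewrite /= ltr_pdivlMr// mulrC div1r.
  exact: ltW.
have [[|l] lP lmin] := ex_minnP (ex_intro (fun n => e / 2 ^+ n <= `|u|) n nP).
  by move: lP; rewrite expr0 divr1 leNgt ue.
have ul : `|u| < e / 2 ^+ l.
  by rewrite ltNge; apply/negP => /lmin; rewrite ltnn.
apply: (@le_trans _ _ (t l)).
  rewrite /t ul mule1 lee_fin; apply: powRN_le => //; exact: ltW.
apply: (@le_trans _ _ (\sum_(l <oo) t l)%E); last by rewrite leeDr// lee_fin powR_ge0.
apply: le_trans (nneseries_lim_ge l.+1 (fun k _ _ => t0 k)).
by rewrite big_nat_recr//= leeDr// sume_ge0.
Qed.

(** Layer l has height e^(-a) 2^(a(l+1)) and mass at most 2^(-l d), so the layers are summed by a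
    geometric series of ratio q = 2^(a - d) < 1. *)
Lemma riesz_average (a : R) : 0 < a -> a < d%:R ->
  exists2 C, 0 <= C & forall (e : R) (nu : {measure set 'rV[R]_d -> \bar R}),
    0 < e -> nu setT = 1%E ->
    (forall (z : 'rV[R]_d) s, 0 < s ->
      (nu [set y : 'rV[R]_d | `|z + y| < s]%R <= ((s / e) ^+ d)%:E)%E) ->
    forall z : 'rV[R]_d, (\int[nu]_y riesz a (z + y)%R <= (C * e `^ (- a))%:E)%E.
Proof.
move=> a0 ad; pose th : R := (2^-1) `^ (- a).
have th0 : 0 < th by apply: powR_gt0; rewrite invr_gt0.
have thE : th = 2 `^ a.
  have : (2 * 2^-1) `^ (- a) = 1 :> R by rewrite divff// powR1.
  rewrite powRM// -/th powRN => h.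
  have p0 : 2 `^ a != 0 :> R by rewrite gt_eqF// powR_gt0.
  by apply: (mulfI (invr_neq0 p0)); rewrite h mulVf.
pose q := th / 2 ^+ d.
have q1 : q < 1.
  rewrite ltr_pdivrMr ?exprn_gt0// mul1r thE -powR_mulrn// /powR !ifF ?gt_eqF//.
  by rewrite ltr_expR ltr_pM2r// ln_gt0// ltr1n.
have q0 : 0 < q by rewrite divr_gt0// exprn_gt0.
have geo n : \sum_(l < n) q ^+ l <= (1 - q)^-1.
  rewrite -[leRHS]mulr1 ler_pdivlMl ?subr_gt0//.
  have := subrX1 q n; have : 0 <= q ^+ n by rewrite exprn_ge0// ltW.
  by move=> h1 h2; rewrite mulrBl mul1r; lra.
exists (1 + th / (1 - q)); first by rewrite addr_ge0// divr_ge0 ?subr_ge0// ltW.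
move=> e nu e0 nu1 nubox z.
have ep l : 0 < e / 2 ^+ l by rewrite divr_gt0// exprn_gt0.
have bE l : (e / 2 ^+ l.+1) `^ (- a) = e `^ (- a) * th ^+ l.+1.
  have e2l k : e / 2 ^+ k.+1 = e / 2 ^+ k * 2^-1 by rewrite exprS invfM; ring.
  elim: l => [|l IH].
    by rewrite !expr1 powRM ?invr_ge0// ltW.
  by rewrite e2l powRM ?invr_ge0 ?(ltW (ep l.+1))// IH -/th [in RHS]exprSr mulrA.
pose A l := [set y : 'rV[R]_d | `|z + y| < e / 2 ^+ l].
have mA l : measurable (A l) by exact: measurable_norm_ball.
pose f l (y : 'rV[R]_d) := (((e / 2 ^+ l.+1) `^ (- a))%:E * (\1_(A l) y)%:E)%E.
have f0 l y : (0 <= f l y)%E by rewrite mule_ge0// lee_fin ?powR_ge0.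
have mf l : measurable_fun setT (f l).
  by apply: measurable_funeM; apply/measurable_EFinP; exact: measurable_indic.
apply: (@le_trans _ _ (\int[nu]_y ((e `^ (- a))%:E + \sum_(l <oo) f l y))%E).
  apply: ge0_le_integralT => y; first exact: riesz_ge0.
  apply: le_trans (riesz_layers (z + y) a0 e0) _.
  rewrite le_eqVlt; apply/orP; left; apply/eqP; congr (_ + _)%E.
  apply: eq_eseriesr => l _; rewrite /f indicE; congr (_ * (_%:R)%:E)%E.
  by congr nat_of_bool; apply/idP/idP; rewrite inE.
rewrite ge0_integralD//; last 3 first.
- by move=> y _; rewrite lee_fin powR_ge0.
- by move=> y _; apply: nneseries_ge0 => l _ _.
- by apply: ge0_emeasurable_sum => // l _.
rewrite integral_cst1// integral_nneseries//.
rewrite mulrDl mul1r EFinD leeD2l//; apply: nneseries_le => [l|n].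
  by apply: integral_ge0.
apply: (@le_trans _ _ (\sum_(0 <= l < n) (e `^ (- a) * th * q ^+ l)%:E)%E).
  apply: lee_sum => l _; rewrite ge0_integralZl//; last 2 first.
  - by apply/measurable_EFinP; exact: measurable_indic.
  - by rewrite lee_fin powR_ge0.
  rewrite integral_indic// setIT bE.
  have -> : (e `^ (- a) * th * q ^+ l)%:E =
     ((e `^ (- a) * th ^+ l.+1)%:E * ((e / 2 ^+ l / e) ^+ d)%:E)%E.
    rewrite -EFinM; congr EFin; rewrite (_ : e / 2 ^+ l / e = (2 ^+ l)^-1).
      rewrite /q expr_div_n exprVn -!exprM mulnC [in LHS]exprM exprS.
      by rewrite -!exprM; ring.
    by field; rewrite expf_neq0//= gt_eqF.
  apply: lee_wpmul2l; last exact: nubox.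
  by rewrite lee_fin mulr_ge0 ?powR_ge0// exprn_ge0// ltW.
rewrite sumEFin lee_fin big_mkord -mulr_sumr.
rewrite [e `^ _ * th]mulrC -mulrA [e `^ _ * _]mulrC mulrA ler_wpM2r ?powR_ge0//.
by rewrite ler_wpM2l// ltW.
Qed.

End riesz_average.

Section triangle.
Context {R : realType} {d : nat}.
Implicit Types x y : 'rV[R]_d.

(** Expand the square of the norm of |y| x - |x| y; when one of the norms vanishes, the cruder
    [dot_le] is enough. *)
Lemma dot_le_enorm x y : dot x y <= enorm x * enorm y.
Proof.
have xy0 : 0 <= enorm x * enorm y by rewrite mulr_ge0 ?enorm_ge0.
have [xy|] := ltP 0 (enorm x * enorm y); last first.
  move=> h; have xy : enorm x * enorm y = 0 by apply/eqP; rewrite eq_le h.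
  have := dot_le x y; rewrite xy mulr0; exact: le_trans (ler_norm _).
have := sqr_ge0 (enorm (enorm y *: x + - (enorm x *: y))).
rewrite sqr_enormD dotNr enormN !enormZ !(ger0_norm (enorm_ge0 _)).
have -> : dot (enorm y *: x) (enorm x *: y) = enorm x * enorm y * dot x y.
  by rewrite /dot mulr_sumr; apply: eq_bigr => i _; rewrite !mxE; ring.
move=> h; rewrite -(ler_pM2l xy); nra.
Qed.

Lemma enorm_triangle x y : enorm (x + y) <= enorm x + enorm y.
Proof.
have xy0 : 0 <= enorm x + enorm y by rewrite addr_ge0 ?enorm_ge0.
rewrite -ler_sqr ?nnegrE ?enorm_ge0// sqr_enormD.
by have := dot_le_enorm x y; nra.
Qed.

End triangle.

(** * Doubling for potentials with a Riesz singularity *)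

Section riesz_doubling.
Context {R : realType} {d : nat}.
Variables (V : 'rV[R]_d -> \bar R) (RW a r1 C2 K B : R) (Vinf : \bar R).
Hypotheses (mV : measurable_fun setT V) (V0 : forall x, (0 <= V x)%E)
  (Vfin : forall x : 'rV[R]_d, x != 0 -> V x \is a fin_num)
  (Vcont : forall x : 'rV[R]_d, x != 0 -> {for x, continuous (fine \o V)})
  (RW0 : 0 < RW) (a0 : 0 < a) (ad : a < d%:R)
  (r10 : 0 < r1) (C20 : 0 < C2) (K0 : 0 < K) (B0 : 0 <= B)
  (Vup : forall u, `|u| <= r1 -> (V u <= C2%:E * riesz a u)%E)
  (Vlow : forall u, `|u| <= r1 -> (riesz a u <= K%:E * (V u + 1))%E)
  (Vgrow : forall z q, RW + 4 <= enorm z -> RW <= enorm q ->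
    enorm q <= enorm z + 1 -> (V q <= 16%:E * V z + B%:E)%E)
  (Vlim : forall r : R, (r%:E < Vinf)%E ->
    exists M : R, forall x, M < enorm x -> (r%:E <= V x)%E)
  (Vle : forall x, RW <= enorm x -> (V x <= Vinf)%E).

Lemma annulus_compact (r S : R) : compact [set u : 'rV[R]_d | r <= `|u| <= S].
Proof.
apply: bounded_closed_compact.
  exists S; split; first exact: num_real.
  by move=> M SM x /= /andP[_ xS]; rewrite (le_trans xS)// ltW.
rewrite (_ : [set _ | _] = Num.norm @^-1` ([set t | r <= t] `&` [set t | t <= S])).
  apply: closed_comp; first by move=> x _; exact: norm_continuous.
  by apply: closedI; [exact: closed_ge|exact: closed_le].
by apply/seteqP; split => u /=; [move=> /andP[]|move=> [-> ->]].
Qed.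

Lemma annulus_bound (r S : R) : 0 < r ->
  exists2 M, 0 <= M & forall u, r <= `|u| <= S -> (V u <= M%:E)%E.
Proof.
move=> r0.
have cV : compact ((fine \o V : 'rV[R]_d -> R^o) @` [set u : 'rV[R]_d | r <= `|u| <= S]).
  apply: continuous_compact; last exact: annulus_compact.
  apply: continuous_in_subspaceT => u; rewrite inE /= => /andP[ru _].
  by apply: Vcont; rewrite -normr_gt0 (lt_le_trans r0).
have [M [_ MP]] := compact_bounded cV.
exists (`|M| + 1); first by rewrite addr_ge0.
move=> u uP; have u0 : u != 0.
  by case/andP: uP => ru _; rewrite -normr_gt0 (lt_le_trans r0).
rewrite -(fineK (Vfin u0)) lee_fin (le_trans (ler_norm _))//.
apply: (MP (`|M| + 1)) => /=; last by exists u.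
by rewrite (le_lt_trans (ler_norm _))// ltrDl.
Qed.

Lemma riesz_upper (S : R) : exists2 M, 0 <= M & forall u, `|u| <= S ->
  (V u <= C2%:E * riesz a u + M%:E)%E.
Proof.
have [M M0 MP] := annulus_bound S r10; exists M => // u uS.
have [ur|ru] := leP `|u| r1.
  by apply: le_trans (Vup ur) _; rewrite leeDl// lee_fin.
apply: (@le_trans _ _ M%:E); first by apply: MP; rewrite uS ltW.
by rewrite leeDr// mule_ge0 ?riesz_ge0// lee_fin ltW.
Qed.

Lemma cube_average : exists2 C3, 0 <= C3 &
  forall S, exists2 M, 0 <= M & forall e, 0 < e -> e <= 1 ->
  forall nu : {measure set 'rV[R]_d -> \bar R}, nu setT = 1%E ->
    nu (~` [set y : 'rV[R]_d | `|y| < e]) = 0%E ->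
    (forall (z : 'rV[R]_d) s, 0 < s ->
      (nu [set y : 'rV[R]_d | `|z + y| < s]%R <= ((s / e) ^+ d)%:E)%E) ->
    forall z : 'rV[R]_d, `|z| <= S ->
    (\int[nu]_y V (z + y)%R <= (C2 * (C3 * e `^ (- a)) + M)%:E)%E.
Proof.
have [C3 C30 C3P] := riesz_average a0 ad; exists C3 => // S.
have [M M0 MP] := riesz_upper (S + 1); exists M => // e e0 e1 nu nu1 nu0 nub z zS.
have mr : measurable_fun setT (fun y : 'rV[R]_d => riesz a (z + y)).
  by apply: measurable_shift; exact: measurable_riesz.
have mr2 : measurable_fun setT (fun y : 'rV[R]_d => C2%:E * riesz a (z + y))%E.
  exact: measurable_funeM.
have r0 (y : 'rV[R]_d) : (0 <= C2%:E * riesz a (z + y)%R)%E.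
  by rewrite mule_ge0 ?riesz_ge0// lee_fin ltW.
apply: (@le_trans _ _ (\int[nu]_y (C2%:E * riesz a (z + y)%R + M%:E))%E).
  apply: (@le_integral_concentrated _ _ _ nu [set y | `|y| < e]) => //.
  - have := measurable_norm_ball (0 : 'rV[R]_d) e.
    by congr measurable; apply/seteqP; split => y /=; rewrite add0r.
  - exact: measurable_shift.
  - exact: emeasurable_funD.
  - by move=> y; rewrite adde_ge0// lee_fin.
  - move=> y /= ye; apply: MP; rewrite (le_trans (ler_normD _ _))// lerD//.
    by rewrite (le_trans _ e1)// ltW.
rewrite integral_shift// EFinD leeD2r// ge0_integralZl//; last 2 first.
- by move=> y _; exact: riesz_ge0.
- by rewrite lee_fin ltW.
by rewrite EFinM; apply: lee_wpmul2l; [rewrite lee_fin ltW|exact: C3P].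
Qed.

Lemma doubling_unbounded e : (1 <= d)%N -> Vinf = +oo%E -> doubling V e Vinf.
Proof.
move=> d1 Vy; have [C3 C30 /(_ (RW + 4))[M M0 MP]] := cube_average.
have d0 : 0 < d%:R :> R by rewrite ltr0n.
(* Shifts in a cube of half-side 1 / d have Euclidean length at most 1, as [Vgrow] requires. *)
pose t : R := d%:R^-1; have t0 : 0 < t by rewrite invr_gt0.
have t1 : t <= 1 by rewrite invf_le1// ler1n.
have [nu [nu1 nu0 nub]] := @cube_law R d t t0.
pose g := C2 * (C3 * t `^ (- a)) + M.
have g0 : 0 <= g by rewrite addr_ge0// !mulr_ge0 ?powR_ge0// ltW.
have near z : `|z| <= RW + 4 -> (\int[nu]_y V (z + y)%R <= g%:E)%E.
  exact: (MP t).
exists nu, 16, (g + B); split => //.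
- apply: (@le_lt_trans _ _ g%:E); last exact: ltry.
  have := near 0; rewrite normr0; under eq_integral do rewrite add0r.
  by apply; rewrite addr_ge0// ltW.
- move=> z; have [zR|Rz] := leP `|z| (RW + 4).
    apply: le_trans (near z zR) _; apply: (@le_trans _ _ (g + B)%:E).
      by rewrite lee_fin lerDl.
    by rewrite leeDr// mule_ge0// lee_fin.
  apply: (@le_trans _ _ (\int[nu]_y (16%:E * V z + B%:E))%E).
    apply: (@le_integral_concentrated _ _ _ nu [set y | `|y| < t]) => //.
    - have := measurable_norm_ball (0 : 'rV[R]_d) t.
      by congr measurable; apply/seteqP; split => y /=; rewrite add0r.
    - exact: measurable_shift.
    - by move=> y; rewrite adde_ge0 ?mule_ge0// lee_fin.
    - move=> y /= yt.
      have y1 : enorm y <= 1.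
        rewrite (le_trans (enorm_le_norm y))// -ler_pdivlMl// mulr1.
        exact: ltW.
      have ez : RW + 4 <= enorm z by rewrite (le_trans (ltW Rz))// norm_le_enorm.
      apply: Vgrow => //; last by rewrite (le_trans (enorm_triangle _ _))// lerD2l.
      have := enorm_triangle (z + y) (- y); rewrite addrK enormN.
      by move: ez y1; lra.
  by rewrite integral_cst1// leeD2l// lee_fin lerDr.
- by rewrite Vy; split; [lra|exact: addr_ge0|exact: ltry].
Qed.

(** On a compact annulus this is uniform continuity. Further out V z >= w - k while V (z + y) <= w,
    which uses that the limit w is finite. *)
Lemma upper_near (r k w : R) : Vinf = w%:E -> 0 < r -> 0 < k ->
  exists2 e, 0 < e & forall z y : 'rV[R]_d, r <= `|z| -> `|y| < e ->
    (V (z + y) <= V z + k%:E)%E.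
Proof.
move=> Vw r0 k0.
have [M1 M1P] : exists M : R, forall x, M < enorm x -> ((w - k)%:E <= V x)%E.
  by apply: Vlim; rewrite Vw lte_fin ltrBlDr ltrDl.
pose M2 := `|M1| + RW + 1.
have cf x : [set u : 'rV[R]_d | r <= `|u| <= M2] x ->
    {for x, continuous (fine \o V : 'rV[R]_d -> R)}.
  by move=> /= /andP[rx _]; apply: Vcont; rewrite -normr_gt0 (lt_le_trans r0).
have [e1 e10 e1P] := compact_unif_continuous (@annulus_compact r M2) cf k0.
exists (Num.min (Num.min e1 1) r); first by rewrite !lt_min e10 r0 ltr01.
move=> z y rz; rewrite !lt_min => /andP[/andP[ye1 y1] yr].
have z0 : z != 0 by rewrite -normr_gt0 (lt_le_trans r0).
have zy : `|z| - `|y| <= `|z + y|.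
  by have := lerB_dist z (- y); rewrite normrN opprK.
have [zM|Mz] := leP `|z| M2.
  have zy0 : z + y != 0 by rewrite -normr_gt0 (lt_le_trans _ zy)// subr_gt0 (lt_le_trans yr).
  have := e1P z (z + y); rewrite addrAC subrr add0r /= rz zM => /(_ isT ye1).
  rewrite -(fineK (Vfin z0)) -(fineK (Vfin zy0)) -EFinD lee_fin => h.
  by have := ler_norm (fine (V (z + y)) - fine (V z)); move: h; lra.
have zw : ((w - k)%:E <= V z)%E.
  apply: M1P; rewrite (lt_le_trans _ (norm_le_enorm z))// (le_lt_trans _ Mz)//.
  by have := ler_norm M1; rewrite /M2; move: RW0; lra.
apply: (@le_trans _ _ Vinf).
  apply: Vle; rewrite (le_trans _ (norm_le_enorm _))// (le_trans _ zy)//.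
  by have := normr_ge0 M1; move: Mz; rewrite /M2; lra.
rewrite Vw; have := leeD2r k%:E zw; rewrite -EFinD.
by rewrite subrK.
Qed.

Lemma singular_near (M : R) : exists2 r, 0 < r & forall z, `|z| < r -> (M%:E <= V z)%E.
Proof.
pose A := K * (`|M| + 1); have A0 : 0 < A by rewrite mulr_gt0// ltr_pwDr.
pose t := A `^ (- a^-1); have t0 : 0 < t by exact: powR_gt0.
have tA : t `^ (- a) = A.
  by rewrite /t -powRrM mulrNN mulVf ?gt_eqF// powRr1// ltW.
exists (Num.min t r1); first by rewrite lt_min t0 r10.
move=> z; rewrite lt_min => /andP[zt zr].
have [->|Vzy] := eqVneq (V z) +oo%E; first exact: leey.
have Vz : V z \is a fin_num by rewrite ge0_fin_numE// ltey.
have := Vlow (ltW zr); rewrite -(fineK Vz) -EFinD -EFinM lee_fin.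
rewrite /riesz /sing_pow; case: ifPn => [_|z0]; first by rewrite leye_eq.
have zn : 0 < `|z| by rewrite lt_def z0 normr_ge0.
rewrite lee_fin => h; have := le_trans (powRN_le zn (ltW zt) (ltW a0)) h.
rewrite tA /A ler_pM2l// lerD2r; exact/le_trans/ler_norm.
Qed.

(** The constant is uniform in the cube size e. If 2 e <= |z|, then |z + y| >= |z| / 2 pointwise;
    otherwise e > |z| / 2 in the averaged bound. Either way the mean of the Riesz potential is at
    most a multiple of its value at z, hence of V z + 1. *)
Lemma cube_average_near : exists C5 : R, exists2 r2, 0 < C5 /\ 0 < r2 &
  r2 <= 1 /\
  forall e, 0 < e -> e <= r2 ->
  forall nu : {measure set 'rV[R]_d -> \bar R}, nu setT = 1%E ->
    nu (~` [set y : 'rV[R]_d | `|y| < e]) = 0%E ->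
    (forall (z : 'rV[R]_d) s, 0 < s ->
      (nu [set y : 'rV[R]_d | `|z + y| < s]%R <= ((s / e) ^+ d)%:E)%E) ->
    forall z : 'rV[R]_d, `|z| < r2 ->
    (\int[nu]_y V (z + y)%R <= C5%:E * (V z + 1))%E.
Proof.
have [C3 C30 C3P] := riesz_average a0 ad.
pose P := 2 `^ a; have P0 : 0 < P :> R by exact: powR_gt0.
pose C5 := C2 * (1 + C3) * P * K.
have C50 : 0 < C5 by rewrite !mulr_gt0// ltr_pwDl.
exists C5, (Num.min (r1 / 2) 1); first by rewrite lt_min divr_gt0 ?ltr01.
split; first by rewrite ge_min lexx orbT.
move=> e e0; rewrite le_min => /andP[er1 e1] nu nu1 nu0 nub z; rewrite lt_min => /andP[zr1 _].
have mr : measurable_fun setT (fun y : 'rV[R]_d => riesz a (z + y)).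
  by apply: measurable_shift; exact: measurable_riesz.
have [->|Vzy] := eqVneq (V z) +oo%E.
  by rewrite addye// gt0_muley ?lte_fin// leey.
have Vz : V z \is a fin_num by rewrite ge0_fin_numE// ltey.
have zr : `|z| <= r1 by move: zr1 r10; lra.
have := Vlow zr; rewrite -(fineK Vz) -EFinD -EFinM.
rewrite /riesz /sing_pow; case: ifPn => [_|z0]; first by rewrite leye_eq.
rewrite lee_fin; set G := `|z| `^ (- a) => GK.
have zn : 0 < `|z| by rewrite lt_def z0 normr_ge0.
have G0 : 0 <= G by exact: powR_ge0.
have half : (`|z| / 2) `^ (- a) = P * G.
  rewrite powRM ?invr_ge0// mulrC; congr (_ * _).
  by rewrite -powR_inv1// -powRrM mulN1r opprK.
suff h : (\int[nu]_y riesz a (z + y)%R <= ((1 + C3) * P * G)%:E)%E.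
  apply: (@le_trans _ _ (C2%:E * \int[nu]_y riesz a (z + y)%R)%E).
    rewrite -ge0_integralZl//; last 2 first.
    - by move=> y _; exact: riesz_ge0.
    - by rewrite lee_fin ltW.
    apply: (@le_integral_concentrated _ _ _ nu [set y | `|y| < e]) => //.
    - have := measurable_norm_ball (0 : 'rV[R]_d) e.
      by congr measurable; apply/seteqP; split => y /=; rewrite add0r.
    - exact: measurable_shift.
    - exact: measurable_funeM.
    - by move=> y; rewrite mule_ge0 ?riesz_ge0// lee_fin ltW.
    - move=> y /= ye; apply: Vup; rewrite (le_trans (ler_normD _ _))//.
      by move: zr1 er1 ye; lra.
  apply: (@le_trans _ _ (C2%:E * ((1 + C3) * P * G)%:E)%E).
    by apply: lee_wpmul2l; [rewrite lee_fin ltW|].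
  rewrite -EFinM lee_fin /C5 -!mulrA !ler_pM2l ?ltr_pwDl//.
have [ez|ze] := leP (2 * e) `|z|.
  apply: (@le_trans _ _ (\int[nu]_y (P * G)%:E)%E).
    apply: (@le_integral_concentrated _ _ _ nu [set y | `|y| < e]) => //.
    - have := measurable_norm_ball (0 : 'rV[R]_d) e.
      by congr measurable; apply/seteqP; split => y /=; rewrite add0r.
    - by move=> y; exact: riesz_ge0.
    - by move=> y; rewrite lee_fin mulr_ge0// ltW.
    - move=> y /= ye; have h : `|z| / 2 <= `|z + y|.
        have := lerB_dist z (- y); rewrite normrN opprK.
        by move: ez ye; lra.
      have h0 : 0 < `|z + y| by apply: lt_le_trans h; rewrite divr_gt0.
      rewrite /riesz /sing_pow gt_eqF// lee_fin -half.
      by apply: powRN_le => //; [exact: divr_gt0|exact: ltW].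
  by rewrite integral_cst1// lee_fin -mulrA ler_peMl ?mulr_ge0 ?(ltW P0)// lerDl.
apply: le_trans (C3P e nu e0 nu1 nub z) _; rewrite lee_fin.
apply: (@le_trans _ _ (C3 * (P * G))).
  rewrite ler_wpM2l// -half; apply: powRN_le; first exact: divr_gt0.
    by move: ze; lra.
  exact: ltW.
by rewrite -mulrA ler_wpM2r ?mulr_ge0 ?(ltW P0)// lerDr.
Qed.

(** The windows of a nonincreasing sequence of radii are disjoint, and their union up to n misses
    the values below r n. *)
Lemma window_sum (r : nat -> R) (t : R) n : (forall l, r l.+1 <= r l) ->
  \sum_(l < n) ((r l.+1 <= t < r l)%R%:R : R) <= (r n <= t)%R%:R.
Proof.
move=> rS; elim: n => [|n IH]; first by rewrite big_ord0 ler0n.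
rewrite big_ord_recr /=; apply: le_trans (lerD IH (lexx _)) _.
rewrite -natrD ler_nat; have [h1|h1] := leP (r n) t; last by rewrite andbT.
by rewrite andbF addn0 (le_trans (rS n) h1).
Qed.

(* The law nu is an average of n cube laws of rapidly decreasing sizes: at a
   given point z, all but one of them increase V by at most k in mean. *)
Lemma doubling_bounded (e w : R) : 0 <= e -> e < w -> Vinf = w%:E -> doubling V e Vinf.
Proof.
move=> e0 ew Vw; have [C3 C30 /(_ 1)[M M0 avg]] := cube_average.
have [C5 [r2 [C50 r20] [r21 near]]] := cube_average_near.
(* The final value of a e + g is e + k + C5 (e + 1) / n, and n makes the last term smaller than k;
   the total is then below e + 2 k < w. *)
pose k := (w - e) / 3; have k0 : 0 < k by rewrite divr_gt0// subr_gt0.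
pose U t := C2 * (C3 * t `^ (- a)) + M.
(* From a radius r, p.1 is a cube size so small that V grows by at most k when |z| >= r, and p.2 is
   the next radius, so small that below it V already exceeds the mean bound U p.1 of this cube. *)
have /choice[p pP] : forall r : R, exists p : R * R, 0 < r ->
  [/\ 0 < p.1 <= r2,
      forall z y : 'rV[R]_d, r <= `|z| -> `|y| < p.1 -> (V (z + y) <= V z + k%:E)%E,
      0 < p.2 <= r & forall z, `|z| < p.2 -> ((U p.1)%:E <= V z)%E].
  move=> r; have [r0|r0] := ltP 0 r; last by exists (0, 0).
  have [t t0 tP] := upper_near Vw r0 k0.
  have [s s0 sP] := singular_near (U (Num.min t r2)).
  exists (Num.min t r2, Num.min s r) => _ /=; split.
  - by rewrite lt_min t0 r20 ge_min lexx orbT.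
  - by move=> z y rz; rewrite lt_min => /andP[yt _]; exact: tP.
  - by rewrite lt_min s0 r0 ge_min lexx orbT.
  - by move=> z; rewrite lt_min => /andP[zs _]; exact: sP.
pose r := fix r n := if n is m.+1 then (p (r m)).2 else r2.
have rp n : 0 < r n by elim: n => //= n /pP[_ _ /andP[]].
have rS n : r n.+1 <= r n by have [_ _ /andP[]] := pP _ (rp n).
have rr n : r n <= r2 by elim: n => //= n; exact: le_trans (rS n).
pose t n := (p (r n)).1.
have tp n : 0 < t n by have [/andP[]] := pP _ (rp n).
have tr n : t n <= r2 by have [/andP[]] := pP _ (rp n).
have /choice[nu nuP] : forall n, exists nu : {measure set 'rV[R]_d -> \bar R},
  [/\ nu setT = 1%E, nu (~` [set y : 'rV[R]_d | `|y| < t n]) = 0%E &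
    forall (z : 'rV[R]_d) s, 0 < s ->
      (nu [set y : 'rV[R]_d | `|z + y| < s]%R <= ((s / t n) ^+ d)%:E)%E].
  by move=> n; exact: cube_law.
have nuU n z : `|z| < r2 -> (\int[nu n]_y V (z + y)%R <= (U (t n))%:E)%E.
  move=> zr; have [h1 h2 h3] := nuP n.
  by apply: avg => //; [exact: le_trans r21|exact/ltW/(lt_le_trans zr)].
(* Cube n costs at most k for |z| >= r n, nothing for |z| < r n.+1, and the factor C5 only in the
   window between these radii. *)
have main n z : V z \is a fin_num -> (\int[nu n]_y V (z + y)%R <=
    (fine (V z) + k + (r n.+1 <= `|z| < r n)%R%:R * (C5 * (fine (V z) + 1)))%:E)%E.
  move=> Vz; have [h1 h2 h3] := nuP n; have [_ pn _ pn'] := pP _ (rp n).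
  have vz0 : 0 <= fine (V z) by exact: fine_ge0.
  have C5v : 0 <= C5 * (fine (V z) + 1) by rewrite mulr_ge0 ?addr_ge0// ltW.
  have [rz|zr] := leP (r n) `|z|.
    rewrite andbF mul0r addr0.
    apply: (@le_trans _ _ (\int[nu n]_y (V z + k%:E))%E).
      apply: (@le_integral_concentrated _ _ _ (nu n) [set y | `|y| < t n]) => //.
      - have := measurable_norm_ball (0 : 'rV[R]_d) (t n).
        by congr measurable; apply/seteqP; split => y /=; rewrite add0r.
      - exact: measurable_shift.
      - by move=> y; rewrite adde_ge0// lee_fin ltW.
      - by move=> y /= yt; exact: pn.
    by rewrite integral_cst1// EFinD fineK.
  rewrite andbT; have zr2 : `|z| < r2 by exact: lt_le_trans (rr n).
  have [rz|zr'] := leP (r n.+1) `|z|.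
    rewrite mul1r; apply: le_trans (near (t n) (tp n) (tr n) _ h1 h2 h3 z zr2) _.
    by rewrite -[X in (X + 1)%E](fineK Vz) -EFinD -EFinM lee_fin lerDr addr_ge0// ltW.
  rewrite mul0r addr0; apply: le_trans (nuU n z zr2) _.
  apply: (le_trans (pn' z zr')); rewrite -[leLHS](fineK Vz) lee_fin lerDl.
  exact: ltW.
pose n := (Num.truncn (C5 * (e + 1) / k)).+1.
have n0 : 0 < n%:R :> R by rewrite ltr0n.
have nP : C5 * (e + 1) < k * n%:R.
  by rewrite [ltRHS]mulrC -ltr_pdivrMr//; exact: truncnS_gt.
have ni0 : 0 <= n%:R^-1 :> R by rewrite invr_ge0 ltW.
pose m : {measure set 'rV[R]_d -> \bar R} := mscale (NngNum ni0) (msum nu n).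
have mE (f : 'rV[R]_d -> \bar R) : measurable_fun setT f -> (forall y, 0 <= f y)%E ->
    (\int[m]_y f y = (n%:R^-1)%:E * \sum_(l < n) \int[nu l]_y f y)%E.
  by move=> mf f0; rewrite ge0_integral_mscale//= ge0_integral_measure_sum.
exists m, (1 + C5 / n%:R), (k + C5 / n%:R).
have C5n : 0 <= C5 / n%:R by rewrite divr_ge0// ltW.
split.
- rewrite /m /= /mscale /= /msum (eq_bigr (fun=> 1%E)); last by move=> i _; case: (nuP i).
  by rewrite sumEFin sumr_const card_ord -EFinM mulVf ?gt_eqF.
- rewrite mE// lte_mul_pinfty// lte_sum_pinfty// => i _.
  apply: (@le_lt_trans _ _ (U (t i))%:E); last exact: ltry.
  by have := nuU i 0; rewrite normr0 => /(_ r20); under eq_integral do rewrite add0r.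
- move=> z; have [->|Vzy] := eqVneq (V z) +oo%E.
    by rewrite gt0_muley ?lte_fin ?ltr_pwDl// addye// leey.
  have Vz : V z \is a fin_num by rewrite ge0_fin_numE// ltey.
  rewrite mE//; last exact: measurable_shift.
  pose v := fine (V z); have v0 : 0 <= v by exact: fine_ge0.
  apply: (@le_trans _ _ ((n%:R^-1)%:E * \sum_(l < n)
      (v + k + (r l.+1 <= `|z| < r l)%R%:R * (C5 * (v + 1)))%:E)%E).
    by apply: lee_wpmul2l; [rewrite lee_fin|apply: lee_sum => l _; exact: main].
  rewrite -(fineK Vz) -/v sumEFin -!EFinM -EFinD lee_fin big_split /= -mulr_suml.
  rewrite sumr_const card_ord -[(v + k) *+ n]mulr_natr.
  have -> : (1 + C5 / n%:R) * v + (k + C5 / n%:R) =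
      n%:R^-1 * ((v + k) * n%:R + 1 * (C5 * (v + 1))).
    by field; rewrite gt_eqF.
  rewrite ler_wpM2l// lerD2l ler_wpM2r//; first by rewrite mulr_ge0 ?addr_ge0// ltW.
  by rewrite (le_trans (window_sum _ _ rS))// lern1 leq_b1.
- split; [by rewrite lerDl|by rewrite addr_ge0// ltW|].
  rewrite Vw lte_fin.
  have -> : (1 + C5 / n%:R) * e + (k + C5 / n%:R) = e + k + C5 * (e + 1) / n%:R.
    by field; rewrite gt_eqF.
  have : C5 * (e + 1) / n%:R < k by rewrite ltr_pdivrMr.
  rewrite /k; lra.
Qed.

End riesz_doubling.

(** * The shifted potential *)

Section infinity.
Context {R : realType} {d : nat}.
Hypothesis d1 : (1 <= d)%N.

Lemma enorm_infty_filter : ProperFilter (@enorm_infty R d).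
Proof.
have F : Filter (@enorm_infty R d).
  apply: filter_from_filter; first by exists 0.
  move=> i j _ _; exists (Num.max i j) => // x /=; rewrite gt_max.
  by move=> /andP[].
apply: filter_from_proper => M _.
exists (const_mx (`|M| + 1)) => /=.
apply: lt_le_trans (coord_le_enorm _ (Ordinal d1)); rewrite mxE ger0_norm ?addr_ge0//.
by rewrite (le_lt_trans (ler_norm M))// ltrDl.
Qed.

Lemma enorm_infty_gt (W : 'rV[R]_d -> \bar R) (Winf : \bar R) (r : R) :
  W x @[x --> enorm_infty] --> Winf -> (r%:E < Winf)%E ->
  exists M : R, forall x, M < enorm x -> (r%:E <= W x)%E.
Proof.
move=> Wl rW.
have /Wl[M _ MP] : nbhs Winf [set t | (r%:E < t)%E].
  by apply: open_nbhs_nbhs; split => //; exact: open_ereal_gt_ereal.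
by exists M => x /MP /ltW.
Qed.

Lemma increasing_le_limit (W : 'rV[R]_d -> \bar R) (Winf : \bar R) (RW : R) x :
  W x @[x --> enorm_infty] --> Winf -> radially_strictly_increasing RW W ->
  RW <= enorm x -> (W x <= Winf)%E.
Proof.
move=> Wl Wi xR; have PF := enorm_infty_filter.
apply: (@closed_cvg _ _ (@enorm_infty R d) _ W [set t | (W x <= t)%E]) => //.
  exact: closed_ereal_le_ereal.
by exists (enorm x) => // y /= xy; exact/ltW/Wi.
Qed.

End infinity.

Section assumptions.
Context {R : realType} {d : nat}.
Hypothesis d1 : (1 <= d)%N.
Variables (W : 'rV[R]_d -> \bar R) (c RW : R) (Winf : \bar R).
Hypotheses (mW : measurable_fun setT W) (lW : lower_semicontinuous W)
  (Wc : forall x, (c%:E <= W x)%E) (RW0 : 0 < RW)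
  (Wi : radially_strictly_increasing RW W)
  (Wl : W x @[x --> enorm_infty] --> Winf).

Let V x := (W x - c%:E)%E.
Let Vinf := (Winf - c%:E)%E.

Lemma shift_ge0 x : (0 <= V x)%E. Proof. by rewrite sube_ge0. Qed.

Lemma shift_measurable : measurable_fun setT V.
Proof. exact: emeasurable_funB. Qed.

Lemma shift_gt (r : R) : (r%:E < Vinf)%E ->
  exists M : R, forall x, M < enorm x -> (r%:E <= V x)%E.
Proof.
rewrite lteBrDr// -EFinD => /(enorm_infty_gt Wl)[M MP].
by exists M => x /MP; rewrite EFinD leeBrDr.
Qed.

Lemma shift_le x : RW <= enorm x -> (V x <= Vinf)%E.
Proof. by move=> xR; rewrite leeB// (increasing_le_limit d1 Wl Wi). Qed.

Lemma doubling_bounded_above (C e : R) : (forall x, (W x <= C%:E)%E) ->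
  (e%:E < Vinf)%E -> doubling V e Vinf.
Proof.
move=> WC eV.
have dir z : (\int[\d_(0%R : 'rV[R]_d)]_y V (z + y)%R = V z)%E.
  rewrite integral_dirac// ?diracT ?mul1e ?addr0//.
  by apply: measurable_shift; exact: shift_measurable.
exists \d_(0 : 'rV[R]_d), 1, 0; split.
- exact: diracT.
- have := dir 0; under eq_integral do rewrite add0r; move=> ->.
  by rewrite /V (le_lt_trans (leeB (WC 0) (lexx _)))// -EFinB ltry.
- by move=> z; rewrite dir mul1e adde0.
- by rewrite mul1r addr0; split.
Qed.

(** The maximum norm is at most the Euclidean one, so passing to it increases the negative power.
    This power is at least 1 here and absorbs the additive constant as |c|. *)
Lemma riesz_upper_bound (b CW : R) : 2 < b -> 0 < CW ->
  (forall x, enorm x <= 1 -> (W x <= CW%:E * sing_pow (enorm x) (2 - b))%E) ->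
  forall u, enorm u <= 1 -> (V u <= (CW + `|c|)%:E * riesz (b - 2) u)%E.
Proof.
move=> b2 CW0 WCW u u1; have b20 : 0 < b - 2 by rewrite subr_gt0.
have nu1 : `|u| <= 1 by exact: le_trans (norm_le_enorm u) u1.
have CWc : 0 < CW + `|c| by rewrite ltr_pwDl.
rewrite /riesz /sing_pow; case: ifPn => [_|u0].
  by rewrite gt0_muley ?lte_fin// leey.
have un : 0 < `|u| by rewrite lt_def u0 normr_ge0.
have ue : `|u| <= enorm u by exact: norm_le_enorm.
have := WCW u u1; rewrite /sing_pow gt_eqF ?(lt_le_trans un)// -EFinM => h.
rewrite /V leeBlDr// (le_trans h)// -EFinM -EFinD lee_fin.
have p1 : 1 <= `|u| `^ (- (b - 2)).
  by have := powRN_le un nu1 (ltW b20); rewrite powR1.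
have := powRN_le un ue (ltW b20); rewrite opprB => h1.
move: p1; rewrite opprB => p1.
have := ler_norm (- c); rewrite normrN; have := normr_ge0 c; nra.
Qed.

Lemma riesz_lower_bound (b : R) : 2 < b -> repulsive b W ->
  (forall x, x != 0 -> W x \is a fin_num) ->
  exists K r, [/\ 0 < K, 0 < r &
    forall u, enorm u <= r -> (riesz (b - 2) u <= K%:E * (V u + 1))%E].
Proof.
move=> b2 rep Wfin; have b20 : 0 < b - 2 by rewrite subr_gt0.
have [c1 [r [C [c10 r0 low]]]] := singular_lower d1 mW lW Wc b2 rep Wfin.
pose a := b - 2.
(* The lower bound holds at 0 for every s > 0; with s = exp(- t) and t large it exceeds any finite
   value of W 0. *)
have W0 : W 0 = +oo%E.
  apply/eqP; rewrite -leye_eq leNgt; apply/negP => W0fin.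
  have W0f : W 0 \is a fin_num.
    by rewrite fin_numE -ltey W0fin andbT gt_eqF// (lt_le_trans _ (Wc 0))// ltNyr.
  pose M := fine (W 0); pose t := (`|M + C| + 1) / (c1 * a).
  have ca : 0 < c1 * a by rewrite mulr_gt0.
  have := low (expR (- t)) 0 (expR_gt0 _); rewrite enorm0 => /(_ (ltW r0)).
  rewrite expr0n add0r -expRM_natl expRK -[X in (_ <= X)%E](fineK W0f) lee_fin -/M.
  have -> : - ((b - 2) / 2) * (2%:R * - t) = a * t by rewrite /a; field.
  have := expR_ge1Dx (a * t) => h1 h2.
  have h3 : c1 * (a * t) = `|M + C| + 1 by rewrite mulrA mulrC /t divfK// gt_eqF.
  have h4 : c1 * (1 + a * t) <= c1 * expR (a * t) by rewrite ler_pM2l.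
  by have := ler_norm (M + C); lra.
have d0 : 0 < d%:R :> R by rewrite ltr0n.
have dd : 0 < 2 * d%:R ^+ 2 :> R by rewrite mulr_gt0// exprn_gt0.
(* For u different from 0 the lower bound is used with s equal to the Euclidean norm of u. Then c2
   pays for |u|^2 + s^2 being at most 2 d^2 times the square of the maximum norm. *)
pose c2 := expR (- (a / 2) * ln (2 * d%:R ^+ 2)); have c20 : 0 < c2 by exact: expR_gt0.
have cc : 0 < c1 * c2 by rewrite mulr_gt0.
have A0 : 0 < 1 + `|c + C| by rewrite ltr_pwDl.
exists ((1 + `|c + C|) / (c1 * c2)), r; split; [exact: divr_gt0|by []|].
move=> u ur; have [->|u0] := eqVneq u 0.
  by rewrite /V W0 /= gt0_muley ?leey// lte_fin divr_gt0.
have un : 0 < `|u| by rewrite normr_gt0.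
have ue : 0 < enorm u by exact: lt_le_trans (norm_le_enorm u).
have Wu := Wfin u u0.
rewrite /riesz /sing_pow gt_eqF// /V -(fineK Wu) -EFinB -EFinD -EFinM lee_fin.
have := low (enorm u) u ue ur; rewrite -[X in (_ <= X)%E](fineK Wu) lee_fin => h.
have pE : `|u| `^ (- (b - 2)) = expR (- a * ln `|u|) by rewrite /powR gt_eqF.
have h2 : c2 * `|u| `^ (- (b - 2)) <=
    expR (- ((b - 2) / 2) * ln (enorm u ^+ 2 + enorm u ^+ 2)).
  rewrite pE /c2 -expRD ler_expR.
  have -> : - (a / 2) * ln (2 * d%:R ^+ 2) + - a * ln `|u| =
      - (a / 2) * ln (2 * d%:R ^+ 2 * `|u| ^+ 2).
    have -> : ln (2 * d%:R ^+ 2 * `|u| ^+ 2) = ln (2 * d%:R ^+ 2) + ln `|u| *+ 2.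
      by rewrite -lnXn// -lnM// posrE exprn_gt0.
    by rewrite mulr2n; field.
  rewrite -/a !mulNr lerN2 ler_pM2l ?divr_gt0// ler_ln ?posrE; last 2 first.
  - by rewrite addr_gt0// exprn_gt0.
  - by rewrite mulr_gt0// exprn_gt0.
  have : enorm u ^+ 2 <= (d%:R * `|u|) ^+ 2.
    by rewrite ler_sqr ?nnegrE ?mulr_ge0 ?(ltW ue)//; exact: enorm_le_norm.
  by rewrite exprMn; lra.
have Wuc : c <= fine (W u) by rewrite -lee_fin fineK.
have h3 : c1 * (c2 * `|u| `^ (- (b - 2))) <= fine (W u) + C.
  by have := h2; rewrite -(ler_pM2l c10) => h4; lra.
rewrite mulrAC ler_pdivlMr// mulrC -mulrA (le_trans h3)//.
by have := ler_norm (c + C); have := normr_ge0 (c + C); nra.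
Qed.

Lemma shift_continuous : C1_off0 W ->
  forall x : 'rV[R]_d, x != 0 -> {for x, continuous (fine \o V)}.
Proof.
move=> WC1 x x0; have [_ /differentiable_continuous cW _] := WC1 x x0.
have Wfin (y : 'rV[R]_d) : y != 0 -> W y \is a fin_num by move=> /WC1[].
have : {for x, continuous (fun y : 'rV[R]_d => (fine (W y) : R^o) - c)}.
  by apply: (@continuousB _ R^o _ (fine \o W) (cst c)) => //; exact: cst_continuous.
rewrite /prop_for /continuous_at /=.
have -> : fine (V x) = fine (W x) - c by rewrite fineB// Wfin.
apply: cvg_trans; apply: (@near_eq_cvg _ _ (nbhs x)).
have : \forall y \near x, y != 0 :> 'rV[R]_d.
  apply/nbhs_normP; exists `|x|; first by rewrite /= normr_gt0.
  by move=> y /= h; apply/eqP => y0; move: h; rewrite y0 subr0 ltxx.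
by move=> nx; near=> y; rewrite /= /V fineB// Wfin//; near: y.
Unshelve. all: by end_near. Qed.

Lemma doubling_repulsive (b CW e : R) : 2 < b < d%:R -> repulsive b W -> C1_off0 W ->
  0 < CW -> (forall x, (laplacian0 W x <= CW%:E)%E) ->
  (forall x, enorm x <= 1 -> (W x <= CW%:E * sing_pow (enorm x) (2 - b))%E) ->
  0 <= e -> (e%:E < Vinf)%E -> doubling V e Vinf.
Proof.
move=> /andP[b2 bd] rep WC1 CW0 lap Wup e0 eV.
have b20 : 0 < b - 2 by rewrite subr_gt0.
have bd2 : b - 2 < d%:R by lra.
have Wfin (y : 'rV[R]_d) : y != 0 -> W y \is a fin_num by move=> /WC1[].
have [K [r [K0 r0 low]]] := riesz_lower_bound b2 rep Wfin.
have [B B0 grow] := growth_bound d1 mW lW Wc RW0 Wi CW0 lap.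
have d0 : 0 < d%:R :> R by rewrite ltr0n.
(* The division by d passes from the maximum norm to the Euclidean one. *)
pose r1 := Num.min r 1 / d%:R.
have r10 : 0 < r1 by rewrite divr_gt0// lt_min r0 ltr01.
have small (u : 'rV[R]_d) : `|u| <= r1 -> enorm u <= r /\ enorm u <= 1.
  rewrite ler_pdivlMr// mulrC => h; have := le_trans (enorm_le_norm u) h.
  by rewrite le_min => /andP[].
have Vfin y : y != 0 -> V y \is a fin_num by move=> /Wfin Wy; rewrite fin_numB Wy.
have CWc : 0 < CW + `|c| by rewrite ltr_pwDl.
have up u : `|u| <= r1 -> (V u <= (CW + `|c|)%:E * riesz (b - 2) u)%E.
  by move=> /small[_]; exact: riesz_upper_bound.
have dn u : `|u| <= r1 -> (riesz (b - 2) u <= K%:E * (V u + 1))%E.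
  by move=> /small[+ _]; exact: low.
case VE : Vinf eV => [w||//] eV.
- apply: (doubling_bounded shift_measurable shift_ge0 Vfin (shift_continuous WC1)
    RW0 b20 bd2 r10 CWc K0 up dn) => //.
  + by rewrite -VE => s; exact: shift_gt.
  + by rewrite -VE => x; exact: shift_le.
  + by rewrite -lte_fin.
- by apply: (doubling_unbounded shift_measurable shift_ge0 Vfin (shift_continuous WC1)
    RW0 b20 bd2 r10 CWc B0 up grow).
Qed.

End assumptions.

(** * Configurations and energies *)

Section diameter.
Context {R : realType} {d N : nat}.
Variable X : 'I_N -> 'rV[R]_d.

Lemma le_diameter i j : enorm (X i - X j) <= diameter (range X).
Proof.
apply: ub_le_sup; last first.
  by exists (X i, X j); [split; [exists i|exists j]|].
exists (\sum_k \sum_l enorm (X k - X l)) => _ [[_ _] /= [[k _ <-] [l _ <-]] <-].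
rewrite (bigD1 k)//= (bigD1 l)//= -addrA lerDl.
by rewrite addr_ge0// ?sumr_ge0// => m _; rewrite ?sumr_ge0// => *; exact: enorm_ge0.
Qed.

Lemma diameter_le M : (0 < N)%N -> (forall i j, enorm (X i - X j) <= M) ->
  diameter (range X) <= M.
Proof.
move=> N0 XM; apply: ge_sup; last first.
  by move=> _ [[_ _] /= [[k _ <-] [l _ <-]] <-]; exact: XM.
by exists (enorm (X (Ordinal N0) - X (Ordinal N0))), (X (Ordinal N0), X (Ordinal N0)).
Qed.

End diameter.

Section additive_constant.
Context {R : realType} {d : nat}.
Variables (V : 'rV[R]_d -> \bar R) (c : R).
Let W x := (V x + c%:E)%E.

Lemma pair_sum_shift N (X : 'I_N -> 'rV[R]_d) : (forall x, 0 <= V x)%E ->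
  pair_sum W X = (pair_sum V X + (\sum_(i < N) \sum_(j < N | j != i) c)%:E)%E.
Proof.
move=> V0; rewrite -sumEFin -big_split /=; apply: eq_bigr => i _.
by rewrite -sumEFin -big_split.
Qed.

Lemma energy_shift (rho : probability 'rV[R]_d R) : measurable_fun setT V ->
  (forall x, 0 <= V x)%E -> energy W rho = (energy V rho + (2^-1 * c)%:E)%E.
Proof.
move=> mV V0; rewrite /energy EFinM.
have I0 x : (0 <= \int[rho]_y V (x - y)%R)%E by exact: integral_ge0.
have -> : (\int[rho]_x \int[rho]_y W (x - y)%R =
    \int[rho]_x (\int[rho]_y V (x - y)%R + c%:E))%E.
  apply: eq_integral => x _; rewrite /W integral_shift//; last exact: measurable_kernel_l.
  exact: probability_setT.
rewrite integral_shift//; last exact: measurable_potential.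
  by rewrite muleDr// fin_num_adde_defl.
exact: probability_setT.
Qed.

End additive_constant.

Section compactness.
Context {R : realType} {d : nat}.

Lemma translated_compactness (X : forall N, 'I_N -> 'rV[R]_d) (psi : nat -> nat) (C : R) :
  (forall n, n < psi n)%N ->
  (forall n (i j : 'I_(psi n)) k, X (psi n) j ord0 k - X (psi n) i ord0 k <= C) ->
  exists (phi : nat -> nat) (a : nat -> 'rV[R]_d) (rho : probability 'rV[R]_d R),
  [/\ {homo phi : m n / (m < n)%N},
      narrow_cvg (fun n => empirical
        (fun i => X (psi (phi n)) i - a (psi (phi n)))) rho &
      forall (V : 'rV[R]_d -> \bar R) (e : \bar R), (forall x, 0 <= V x)%E ->
        measurable_fun setT V -> lower_semicontinuous V ->
        (forall n, discrete_energy V (X (psi n)) <= e)%E -> (energy V rho <= e)%E].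
Proof.
move=> psin XC; pose C' := `|C|.
have XC' n (i j : 'I_(psi n)) k : X (psi n) j ord0 k - X (psi n) i ord0 k <= C'.
  by rewrite (le_trans (XC _ _ _ _))// ler_norm.
have C0 : 0 <= C' by exact: normr_ge0.
(* One particle is sent to the point with all coordinates C', which puts all coordinates in
   [0, 2 C']. The box of the compactness lemma is half-open, hence its side 2 C' + 1. *)
pose a m : 'rV[R]_d := if [pick i : 'I_m] is Some i then X m i - const_mx C' else 0.
have psi0 n : (0 < psi n)%N by exact: leq_ltn_trans (psin n).
pose Y n i := X (psi n) i - a (psi n).
have L0 : 0 < 2 * C' + 1 by rewrite ltr_wpDl// mulr_ge0.
have Y0 n i k : 0 <= Y n i ord0 k < 2 * C' + 1.
  rewrite /Y /a; case: pickP => [j _|/(_ (Ordinal (psi0 n)))//].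
  by rewrite !mxE; have := XC' n j i k; have := XC' n i j k; lra.
have psioo M : exists n0, forall n, (n0 <= n)%N -> (M <= psi n)%N.
  by exists M => n Mn; rewrite (leq_trans Mn)// ltnW.
have [phi [rho [phim cv low]]] := narrow_compactness L0 psi0 Y0 psioo.
exists phi, a, rho; split => // V e V0 mV lV Xe; apply: (low V e) => // n.
by rewrite discrete_energyE pair_sum_translate -discrete_energyE.
Qed.

End compactness.

Section nonnegative_potential.
Context {R : realType} {d : nat}.
Hypothesis d1 : (1 <= d)%N.
Variables (V : 'rV[R]_d -> \bar R) (RW : R) (Vinf : \bar R).
Hypotheses (V0 : forall x, (0 <= V x)%E) (lV : lower_semicontinuous V)
  (mV : measurable_fun setT V) (Vs : forall x, V (- x) = V x) (RW0 : 0 < RW)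
  (Vi : radially_strictly_increasing RW V)
  (Vle : forall x, RW <= enorm x -> (V x <= Vinf)%E).

Lemma pair_mean_le N (s t : \bar R) : (0 < N)%N -> (0 <= t)%E ->
  (s <= (N * N.-1)%:R%:E * t)%E -> (((2 * N%:R ^+ 2)^-1)%:E * s <= (2^-1)%:E * t)%E.
Proof.
move=> N0 t0 st; have N2 : 0 < 2 * N%:R ^+ 2 :> R by rewrite mulr_gt0// exprn_gt0// ltr0n.
apply: (@le_trans _ _ (((2 * N%:R ^+ 2)^-1)%:E * ((N * N.-1)%:R%:E * t))%E).
  by apply: lee_wpmul2l => //; rewrite lee_fin invr_ge0 ltW.
rewrite muleA -EFinM; apply: lee_wpmul2r => //.
rewrite lee_fin mulrC ler_pdivrMr// mulrA mulVf ?pnatr_eq0// mul1r -natrX ler_nat.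
by rewrite expnS expn1 leq_mul2l leq_pred orbT.
Qed.

Lemma minimal_energy_le N (X : 'I_N -> 'rV[R]_d) (rho : probability 'rV[R]_d R) :
  (0 < N)%N -> (forall Y : 'I_N -> 'rV[R]_d, (pair_sum V X <= pair_sum V Y)%E) ->
  (discrete_energy V X <= energy V rho)%E.
Proof.
move=> N0 Xmin; have [Y Ye] := averaging rho V0 mV Vs N.
rewrite discrete_energyE; apply: pair_mean_le => //; last exact: le_trans Ye.
by apply: integral_ge0 => x _; exact: integral_ge0.
Qed.

Lemma minimal_energy_le_limit N (X : 'I_N -> 'rV[R]_d) :
  (0 < N)%N -> (forall Y : 'I_N -> 'rV[R]_d, (pair_sum V X <= pair_sum V Y)%E) ->
  (discrete_energy V X <= (2^-1)%:E * Vinf)%E.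
Proof.
move=> N0 Xmin; pose k0 : 'I_d := Ordinal d1.
have Vinf0 : (0 <= Vinf)%E.
  apply: le_trans (Vle (x := const_mx RW) _); first exact: V0.
  by apply: le_trans (coord_le_enorm _ k0); rewrite mxE ger0_norm// ltW.
rewrite discrete_energyE; apply: pair_mean_le => //.
(* Points on a diagonal at mutual distance at least RW, where V is at most Vinf. *)
pose Y (i : 'I_N) : 'rV[R]_d := const_mx (RW * i%:R).
apply: le_trans (Xmin Y) _; apply: (@le_trans _ _ (\sum_(i < N) \sum_(j < N | j != i) Vinf)%E).
  apply: lee_sum => i _; apply: lee_sum => j ji; apply: Vle.
  apply: le_trans (coord_le_enorm _ k0); rewrite !mxE -mulrBr normrM gtr0_norm//.
  rewrite ler_peMr ?(ltW RW0)//; have [ij|ij|/val_inj ij] := ltngtP i j.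
  - by rewrite distrC -natrB ?(ltnW ij)// normr_nat ler1n subn_gt0.
  - by rewrite -natrB ?(ltnW ij)// normr_nat ler1n subn_gt0.
  - by rewrite ij eqxx in ji.
have E (i : 'I_N) : (\sum_(j < N | j != i) Vinf = N.-1%:R%:E * Vinf)%E.
  rewrite (eq_bigl [pred j | j \in predC1 i])//.
  by rewrite [LHS]sumr_const cardC1 card_ord mule_natl.
rewrite (eq_bigr _ (fun i _ => E i)) [leLHS]sumr_const card_ord.
by rewrite natrM EFinM -muleA [leRHS]mule_natl.
Qed.

Variable X : forall N, 'I_N -> 'rV[R]_d.
Arguments X : clear implicits.
Hypothesis Xmin : forall N, (2 <= N)%N -> forall Y : 'I_N -> 'rV[R]_d,
  (pair_sum V (X N) <= pair_sum V Y)%E.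

Lemma unstable_compactness :
  (forall r : R, (r%:E < Vinf)%E ->
    exists M : R, forall x, M < enorm x -> (r%:E <= V x)%E) ->
  (forall e : R, 0 <= e -> (e%:E < Vinf)%E -> doubling V e Vinf) ->
  unstable V Vinf ->
  (exists M : R, forall N, (2 <= N)%N -> diameter (range (X N)) <= M) /\
  exists phi : nat -> nat,
    [/\ {homo phi : m n / (m < n)%N}, forall n, (2 <= phi n)%N &
      exists (a : nat -> 'rV[R]_d) (rho : probability 'rV[R]_d R),
        narrow_cvg (fun n => empirical (fun i => X (phi n) i - a (phi n))) rho /\
        minimiser V rho].
Proof.
move=> Vlim dbl [rho0 rho0V]; pose I0 := (\int[rho0]_x \int[rho0]_y V (x - y)%R)%E.
have I00 : (0 <= I0)%E by apply: integral_ge0 => x _; exact: integral_ge0.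
have I0V : (I0 < Vinf)%E by move: rho0V; rewrite /energy lte_pmul2l// lte_fin invr_gt0.
have I0fin : I0 \is a fin_num by rewrite ge0_fin_numE// (lt_le_trans I0V)// leey.
(* The double integral is twice the energy, so instability gives exactly e < Vinf. *)
pose e := fine I0; have e0 : 0 <= e by exact: fine_ge0.
have eV : (e%:E < Vinf)%E by rewrite fineK.
have [C CP] := coord_spread_bound V0 RW0 Vi mV Vs Vlim e0 (dbl e e0 eV).
have spread N : (2 <= N)%N -> forall (i j : 'I_N) k, X N j ord0 k - X N i ord0 k <= C.
  move=> N2; apply: CP => //; first exact: Xmin.
  have [Y Ye] := averaging rho0 V0 mV Vs N.
  by apply: (le_trans (Xmin N2 Y)); rewrite (le_trans Ye)// EFinM fineK.
split.
  exists (d%:R * `|C|) => N N2; apply: diameter_le => [|i j]; first exact: ltnW.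
  apply: le_trans (enorm_le_norm _) _; rewrite ler_wpM2l//.
  apply: norm_le_coord => // k; rewrite !mxE ler_norml.
  have := spread N N2 i j k; have := spread N N2 j i k; have := ler_norm C.
  by move=> h1 h2 h3; apply/andP; split; lra.
(* The sizes start at 2, since nothing is assumed on X 0 and X 1. *)
have [||phi [a [rho [phim cv low]]]] := @translated_compactness _ _ X (fun n => n.+2) C.
- by move=> n; rewrite ltnW.
- by move=> n; exact: spread.
exists (fun n => (phi n).+2); split => //; exists a, rho; split => // nu.
by apply: low => // n; apply: minimal_energy_le => //; exact: Xmin.
Qed.

Lemma bounded_diameters_not_stable (M : R) :
  (forall n0, exists2 N, (n0 <= N)%N & diameter (range (X N)) <= M) ->
  ~ strictly_stable V Vinf.
Proof.
move=> XM stable.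
have /choice[psi psiP] : forall n, exists N,
    (n < N)%N /\ ((2 <= N)%N /\ diameter (range (X N)) <= M).
  move=> n; have [N nN NM] := XM n.+2.
  by exists N; split; [exact: leq_trans nN|split => //; exact: leq_trans nN].
have [||phi [a [rho [_ _ low]]]] := @translated_compactness _ _ X psi M.
- by move=> n; case: (psiP n).
- move=> n i j k; have [_ [_ /(le_trans (le_diameter _ j i)) h]] := psiP n.
  apply: le_trans h; apply: le_trans (coord_le_enorm _ k).
  by rewrite !mxE ler_norm.
have := stable rho; apply/negP; rewrite -leNgt; apply: low => // n.
have [_ [n2 _]] := psiP n.
by apply: minimal_energy_le_limit; [exact: ltnW|exact: Xmin].
Qed.

End nonnegative_potential.

Theorem theorem1p2 (R : realType) (d : nat) (W : 'rV[R]_d -> \bar R)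
    (Winf : \bar R) (RW : R)
    (d_ge1 : (1 <= d)%N)
    (W_lsc : lower_semicontinuous W)
    (W_lbounded : exists c : R, forall x, (c%:E <= W x)%E)
    (W_locint : locally_integrable_rV W)
    (W_sym : forall x, W (- x) = W x)
    (W_lim : W x @[x --> enorm_infty] --> Winf)
    (Winf_gtNy : (-oo < Winf)%E)
    (RW_gt0 : 0 < RW)
    (W_incr : radially_strictly_increasing RW W)
    (W_AB :
      ((exists c : R, forall x, (W x <= c%:E)%E) /\ upper_semicontinuous W)
      \/
      (exists b : R,
        [/\ 2 < b < d%:R,
            repulsive b W,
            C1_off0 W &
            exists CW : R,
              [/\ 0 < CW,
                  forall x, (laplacian0 W x <= CW%:E)%E,
                  forall x, enorm x <= 1 ->
                    (W x <= CW%:E * sing_pow (enorm x) (2 - b))%E &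
                  forall x, 0 < enorm x <= 1 ->
                    enorm (gradient W x) <= CW * enorm x `^ (1 - b)]])) :
  (forall N : nat, (2 <= N)%N ->
    exists X : 'I_N -> 'rV[R]_d, discrete_minimiser W X) /\
  (forall X : forall N : nat, 'I_N -> 'rV[R]_d,
    (forall N : nat, (2 <= N)%N -> discrete_minimiser W (X N)) ->
    (unstable W Winf ->
      (exists M : R, forall N : nat, (2 <= N)%N ->
        diameter (range (X N)) <= M) /\
      (exists phi : nat -> nat,
        [/\ {homo phi : m n / (m < n)%N},
            forall n, (2 <= phi n)%N &
            exists (a : nat -> 'rV[R]_d) (rho : probability 'rV[R]_d R),
              narrow_cvg
                (fun n => empirical (fun i => X (phi n) i - a (phi n))) rho /\
              minimiser W rho])) /\
    (strictly_stable W Winf ->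
      diameter (range (X N)) @[N --> \oo] --> +oo)).
Proof.
have [c Wc] := W_lbounded; have [mW _] := W_locint.
pose V x := (W x - c%:E)%E; pose Vinf := (Winf - c%:E)%E.
have V0 : forall x, (0 <= V x)%E by exact: shift_ge0.
have mV : measurable_fun setT V by exact: shift_measurable.
have lV : lower_semicontinuous V.
  move=> x a; rewrite lteBrDr// -EFinD => /W_lsc[U Ux UP].
  by exists U => // y /UP; rewrite EFinD lteBrDr.
have Vs x : V (- x) = V x by rewrite /V W_sym.
have Vi : radially_strictly_increasing RW V.
  by move=> x y xR xy; rewrite /V lteD2rE// W_incr.
have Vle x : RW <= enorm x -> (V x <= Vinf)%E by exact: shift_le.
have Vlim r : (r%:E < Vinf)%E -> exists M : R, forall x, M < enorm x -> (r%:E <= V x)%E.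
  exact: shift_gt.
have WV : W = (fun x => V x + c%:E)%E by apply/funext => x; rewrite /V subeK.
have minE N (X : 'I_N -> 'rV[R]_d) : (2 <= N)%N -> discrete_minimiser W X <->
    forall Y : 'I_N -> 'rV[R]_d, (pair_sum V X <= pair_sum V Y)%E.
  move=> N2; rewrite discrete_minimiserP ?(ltnW N2)// WV.
  by split=> XY Y; have := XY Y; rewrite !(@pair_sum_shift R d V c N _ V0) leeD2rE.
(* Subtracting c shifts the threshold Winf / 2 and all energies by the same finite amount c / 2,
   even if Winf = +oo, so stability and instability carry over to V. *)
have WinfV : ((2^-1)%:E * Winf = (2^-1)%:E * Vinf + (2^-1 * c)%:E)%E.
  by rewrite EFinM -muleDr ?fin_num_adde_defl// subeK.
have enE rho : energy W rho = (energy V rho + (2^-1 * c)%:E)%E.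
  by rewrite {1}WV; exact: energy_shift.
have dbl e : 0 <= e -> (e%:E < Vinf)%E -> doubling V e Vinf.
  move=> e0 eV; case: W_AB => [[[C WC] _]|[b [bd rep WC1 [CW [CW0 lap Wup _]]]]].
    exact: doubling_bounded_above eV.
  exact: (doubling_repulsive d_ge1 mW W_lsc Wc RW_gt0 W_incr W_lim bd rep WC1 CW0 lap Wup).
split=> [N N2|X XminW].
  have [X XP] := minimiser_exists V0 RW_gt0 Vi d_ge1 (ltnW N2) lV.
  by exists X; apply/minE.
have Xmin N : (2 <= N)%N -> forall Y : 'I_N -> 'rV[R]_d, (pair_sum V (X N) <= pair_sum V Y)%E.
  by move=> N2; apply/minE => //; exact: XminW.
split=> [[rho rhoW]|stable].
  have [|diam [phi [phim phi2 [a [mu [cv mumin]]]]]] :=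
    unstable_compactness V0 lV mV Vs RW_gt0 Vi Xmin Vlim dbl.
    by exists rho; move: rhoW; rewrite enE WinfV lteD2rE.
  split; first exact: diam.
  exists phi; split; [exact: phim|exact: phi2|exists a, mu; split; first exact: cv].
  by move=> nu; rewrite !enE leeD2rE.
(* If the diameters do not tend to infinity, some A bounds them for arbitrarily large N. *)
apply/cvgryPge => A; apply: contrapT => notA.
apply: (@bounded_diameters_not_stable _ _ d_ge1 V RW Vinf V0 lV mV RW_gt0 Vle X Xmin A).
  move=> n0; apply: contrapT => no; apply: notA; exists n0 => // N /= n0N.
  by rewrite leNgt; apply/negP => NA; apply: no; exists N => //; exact: ltW.
by move=> rho; have := stable rho; rewrite enE WinfV lteD2rE.
Qed.
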